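(* Let $n\ge3$, $\alpha<1$, $M>0$, and let $u=P_\alpha[\phi]$ in $\mathbb{B}^n$ with $\phi\in L^\infty(\mathbb{S}^{n-1},\mathbb{R}^n)$, $\|\phi\|_{L^\infty(\mathbb{S}^{n-1},\mathbb{R}^n)}\le M$. Suppose $u(0)=0$ and $J_u(0)=1$. Let $r_0\in(0,1)$ be the smallest positive root of $$M^n\, r\, G(r)=\Big(\frac{\sqrt\pi\,\Gamma(\frac{n+1}{2})}{(n-\alpha)C_{n,\alpha}\Gamma(\frac n2)}\Big)^{n-1}.$$ Then $u$ is univalent in $\mathbb{B}^n(r_0)$ and $u(\mathbb{B}^n(r_0))\supset\mathbb{B}^n(R_0)$, where $R_0=\frac M2 r_0^2 G(r_0)$.
   Context: $n\ge3$; $\mathbb{B}^n(r)=\{x\in\mathbb{R}^n:|x|<r\}$, $\mathbb{B}^n=\mathbb{B}^n(1)$, $\mathbb{S}^{n-1}$ the unit sphere with normalized surface measure $\sigma$. For $\alpha<1$, $P_\alpha(x,\zeta)=C_{n,\alpha}\frac{(1-|x|^2)^{1-\alpha}}{|x-\zeta|^{n-\alpha}}$ with $C_{n,\alpha}=\frac{\Gamma(\frac{n-\alpha}{2})\Gamma(1-\frac\alpha2)}{\Gamma(\frac n2)\Gamma(1-\alpha)}$, and for vector-valued $\phi$, $P_\alpha[\phi](x)=\int_{\mathbb{S}^{n-1}}P_\alpha(x,\zeta)\phi(\zeta)\,d\sigma(\zeta)$ (componentwise). $\|\phi\|_{L^\infty}$ is the essential supremum of $|\phi|$. $J_u(x)=\det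 Du(x)$ is the Jacobian determinant. For $r\in[0,1)$, $$G(r)=\frac{2(1-\alpha)C_{n,\alpha}}{1-r^2}\max_{0\le t\le r}{}_2F_1\Big(\tfrac\alpha2,\tfrac{n+\alpha}{2}-1;\tfrac n2;t^2\Big)+\frac{(n-\alpha)C_{n,\alpha}}{(1-r^2)^2}\max_{0\le t\le r}{}_2F_1\Big(\tfrac\alpha2-1,\tfrac{n+\alpha}{2}-2;\tfrac n2;t^2\Big)$$ $$+\frac{(n-\alpha)C_{n,\alpha}}{(1-r^2)^{3-\alpha}}\max_{0\le t\le r}\Big\{{}_2F_1\Big(\tfrac\alpha2-1,\tfrac{n+\alpha}{2}-2;\tfrac n2;t^2\Big)g(t)\Big\},$$ where $g(t)=\big(2(1+t^2)^{\frac{n+2-\alpha}{2}}-(1-t)^{n+2-\alpha}-(1-t^2)^{1-\alpha}\big)/t$ for $t\in(0,1)$ and $g(0)=n+2-\alpha$. ${}_2F_1$ is the Gauss hypergeometric series. *)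

(* Defs.v *)
From HB Require Import structures.
From mathcomp Require Import all_boot all_order all_algebra.
From mathcomp Require Import all_classical all_reals all_analysis.
Set Implicit Arguments.
Unset Strict Implicit.
Unset Printing Implicit Defensive.
Import Order.TTheory GRing.Theory Num.Theory.
Import numFieldNormedType.Exports.
Local Open Scope classical_set_scope.
Local Open Scope ring_scope.

Section Defs.
Variable R : realType.

Definition enorm (n : nat) (x : 'rV[R]_n) : R := Num.sqrt (\sum_(i < n) x 0 i ^+ 2).

Definition m1p1 : set R := `]-1, 1[%classic.
Definition pos_half : set R := `]0, +oo[%classic.

Definition Gamma (s : R) : R :=
  fine (\int[@lebesgue_measure R]_(t in pos_half)
          ((t `^ (s - 1)) * expR (- t))%:E)%E.

Definition poch (a : R) (k : nat) : R := \prod_(i < k) (a + i%:R).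
Definition hyp2F1 (a b c z : R) : R :=
  limn (series (fun k : nat => poch a k * poch b k / (poch c k * (k`!)%:R) * z ^+ k)).

(** Normalized surface measure on S^{k} in R^(k+1), defined via the slice
    formula: for zeta = (t, sqrt(1-t^2) eta), eta in S^{k-1},
    d sigma_k = c (1-t^2)^((k-2)/2) dt d sigma_(k-1)(eta),
    c the normalizing constant; and sigma_0 = (delta_1 + delta_(-1))/2. *)
Fixpoint sphere_int (k : nat) : ('rV[R]_k.+1 -> \bar R) -> \bar R :=
  match k return ('rV[R]_k.+1 -> \bar R) -> \bar R with
  | 0 => fun f => ((f (1%:M) + f ((-1)%:M)) * (2^-1)%:E)%E
  | k'.+1 => fun f =>
      let w := fun t : R => (1 - t ^+ 2) `^ ((k'%:R - 1) / 2) in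
      let c := (fine (\int[@lebesgue_measure R]_(t in m1p1) (w t)%:E)%E)^-1 in
      (c%:E * \int[@lebesgue_measure R]_(t in m1p1)
          ((w t)%:E *
             sphere_int (fun eta : 'rV[R]_k'.+1 =>
               f (row_mx (t%:M : 'rV[R]_1) (Num.sqrt (1 - t ^+ 2) *: eta)))))%E
  end.

Definition sphere_integral (n : nat) : ('rV[R]_n -> \bar R) -> \bar R :=
  match n return ('rV[R]_n -> \bar R) -> \bar R with
  | 0 => fun _ => 0%E
  | k.+1 => @sphere_int k
  end.

Definition sigma (n : nat) (E : set 'rV[R]_n) : \bar R :=
  sphere_integral (fun z => (\1_E z)%:E).

Definition unit_sphere (n : nat) : set 'rV[R]_n := [set z | enorm z = 1].

(** identification of n-tuples (which carry the product = Borel sigma-algebra)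
    with row vectors *)
Definition to_rV (n : nat) (t : n.-tuple R) : 'rV[R]_n := \row_i tnth t i.

Definition Linfty_sphere_bounded (n : nat) (phi : 'rV[R]_n -> 'rV[R]_n) (M : R) : Prop :=
  (forall i : 'I_n, measurable_fun (@to_rV n @^-1` (@unit_sphere n))
                       (fun t : n.-tuple R => phi (to_rV t) 0 i)) /\
  sigma [set z | M < enorm (phi z)] = 0%E.

Definition Cna (n : nat) (alpha : R) : R :=
  Gamma ((n%:R - alpha) / 2) * Gamma (1 - alpha / 2) /
  (Gamma (n%:R / 2) * Gamma (1 - alpha)).

Definition Pker (n : nat) (alpha : R) (x zeta : 'rV[R]_n) : R :=
  Cna n alpha * (1 - enorm x ^+ 2) `^ (1 - alpha) /
  (enorm (x - zeta)) `^ (n%:R - alpha).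

Definition Palpha (n : nat) (alpha : R) (phi : 'rV[R]_n -> 'rV[R]_n) (x : 'rV[R]_n)
  : 'rV[R]_n :=
  \row_i fine (sphere_integral (fun zeta => (Pker alpha x zeta * phi zeta 0 i)%:E)).

Definition jacobian (n : nat) (u : 'rV[R]_n -> 'rV[R]_n) (x : 'rV[R]_n) : 'M[R]_n :=
  \matrix_(i, j) ('D_(delta_mx 0 j) u x) 0 i.
Definition Jdet (n : nat) (u : 'rV[R]_n -> 'rV[R]_n) (x : 'rV[R]_n) : R :=
  \det (jacobian u x).

(** max over [0, r] (a supremum of a continuous function on a compact). *)
Definition maxOn (f : R -> R) (r : R) : R := sup [set f t | t in `[0, r]%classic].

Definition gfun (n : nat) (alpha t : R) : R :=
  if t == 0 then n%:R + 2 - alpha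
  else (2 * (1 + t ^+ 2) `^ ((n%:R + 2 - alpha) / 2)
        - (1 - t) `^ (n%:R + 2 - alpha) - (1 - t ^+ 2) `^ (1 - alpha)) / t.

Definition Gfun (n : nat) (alpha r : R) : R :=
  let C := Cna n alpha in
  let F1 := fun t : R => hyp2F1 (alpha / 2) ((n%:R + alpha) / 2 - 1) (n%:R / 2) (t ^+ 2) in
  let F2 := fun t : R => hyp2F1 (alpha / 2 - 1) ((n%:R + alpha) / 2 - 2) (n%:R / 2) (t ^+ 2) in
  2 * (1 - alpha) * C / (1 - r ^+ 2) * maxOn F1 r
  + (n%:R - alpha) * C / (1 - r ^+ 2) ^+ 2 * maxOn F2 r
  + (n%:R - alpha) * C / (1 - r ^+ 2) `^ (3 - alpha)
      * maxOn (fun t => F2 t * gfun n alpha t) r.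

Definition Kconst (n : nat) (alpha : R) : R :=
  (Num.sqrt pi * Gamma ((n%:R + 1) / 2) /
   ((n%:R - alpha) * Cna n alpha * Gamma (n%:R / 2))) ^+ n.-1.

End Defs.

(* Main.v *)
(** For a bounded boundary function the map u = P_alpha[phi] is compared with its
    differential A at 0. The difference of the gradients of the kernel at x and at 0
    is integrated over the sphere: its first two terms are zonal integrals of powers
    of |x - zeta|, which solve the hypergeometric differential equation and hence equal
    (1 - r^2)^(...) times the series in G; the third is a mean of |1 - b |x - zeta|^(-p)|,
    estimated by folding opposite heights. Thus
    |u(x) - u(y) - A(x - y)| <= M rho G(r0) |x - y| on the ball of radius rho <= r0, and
    |u(x) - A x| <= M G(r0) |x|^2 / 2.
    The norm of A is at most M (n - alpha) C times the mean of |zeta_1|, so det A = 1 and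
    Hadamard's inequality give |A v| >= M r0 G(r0) |v|, by the equation defining r0.
    Univalence follows at once, and Newton's map for A yields the covered ball. *)
Require Import Defs.
From HB Require Import structures.
From mathcomp Require Import all_boot all_order all_algebra.
From mathcomp Require Import all_classical all_reals all_analysis.
From mathcomp Require Import measurable_realfun.
From mathcomp Require Import ring lra.
Set Implicit Arguments.
Unset Strict Implicit.
Unset Printing Implicit Defensive.
Import Order.TTheory GRing.Theory Num.Theory.
Import numFieldNormedType.Exports.
Local Open Scope classical_set_scope.
Local Open Scope ring_scope.

(** * Integrals against the weights (1 - t^2)^e *)

Section FTC.
Context {R : realType}.
Notation mu := (@lebesgue_measure R).

(** [sphere_int] slices along the first coordinate only, so rotation invariance is not visible in
    it, while the estimates need integrals that are zonal about the direction of x. It is recovered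
    from moments: powers of a linear form are integrated by induction on the dimension, and
    polynomial approximation passes to continuous functions. The gradient terms along x carry a
    factor |x|; the one along zeta must get it from the mean of |1 - b |x - zeta|^(-p)|, where r
    g(r) is the bracket of the estimate. Euler's transformation is what puts powers of 1 - r^2 in
    front of the series. Maxima over [0, r] occur in G so that the one constant M G(r0) serves every
    smaller radius. If L is the bound for the norm of A, the right-hand side of the equation for r0
    is (M / L)^(n - 1); hence M r0 G(r0) = L^(1 - n), the lower bound for |A v| / |v|. The factor
    1/2 in R_0 reflects that the gradient difference at s x grows linearly in s on [0, 1]. *)

Lemma integrable_FTC2 (f F : R -> R) (a b : R) : a < b ->
  mu.-integrable `[a, b] (EFin \o f) ->
  {in `]a, b[, continuous f} ->
  {within `[a, b], continuous F} ->
  (forall x, x \in `]a, b[ -> is_derive x 1 F (f x)) ->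
  \int[mu]_(x in `[a, b]) f x = F b - F a.
Proof.
move=> ab intf cf cF dF.
(* The integrand may blow up at both ends, as (1 - t^2)^e does for e < 0. So F is compared with the
   indefinite integral, which is continuous up to the ends: F - G has zero derivative inside. *)
pose G x := \int[mu]_(t in `[a, x]) f t.
have dG x : x \in `]a, b[ -> is_derive x 1 G (f x).
  move=> xab; have [] := continuous_FTC1_closed _ intf _ (cf x xab).
  - by rewrite (itvP xab).
  - by rewrite (itvP xab).
  by move=> dG G'; apply: DeriveDef; [exact: dG|rewrite -derive1E; exact: G'].
have cG := parameterized_integral_continuous (ltW ab) intf.
have [||c _] := @MVT R (F \- G) (fun=> 0) a b ab.
- move=> x xab; have := dF x xab; have := dG x xab => ? ?.
  by rewrite -(subrr (f x)); apply: is_deriveB.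
- by move=> x; apply: continuousB; [exact: cF|exact: cG].
rewrite mul0r /= => /eqP; rewrite {2}/G set_itv1 Rintegral_set1 subr0 => /eqP.
by rewrite /G; lra.
Qed.

Lemma Rintegral_oo_cc (f : R -> R) (a b : R) : mu.-integrable `]a, b[ (EFin \o f) ->
  mu.-integrable `[a, b] (EFin \o f) /\
  \int[mu]_(t in `]a, b[) f t = \int[mu]_(t in `[a, b]) f t.
Proof.
move=> fi; have mf : measurable_fun (`[a, b] : set R) f.
  have /integrableP[/measurable_EFinP mf _] := fi.
  apply/measurable_fun_itv_bndo_bndcP.
  exact/measurable_fun_itv_obnd_cbndP.
have fi1 : mu.-integrable `[a, b] (EFin \o f).
  apply/integrableP; split; first exact/measurable_EFinP.
  have /integrableP[_] := fi; apply: le_lt_trans.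
  rewrite -integral_itv_bndo_bndc; last first.
    apply/measurable_EFinP/measurableT_comp => //.
    by apply: measurable_funS mf => //; apply: subset_itvl; rewrite bnd_simp.
  rewrite -integral_itv_obnd_cbnd// .
  apply/measurable_EFinP/measurableT_comp => //.
  by apply: measurable_funS mf => //; apply: subset_itvW; rewrite ?bnd_simp.
have fi' : mu.-integrable `[a, b[ (EFin \o f).
  by apply: integrableS fi1 => //; apply: subset_itvl; rewrite bnd_simp.
split => //.
by rewrite -Rintegral_itv_bndo_bndc// -Rintegral_itv_obnd_cbnd.
Qed.

Lemma integrable_FTC2_oo (f F : R -> R) (a b : R) : a < b ->
  mu.-integrable `]a, b[ (EFin \o f) ->
  {in `]a, b[, continuous f} ->
  {within `[a, b], continuous F} ->
  (forall x, x \in `]a, b[ -> is_derive x 1 F (f x)) ->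
  \int[mu]_(x in `]a, b[) f x = F b - F a.
Proof.
move=> ab /Rintegral_oo_cc[fi ->] cf cF dF.
exact: integrable_FTC2.
Qed.

(** [powR] has a default value on negative bases; composing with the absolute value gives a function
    continuous on the whole line that agrees with x^e for x >= 0. *)
Lemma continuous_powR_norm (e : R) : 0 < e ->
  continuous (fun x : R => `|x| `^ e).
Proof.
move=> e0 x; have [->|x0] := eqVneq x 0.
  rewrite /continuous_at normr0 powR0 ?gt_eqF//.
  apply/cvgrPdist_lt => eps eps0; near=> y.
  rewrite sub0r normrN ger0_norm ?powR_ge0//.
  have -> : eps = (eps `^ e^-1) `^ e.
    by rewrite -powRrM mulVf ?gt_eqF// powRr1// ltW.
  apply: gt0_ltr_powR; rewrite ?nnegrE ?powR_ge0//.
  by near: y; exact: (@nbhs0_lt _ R^o (eps `^ e^-1) (powR_gt0 _ eps0)).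
apply: (@continuous_comp _ _ _ (fun x : R => `|x|) (fun x => x `^ e)).
  exact: norm_continuous.
apply/differentiable_continuous/derivable1_diffP.
by apply: derivable_powR; rewrite in_itv/= andbT normr_gt0.
Unshelve. all: by end_near. Qed.

Lemma continuous_asin_within : {within `[(-1)%R, 1%R], continuous (@asin R)}.
Proof.
have := @segment_can_le_continuous R (- (pi / 2)) (pi / 2) sin asin.
rewrite sinN sin_pihalf; apply.
- by rewrite ge0_cp// divr_ge0// pi_ge0.
- by apply: continuous_subspaceT; exact: continuous_sin.
- exact: sinK.
Qed.

Lemma asin1 : asin 1 = pi / 2 :> R.
Proof.
have p0 := pi_ge0 R.
have := @sinK R (pi / 2); rewrite sin_pihalf; apply.
by rewrite in_itv/=; apply/andP; split; lra.
Qed.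

Lemma asinN1 : asin (-1) = - (pi / 2) :> R.
Proof.
have p0 := pi_ge0 R.
have := @sinK R (- (pi / 2)); rewrite sinN sin_pihalf; apply.
by rewrite in_itv/=; apply/andP; split; lra.
Qed.

Lemma one_minus_sqr_gt0 (t : R) : m1p1 t -> 0 < 1 - t ^+ 2.
Proof. by rewrite /m1p1/= in_itv/= => /andP[? ?]; nra. Qed.

Definition wt (e t : R) : R := (1 - t ^+ 2) `^ e.

Lemma wt_ge0 e t : 0 <= wt e t. Proof. exact: powR_ge0. Qed.

Lemma measurable_m1p1 : measurable (@m1p1 R).
Proof. exact: measurable_itv. Qed.

Lemma measurable_wt (D : set R) e : measurable_fun D (wt e).
Proof.
apply: measurable_funTS.
apply: (measurableT_comp (measurable_powR e)).
by apply: measurable_funB => //; exact: exprn_measurable.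
Qed.

Lemma is_derive_wt (e t : R) : m1p1 t ->
  is_derive t 1 (wt e) (- 2 * e * t * wt (e - 1) t).
Proof.
move=> /one_minus_sqr_gt0 t0.
have d1 : is_derive t 1 (fun t : R => 1 - t ^+ 2) (- 2 * t).
  by apply: is_derive_eq; rewrite /GRing.scale/=; ring.
have d2 := is_derive1_powR e t0.
apply: is_derive_eq; first exact: (@is_derive1_comp R _ (fun t : R => 1 - t ^+ 2) _ _ _ d2 d1).
by rewrite /wt /GRing.scale/=; ring.
Qed.

Lemma continuous_wt e t : m1p1 t -> {for t, continuous (wt e)}.
Proof.
move=> tm; apply/differentiable_continuous/derivable1_diffP.
by case: (is_derive_wt e tm).
Qed.

(** A primitive is asin, whose increment over a symmetric interval inside (-1, 1) never exceeds pi.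
    Exhausting (-1, 1) by such intervals gives the integrability of the most singular weight
    needed. *)
Lemma integral_wtNhalf_le (x : R) : 0 <= x < 1 ->
  (\int[mu]_(t in `[(- x)%R, x]) (wt (- 2^-1) t)%:E <= pi%:E)%E.
Proof.
move=> /andP[x0 x1].
have [->|xn0] := eqVneq x 0.
  by rewrite oppr0 set_itv1 integral_set1 lee_fin pi_ge0.
have xp : 0 < x by rewrite lt_neqAle eq_sym xn0.
have sub t : t \in `[(- x)%R, x] -> m1p1 t.
  by rewrite /m1p1/= !in_itv/= => /andP[? ?]; apply/andP; split; lra.
rewrite (@continuous_FTC2 _ _ asin).
- rewrite -EFinB lee_fin.
  have := @asin_lepi2 R x; have := @asin_geNpi2 R (- x).
  have -> : -1 <= x <= 1 by apply/andP; split; lra.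
  have -> : -1 <= - x <= 1 by apply/andP; split; lra.
  by move=> /(_ isT) ? /(_ isT); lra.
- lra.
- apply: continuous_in_subspaceT => t /set_mem/= tx.
  by apply: continuous_wt; exact: sub.
- split.
  + move=> t tx; have /is_derive1_asin[] // : -1 < t < 1.
    by have := sub t (subset_itv_oo_cc tx); rewrite /m1p1/= in_itv.
  + apply: cvg_at_right_filter; apply: continuous_asin; apply/andP; split; lra.
  + apply: cvg_at_left_filter; apply: continuous_asin; apply/andP; split; lra.
- move=> t tx; have tm := sub t (subset_itv_oo_cc tx).
  have /is_derive1_asin[_] : -1 < t < 1 by move: tm; rewrite /m1p1/= in_itv.
  rewrite derive1E => ->; rewrite /wt powRN powR12_sqrt// ltW//.
  exact: one_minus_sqr_gt0.
Qed.

Lemma m1p1_bigcup :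
  @m1p1 R = \bigcup_n `[(- (1 - n.+1%:R^-1))%R, (1 - n.+1%:R^-1)%R]%classic.
Proof.
apply/seteqP; split => t.
  rewrite /m1p1/= in_itv/= => /andP[t1 t2].
  have t0 : 0 < 1 - `|t| by rewrite subr_gt0 ltr_norml; apply/andP; split.
  have [n nP] := ltr_add_invr t0.
  exists n => //=.
  by move: nP; rewrite add0r in_itv/= -ler_norml => nP; rewrite lerBrDl -lerBrDr ltW.
move=> [n _] /=; rewrite in_itv/= -ler_norml => tn.
by rewrite /m1p1/= in_itv/= -ltr_norml (le_lt_trans tn)// ltrBlDr ltrDl invr_gt0.
Qed.

Lemma integral_wtNhalf_lty :
  (\int[mu]_(t in @m1p1 R) (wt (- 2^-1) t)%:E < +oo)%E.
Proof.
apply: (@le_lt_trans _ _ pi%:E); last exact: ltry.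
rewrite m1p1_bigcup.
have H : (\int[mu]_(t in `[(- (1 - n.+1%:R^-1))%R, (1 - n.+1%:R^-1)%R])
    (wt (- 2^-1) t)%:E)%E @[n --> \oo] -->
    (\int[mu]_(t in \bigcup_n `[(- (1 - n.+1%:R^-1))%R, (1 - n.+1%:R^-1)%R]%classic)
    (wt (- 2^-1) t)%:E)%E.
  apply: ge0_nondecreasing_set_cvg_integral => //.
  - move=> m n mn; apply/subsetPset => t /=; rewrite !in_itv/= -!ler_norml.
    move=> /le_trans; apply; rewrite lerB// lef_pV2 ?posrE// ler_nat//.
  - by move=> n; apply/measurable_EFinP; exact: measurable_wt.
  - by move=> n x _; rewrite lee_fin wt_ge0.
apply: (cvge_le _ H) => //; apply: nearW => n.
apply: integral_wtNhalf_le; rewrite subr_ge0 ltrBlDr ltrDl invr_gt0 ltr0n andbT.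
by rewrite invf_le1// ler1n.
Qed.

(** Since 0 < 1 - t^2 <= 1, the weight decreases with e, so the exponent -1/2 dominates all larger
    ones. It is the exponent of the circle, the lowest sphere that is sliced. *)
Lemma wt_integrable e : - 2^-1 <= e ->
  mu.-integrable (@m1p1 R) (EFin \o wt e).
Proof.
move=> e2; apply: (@le_integrable _ _ _ mu _ measurable_m1p1 _
    (EFin \o wt (- 2^-1))).
- by apply/measurable_EFinP; exact: measurable_wt.
- move=> t tm /=; rewrite lee_fin !ger0_norm ?wt_ge0//.
  have t0 := one_minus_sqr_gt0 tm.
  by apply: ger_powR => //; rewrite t0/= lerBlDr lerDl sqr_ge0.
apply/integrableP; split.
  by apply/measurable_EFinP; exact: measurable_wt.
apply: le_lt_trans integral_wtNhalf_lty.
by apply: ge0_le_integral => //=; [exact: measurable_m1p1|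
  apply/measurable_EFinP/measurableT_comp => //; exact: measurable_wt|
  apply/measurable_EFinP; exact: measurable_wt|
  move=> t _; rewrite lee_fin ger0_norm// wt_ge0].
Qed.

(** The class is an algebra, and membership settles every integrability condition against the
    weights. *)
Definition mbd (g : R -> R) := measurable_fun (@m1p1 R) g /\
  exists B, forall t, m1p1 t -> `|g t| <= B.

Lemma wtM_integrable e g : - 2^-1 <= e -> mbd g ->
  mu.-integrable (@m1p1 R) (EFin \o (fun t => wt e t * g t)).
Proof.
move=> e2 [mg [B Bg]].
apply: (@le_integrable _ _ _ mu _ measurable_m1p1 _
    (fun t => B%:E * (EFin \o wt e) t)%E); last first.
- by apply: integrableZl; [exact: measurable_m1p1|exact: wt_integrable].
- move=> t tm /=; rewrite lee_fin !normrM mulrC ler_wpM2r//.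
  exact: le_trans (Bg _ tm) (ler_norm _).
- apply/measurable_EFinP; apply: measurable_funM => //; exact: measurable_wt.
Qed.

Definition wI (e : R) (g : R -> R) : R := \int[mu]_(t in @m1p1 R) (wt e t * g t).

Lemma wI_D e f g : - 2^-1 <= e -> mbd f -> mbd g ->
  wI e (fun t => f t + g t) = wI e f + wI e g.
Proof.
move=> e2 mf mg; rewrite /wI -RintegralD.
- by apply: eq_Rintegral => t _; rewrite mulrDr.
- exact: measurable_m1p1.
- exact: wtM_integrable.
- exact: wtM_integrable.
Qed.

Lemma wI_Z e k g : - 2^-1 <= e -> mbd g ->
  wI e (fun t => k * g t) = k * wI e g.
Proof.
move=> e2 mg; rewrite /wI -RintegralZl.
- by apply: eq_Rintegral => t _; rewrite mulrCA.
- exact: measurable_m1p1.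
- exact: wtM_integrable.
Qed.

Lemma le_wI e f g : - 2^-1 <= e -> mbd f -> mbd g ->
  (forall t, m1p1 t -> f t <= g t) -> wI e f <= wI e g.
Proof.
move=> e2 mf mg fg; apply: le_Rintegral.
- exact: measurable_m1p1.
- exact: wtM_integrable.
- exact: wtM_integrable.
- by move=> t tm; rewrite ler_wpM2l ?wt_ge0// fg.
Qed.

Lemma eq_wI e f g : (forall t, m1p1 t -> f t = g t) -> wI e f = wI e g.
Proof.
by move=> fg; apply: eq_Rintegral => t /set_mem tm; rewrite fg.
Qed.

Lemma mbdD f g : mbd f -> mbd g -> mbd (fun t => f t + g t).
Proof.
move=> [mf [B fB]] [mg [C gC]]; split; first exact: measurable_funD.
by exists (B + C) => t tm; rewrite (le_trans (ler_normD _ _))// lerD// ?fB ?gC.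
Qed.

Lemma mbdM f g : mbd f -> mbd g -> mbd (fun t => f t * g t).
Proof.
move=> [mf [B fB]] [mg [C gC]]; split; first exact: measurable_funM.
by exists (B * C) => t tm; rewrite normrM ler_pM// ?fB ?gC.
Qed.

Lemma mbd_cst k : mbd (fun=> k).
Proof. by split; [exact: measurable_cst|exists `|k|]. Qed.

Lemma mbd_id : mbd id.
Proof.
split; first exact: measurable_id.
exists 1 => t; rewrite /m1p1/= in_itv/= => /andP[? ?].
by rewrite ler_norml; apply/andP; split; lra.
Qed.

Lemma mbdX f k : mbd f -> mbd (fun t => f t ^+ k).
Proof.
move=> mf; elim: k => [|k ih].
  by under eq_fun do rewrite expr0; exact: mbd_cst.
by under eq_fun do rewrite exprS; exact: mbdM.
Qed.

Lemma mbdN f : mbd f -> mbd (fun t => - f t).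
Proof.
move=> mf; under eq_fun do rewrite -mulN1r.
by apply: mbdM => //; exact: mbd_cst.
Qed.

Lemma mbdB f g : mbd f -> mbd g -> mbd (fun t => f t - g t).
Proof. by move=> mf mg; apply: mbdD => //; exact: mbdN. Qed.

Lemma mbd_continuous (f : R -> R) : continuous f -> mbd f.
Proof.
move=> cf; split; first by apply: measurable_funTS; exact: continuous_measurable_fun.
have [c1 _ c1P] := @EVT_max R (fun t => `|f t|) (-1) 1 ltac:(lra)
  ltac:(apply: continuous_subspaceT => x; apply: continuous_comp;
        [exact: cf|exact: norm_continuous]).
exists `|f c1| => t; rewrite /m1p1/= in_itv/= => /andP[? ?].
by apply: c1P; rewrite in_itv/=; apply/andP; split; lra.
Qed.

Lemma wI_B e f g : - 2^-1 <= e -> mbd f -> mbd g ->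
  wI e (fun t => f t - g t) = wI e f - wI e g.
Proof.
move=> e2 mf mg; rewrite wI_D//; last exact: mbdN.
congr (_ + _); rewrite -mulN1r -wI_Z//; apply: eq_wI => t _.
by rewrite mulN1r.
Qed.

Lemma continuous_wt_closed e : 0 < e ->
  {within `[(-1)%R, 1%R], continuous (wt e)}.
Proof.
move=> e0; pose h (t : R) := `|1 - t ^+ 2| `^ e.
have ch : continuous h.
  move=> t; apply: (@continuous_comp _ _ _ (fun t : R => 1 - t ^+ 2)
    (fun x => `|x| `^ e)).
    by apply: continuousB; [exact: cst_continuous|exact: exprn_continuous].
  exact: continuous_powR_norm.
apply: (@subspace_eq_continuous _ _ _ h); last exact: continuous_subspaceT.
move=> t /set_mem/=; rewrite in_itv/= => /andP[? ?].
by rewrite /h /wt ger0_norm//; nra.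
Qed.

End FTC.

(** * Integration by parts, moments and masses of the weights *)

Section WeightMoments.
Context {R : realType}.
Notation mu := (@lebesgue_measure R).
Implicit Types e : R.
Lemma wI_FTC e (g F : R -> R) : - 2^-1 <= e -> mbd g ->
  (forall t, m1p1 t -> {for t, continuous g}) ->
  {within `[(-1)%R, 1%R], continuous F} ->
  (forall t, m1p1 t -> is_derive t 1 F (wt e t * g t)) ->
  wI e g = F 1 - F (-1).
Proof.
move=> e2 mg cg cF dF.
have lt11 : (-1 : R) < 1 by lra.
have fi := wtM_integrable e2 mg.
have cf : {in `](-1)%R, 1%R[, continuous (fun t => wt e t * g t)}.
  by move=> t tm; apply: continuousM; [exact: continuous_wt|exact: cg].
exact (integrable_FTC2_oo lt11 fi cf cF dF).
Qed.

(** The integrand times the weight is the derivative of (1 - t^2)^(e + 1) g, which vanishes at both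
    ends because e + 1 > 0. The moment recursion and a relation between zonal integrals are both
    instances. *)
Lemma wI_by_parts (e : R) (g g' : R -> R) : - 2^-1 <= e ->
  (forall t : R, t \in `[(-1)%R, 1%R] -> is_derive t 1 g (g' t)) ->
  (forall t, m1p1 t -> {for t, continuous g'}) -> mbd g' -> mbd g ->
  wI e (fun t => (1 - t ^+ 2) * g' t - 2 * (e + 1) * t * g t) = 0.
Proof.
move=> e2 dg cg' mg' mg.
have mf : mbd (fun t => (1 - t ^+ 2) * g' t - 2 * (e + 1) * t * g t).
  apply: mbdB; apply: mbdM => //.
  - by apply: mbdB; [exact: mbd_cst|apply: mbdX; exact: mbd_id].
  - by apply: mbdM; [exact: mbd_cst|exact: mbd_id].
pose F t := wt (e + 1) t * g t.
have lt11 : (-1 : R) < 1 by lra.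
have F10 : F 1 = 0 by rewrite /F /wt expr1n subrr powR0 ?mul0r// gt_eqF//; lra.
have FN10 : F (-1) = 0.
  by rewrite /F /wt sqrrN expr1n subrr powR0 ?mul0r// gt_eqF//; lra.
have cF : {within `[(-1)%R, 1%R], continuous F}.
  move=> t; apply: continuousM.
    by apply: continuous_wt_closed; lra.
  apply: derivable_within_continuous => {}t tm.
  by have [] := dg _ tm.
have dF t : m1p1 t -> is_derive t 1 F
    (wt e t * ((1 - t ^+ 2) * g' t - 2 * (e + 1) * t * g t)).
  move=> tm; have ? := is_derive_wt (e + 1) tm.
  have ? := dg _ (subset_itv_oo_cc tm).
  apply: is_derive_eq; rewrite /GRing.scale/= addrK.
  have -> : wt (e + 1) t = (1 - t ^+ 2) * wt e t.
    rewrite /wt powRD ?powRr1 1?mulrC//.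
      by rewrite ltW// one_minus_sqr_gt0.
    by rewrite (gt_eqF (one_minus_sqr_gt0 tm)) implybT.
  ring.
move: F F10 FN10 cF dF => F F10 FN10 cF dF.
rewrite (wI_FTC e2 mf _ cF dF) ?F10 ?FN10 ?subr0// => t tm.
have cg : {for t, continuous g}.
  apply/differentiable_continuous/derivable1_diffP.
  by have [] := dg _ (subset_itv_oo_cc tm).
have ct : {for t, continuous (@id R)} by [].
apply: continuousB; apply: continuousM => //.
- by apply: continuousB; [exact: cst_continuous|exact: exprn_continuous].
- exact: cg'.
- by apply: continuousM => //; exact: cst_continuous.
Qed.

Lemma wI_succ e g : wI (e + 1) g = wI e (fun t => (1 - t ^+ 2) * g t).
Proof.
apply: eq_Rintegral => t /set_mem tm.
rewrite mulrA; congr (_ * _); rewrite /wt powRD ?powRr1//.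
  by rewrite ltW// one_minus_sqr_gt0.
by rewrite (gt_eqF (one_minus_sqr_gt0 tm)) implybT.
Qed.

Lemma wI_moment_rec e j : - 2^-1 <= e ->
  (j%:R + 2 * e + 3) * wI e (fun t => t ^+ j.+2) =
  j.+1%:R * wI e (fun t => t ^+ j).
Proof.
move=> e2.
have := @wI_by_parts e (fun t => t ^+ j.+1) (fun t => j.+1%:R * t ^+ j) e2.
have mX k : mbd (fun t : R => t ^+ k) by apply: mbdX; exact: mbd_id.
move=> /(_ _ _ (mbdM (mbd_cst _) (mX _)) (mX _)) H.
have {}H : wI e (fun t : R => (1 - t ^+ 2) * (j.+1%:R * t ^+ j) -
    2 * (e + 1) * t * t ^+ j.+1) = 0.
  apply: H.
    move=> t _.
    have d : is_derive t 1 ((@id R) ^+ j.+1) (j.+1%:R * t ^+ j).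
      by apply: is_derive_eq; rewrite /GRing.scale/= mulr1 mulr_natl.
    rewrite (_ : (fun t : R => _) = id ^+ j.+1)//.
    by apply/funext => z; rewrite fctE.
  by move=> t _; apply: cvgM; [exact: cvg_cst|exact: exprn_continuous].
rewrite (_ : wI e _ = wI e (fun t => j.+1%:R * t ^+ j -
   (j%:R + 2 * e + 3) * t ^+ j.+2)) in H; last first.
  by apply: eq_wI => t _; rewrite !exprS -natr1; ring.
move: H; rewrite wI_B// ?wI_Z//; last 2 first.
- by apply: mbdM => //; exact: mbd_cst.
- by apply: mbdM => //; exact: mbd_cst.
by move=> /eqP; rewrite subr_eq0 => /eqP.
Qed.

(** The moment recursion for j = 0, with t^2 = 1 - (1 - t^2). *)
Lemma wI_succ1 e : - 2^-1 <= e ->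
  (2 * e + 3) * wI (e + 1) (fun=> 1) = (2 * e + 2) * wI e (fun=> 1).
Proof.
move=> e2; have := wI_moment_rec 0 e2.
rewrite (_ : (@GRing.exp R)^~ 0%N = fun=> 1); last exact/funext.
rewrite wI_succ (_ : wI e (fun t => _ * 1) = wI e (fun=> 1) - wI e (fun t => t ^+ 2)).
  by rewrite mul1r add0r; lra.
rewrite -wI_B//; last 2 first.
- exact: mbd_cst.
- by apply: mbdX; exact: mbd_id.
by apply: eq_wI => t _; rewrite mulr1.
Qed.

Lemma wI0 : wI (0 : R) (fun=> 1) = 2.
Proof.
have dF (t : R) : m1p1 t -> is_derive t 1 id (wt 0 t * 1).
  by move=> _; rewrite /wt powRr0 mulr1; exact: is_derive_id.
rewrite (wI_FTC _ (mbd_cst 1) _ _ dF); first by rewrite opprK.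
- lra.
- by move=> t _; exact: cst_continuous.
- by apply: continuous_subspaceT => t.
Qed.

Lemma wI_Nhalf : wI (- 2^-1 : R) (fun=> 1) = pi.
Proof.
have lt11 : (-1 : R) < 1 by lra.
have dF (t : R) : m1p1 t -> is_derive t 1 asin (wt (- 2^-1) t * 1).
  move=> tm; rewrite /wt mulr1 powRN powR12_sqrt; last first.
    by rewrite ltW// one_minus_sqr_gt0.
  by apply: is_derive1_asin; move: tm; rewrite /m1p1/= in_itv.
rewrite (wI_FTC (lexx _) (mbd_cst 1) _ continuous_asin_within dF).
  by rewrite asin1 asinN1; lra.
by move=> t _; exact: cst_continuous.
Qed.

(* With exponent [wexp k] the weight is proportional to the density of a coordinate
   of a uniformly distributed point of the unit sphere of R^(k+2). *)
Definition wexp (k : nat) : R := (k%:R - 1) / 2.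

Lemma wexp_ge k : - 2^-1 <= wexp k.
Proof. by rewrite /wexp; have : (0 : R) <= k%:R by []; lra. Qed.

Lemma wexpSS k : wexp k.+2 = wexp k + 1.
Proof. by rewrite /wexp -addn2 natrD; lra. Qed.

(** Induction by steps of two, since k + 2 raises the exponent by one; the bases are the explicit
    masses pi and 2. *)
Lemma wI_gt0 k : 0 < wI (wexp k) (fun=> 1).
Proof.
elim/ltn_ind: k => -[|[|k]] ih.
- by rewrite /wexp sub0r mulN1r wI_Nhalf pi_gt0.
- by rewrite /wexp subrr mul0r wI0.
rewrite wexpSS; have := wI_succ1 (wexp_ge k).
have e2 := wexp_ge k; have k0 := ih k (leqnSn _).
have : 0 < 2 * wexp k + 3 by lra.
move=> p0 /(canRL (mulKf (lt0r_neq0 p0))) ->.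
by rewrite mulr_gt0 ?invr_gt0// mulr_gt0//; lra.
Qed.


End WeightMoments.

(** * Integration over the sphere *)

Section SphereMeasurability.
Context {R : realType}.
Notation mu := (@lebesgue_measure R).

Definition cons_pt (k : nat) (t : R) (eta : 'rV[R]_k.+1) : 'rV[R]_k.+2 :=
  row_mx (t%:M : 'rV[R]_1) (Num.sqrt (1 - t ^+ 2) *: eta).

Lemma cons_ptE k t (eta : 'rV[R]_k.+1) (i : 'I_k.+2) :
  cons_pt t eta 0 i = oapp (fun j => Num.sqrt (1 - t ^+ 2) * eta 0 j) t (unlift 0 i).
Proof.
rewrite /cons_pt; case: unliftP => [j|] -> /=.
  rewrite (_ : lift 0 j = rshift 1 j); last exact/val_inj.
  by rewrite (@row_mxEr _ 1 1 k.+1) mxE.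
rewrite (_ : 0 = lshift k.+1 (0 : 'I_1)); last exact/val_inj.
by rewrite (@row_mxEl _ 1 1 k.+1) mxE eqxx mulr1n.
Qed.

(** The sigma-algebra lives on tuples, not on row vectors; this is [cons_pt] on the measurable
    side. *)
Definition cons_tuple k (t : R) (eta : k.+1.-tuple R) : k.+2.-tuple R :=
  [tuple of t :: [tuple of map (fun x => Num.sqrt (1 - t ^+ 2) * x) eta]].

Lemma cons_pt_to_rV k t (eta : k.+1.-tuple R) :
  cons_pt t (to_rV eta) = to_rV (cons_tuple t eta).
Proof.
apply/rowP => i; rewrite cons_ptE !mxE /cons_tuple.
case: unliftP => [j|] -> /=; last by rewrite tnth0.
by rewrite mxE tnthS tnth_map.
Qed.

Lemma measurable_cons_tuple d (T : measurableType d) k (f : T -> R)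
    (g : T -> k.+1.-tuple R) : measurable_fun setT f -> measurable_fun setT g ->
  measurable_fun setT (fun x => cons_tuple (f x) (g x)).
Proof.
move=> mf mg; apply: measurable_cons => //.
apply/measurable_fun_tnthP => i.
rewrite (_ : _ \o _ = fun x => Num.sqrt (1 - f x ^+ 2) * tnth (g x) i); last first.
  by apply/funext => x /=; rewrite tnth_map.
apply: measurable_funM; last by move/measurable_fun_tnthP : mg; exact.
apply: (measurableT_comp (continuous_measurable_fun (@sqrt_continuous R))).
by apply: measurable_funB => //; exact: measurable_funX.
Qed.

Definition of_rV k (z : 'rV[R]_k) : k.-tuple R := [tuple z 0 i | i < k].

Lemma of_rVK k (z : 'rV[R]_k) : to_rV (of_rV z) = z.
Proof. by apply/rowP => i; rewrite mxE tnth_mktuple. Qed.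

(** The parameter space T serves the induction: the integral over a slice must be measurable in the
    height t jointly with the outer parameter, so t joins the parameters at each dimension. *)
Lemma measurable_sphere_int k d (T : measurableType d)
    (F : T -> 'rV[R]_k.+1 -> \bar R) :
  measurable_fun setT (fun p : T * k.+1.-tuple R => F p.1 (to_rV p.2)) ->
  measurable_fun setT (fun x => sphere_int (F x)).
Proof.
elim: k d T F => [|k ih] d T F mF.
  have mz (z : 'rV[R]_1) : measurable_fun setT (fun x => F x z).
    rewrite -(of_rVK z).
    apply: (measurableT_comp mF (_ : measurable_fun setT (fun x => (x, of_rV z)))).
    by apply: measurable_fun_pair; [exact: measurable_id|exact: measurable_cst].
  apply: emeasurable_funM; last exact: measurable_cst.
  by apply: emeasurable_funD; exact: mz.
rewrite /=; set c := (fine _)^-1.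
apply: emeasurable_funM; first exact: measurable_cst.
pose G (p : T * R) : \bar R := ((wt (wexp k) p.2)%:E *
  sphere_int (fun eta : 'rV[R]_k.+1 => F p.1 (cons_pt p.2 eta)))%E.
have mG : measurable_fun setT G.
  apply: emeasurable_funM.
    apply/measurable_EFinP.
    by apply: (measurableT_comp (measurable_wt (D := setT) _)).
  apply: (ih _ (T * R)%type (fun p eta => F p.1 (cons_pt p.2 eta))).
  rewrite (_ : (fun p => _) = (fun p : T * k.+2.-tuple R => F p.1 (to_rV p.2)) \o
    (fun p : (T * R) * k.+1.-tuple R => (p.1.1, cons_tuple p.1.2 p.2))); last first.
    by apply/funext => p /=; rewrite cons_pt_to_rV.
  apply: measurableT_comp => //.
  apply: measurable_fun_pair.
    exact: (measurableT_comp measurable_fst measurable_fst).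
  apply: measurable_cons_tuple; last exact: measurable_snd.
  exact: (measurableT_comp measurable_snd measurable_fst).
pose H (p : T * R) : \bar R := (G \_ (setT `*` @m1p1 R)) p.
have mH : measurable_fun setT H.
  apply/(measurable_restrictT _ _).1 => //.
    by apply: measurableX => //; exact: measurable_m1p1.
  exact: measurable_funTS.
rewrite (_ : (fun x => _) = (fun x => \int[mu]_t H (x, t))%E); last first.
  apply/funext => x; rewrite integral_mkcond; apply: eq_integral => t _.
  rewrite /H !patchE; congr (if _ then _ else _).
  by apply/idP/idP => /set_mem tm; apply/mem_set => //; case: tm.
(* Tonelli's theorem is for nonnegative functions and no integrability is assumed, so the integral
   is split into its positive and negative parts. *)
rewrite (_ : (fun x => _) = fun x =>
  (\int[mu]_t (H^\+ (x, t)) - \int[mu]_t (H^\- (x, t)))%E); last first.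
  apply/funext => x; rewrite [LHS]integralE.
  by congr (_ - _)%E; apply: eq_integral => t _; rewrite ?funeposE ?funenegE.
apply: emeasurable_funB.
- apply: (measurable_fun_fubini_tonelli_F (m2 := mu) (H^\+)%E) => //.
  exact: measurable_funepos.
- apply: (measurable_fun_fubini_tonelli_F (m2 := mu) (H^\-)%E) => //.
  exact: measurable_funeneg.
Qed.
End SphereMeasurability.

(** * The sphere functional: null sets, finiteness, reduction to slices *)

Section SphereFunctional.
Context {R : realType}.
Notation mu := (@lebesgue_measure R).

Lemma sqr_enorm n (x : 'rV[R]_n) : enorm x ^+ 2 = \sum_(i < n) x 0 i ^+ 2.
Proof. by rewrite sqr_sqrtr// sumr_ge0// => i _; exact: sqr_ge0. Qed.

Lemma enorm_ge0 n (x : 'rV[R]_n) : 0 <= enorm x.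
Proof. exact: sqrtr_ge0. Qed.

Lemma enorm_eq1 n (x : 'rV[R]_n) : \sum_(i < n) x 0 i ^+ 2 = 1 -> enorm x = 1.
Proof. by rewrite /enorm => ->; rewrite sqrtr1. Qed.

Lemma enorm_cons_pt k t (eta : 'rV[R]_k.+1) : m1p1 t -> enorm eta = 1 ->
  enorm (cons_pt t eta) = 1.
Proof.
move=> tm e1; apply: enorm_eq1; rewrite big_ord_recl.
have -> : cons_pt t eta 0 ord0 = t by rewrite cons_ptE unlift_none.
under eq_bigr => i _.
  rewrite cons_ptE liftK /= exprMn sqr_sqrtr; last first.
    by rewrite ltW// one_minus_sqr_gt0.
  over.
by rewrite -mulr_sumr -sqr_enorm e1 expr1n mulr1 addrC subrK.
Qed.

Lemma enorm_pm1 : enorm (1%:M : 'rV[R]_1) = 1 /\ enorm ((-1)%:M : 'rV[R]_1) = 1.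
Proof.
by split; apply: enorm_eq1; rewrite big_ord1 !mxE eqxx mulr1n ?sqrrN expr1n.
Qed.

Lemma eq_sphere_int k (f g : 'rV[R]_k.+1 -> \bar R) :
  (forall z, enorm z = 1 -> f z = g z) -> sphere_int f = sphere_int g.
Proof.
elim: k f g => [|k ih] f g fg /=.
  by have [h1 h2] := enorm_pm1; rewrite !fg.
congr (_ * _)%E; apply: eq_integral => t /set_mem tm; congr (_ * _)%E.
by apply: ih => z z1; apply: fg; exact: enorm_cons_pt.
Qed.

Lemma wI1E k : fine (\int[mu]_(t in @m1p1 R) ((1 - t ^+ 2) `^ ((k%:R - 1) / 2))%:E)%E =
  wI (wexp k) (fun=> 1).
Proof. by congr fine; apply: eq_integral => t _; rewrite mulr1. Qed.

Definition smeas k (f : 'rV[R]_k.+1 -> \bar R) :=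
  measurable_fun setT (fun z : k.+1.-tuple R => f (to_rV z)).

Lemma smeas_cons k (f : 'rV[R]_k.+2 -> \bar R) t : smeas f ->
  smeas (fun eta => f (cons_pt t eta)).
Proof.
move=> mf; rewrite /smeas; under eq_fun do rewrite cons_pt_to_rV.
apply: (measurableT_comp mf); apply: measurable_cons_tuple.
  exact: measurable_cst.
exact: measurable_id.
Qed.

Lemma measurable_slice k (f : 'rV[R]_k.+2 -> \bar R) : smeas f ->
  measurable_fun (setT : set R) (fun t => sphere_int (fun eta => f (cons_pt t eta))).
Proof.
move=> mf; apply: (measurable_sphere_int (T := R)
  (F := fun t eta => f (cons_pt t eta))).
under eq_fun do rewrite cons_pt_to_rV.
by apply: (measurableT_comp mf); apply: measurable_cons_tuple.
Qed.

Lemma sphere_int_ge0 k (f : 'rV[R]_k.+1 -> \bar R) :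
  (forall z, 0 <= f z)%E -> (0 <= sphere_int f)%E.
Proof.
elim: k f => [|k ih] f f0 /=.
  by apply: mule_ge0; [exact: adde_ge0|rewrite lee_fin].
rewrite wI1E; apply: mule_ge0; first by rewrite lee_fin invr_ge0 ltW// wI_gt0.
apply: integral_ge0 => t _; apply: mule_ge0; first by rewrite lee_fin powR_ge0.
exact: ih.
Qed.

(** [sphere_int] is an iterated integral and not given as the integral of a measure, so a null set
    is handled by slices: almost every slice of N is null, and the induction hypothesis applies to
    it. *)
Lemma sphere_int_null k (N : set 'rV[R]_k.+1) (f g : 'rV[R]_k.+1 -> \bar R) :
  smeas f -> smeas g -> smeas (fun z => (\1_N z)%:E) ->
  sphere_int (fun z => (\1_N z)%:E) = 0%E ->
  (forall z, ~ N z -> f z = g z) -> sphere_int f = sphere_int g.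
Proof.
elim: k N f g => [|k ih] N f g mf mg mN.
  (* Each of the two points of the 0-sphere has mass 1/2, so a null set contains neither. *)
  move=> N0 fg /=; suff nN z : z = 1%:M \/ z = (-1)%:M -> ~ N z.
    by rewrite !fg//; apply: nN; [right|left].
  move=> zz Nz; move: N0 => /= /eqP; rewrite -EFinD -EFinM eqe mulf_eq0 invr_eq0.
  rewrite pnatr_eq0 orbF paddr_eq0 ?indicE// !pnatr_eq0 => /andP[].
  by case: zz Nz => -> /mem_set ->.
move=> /=; rewrite wI1E => /eqP; rewrite mule_eq0 eqe invr_eq0.
rewrite (gt_eqF (wI_gt0 k)) /= => /eqP N0 fg; congr (_ * _)%E.
have mw D : measurable_fun D (EFin \o @wt R (wexp k)).
  by apply/measurable_EFinP; exact: measurable_wt.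
have mS (h : 'rV[R]_k.+2 -> \bar R) : smeas h -> measurable_fun (@m1p1 R) (fun t =>
    ((wt (wexp k) t)%:E * sphere_int (fun eta => h (cons_pt t eta)))%E).
  move=> mh; apply: emeasurable_funM; first exact: mw.
  by apply: measurable_funTS; exact: measurable_slice.
apply: ae_eq_integral.
- exact: measurable_m1p1.
- exact: mS.
- exact: mS.
have := @ae_eq_integral_abs _ _ R mu _ measurable_m1p1 _ (mS _ mN).
set I := (\int[_]_(_ in _) `| _ |)%E => H.
have I0 : I = 0%E.
  rewrite /I -[RHS]N0; apply: eq_integral => t _; rewrite gee0_abs//.
  apply: mule_ge0; first by rewrite lee_fin wt_ge0.
  by apply: sphere_int_ge0 => z; rewrite lee_fin indicE.
apply: filterS (H.1 I0) => t Ht tm.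
congr (_ * _)%E; apply: (ih [set eta | N (cons_pt t eta)]).
- exact: smeas_cons.
- exact: smeas_cons.
- by have := smeas_cons t mN; congr smeas; apply/funext => z; rewrite !indicE.
- have /eqP := Ht tm; rewrite mule_eq0 eqe.
  rewrite /wt gt_eqF ?powR_gt0 ?one_minus_sqr_gt0//= => /eqP <-.
  by apply: eq_sphere_int => z _; rewrite !indicE.
- by move=> z Nz; exact: fg.
Qed.

(** The analogue of [mbd]. The bound is asked on the unit sphere only, since coordinates and kernels
    are unbounded off it. *)
Definition sbd k (f : 'rV[R]_k.+1 -> R) :=
  measurable_fun setT (fun z : k.+1.-tuple R => f (to_rV z)) /\
  exists B : R, forall z, enorm z = 1 -> `|f z| <= B.

Definition sint k (f : 'rV[R]_k.+1 -> R) : R := fine (sphere_int (fun z => (f z)%:E)).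

Definition wmean k (g : R -> R) : R :=
  (wI (wexp k) (fun=> 1))^-1 * wI (wexp k) g.

(** Finiteness and bound go through the induction together: the bound on the slices makes the outer
    integrand integrable, and the normalized weight returns the same B. *)
Lemma sphere_int_fin k (f : 'rV[R]_k.+1 -> R) (B : R) :
  measurable_fun setT (fun z : k.+1.-tuple R => f (to_rV z)) ->
  (forall z, enorm z = 1 -> `|f z| <= B) ->
  sphere_int (fun z => (f z)%:E) = (sint f)%:E /\ `|sint f| <= B.
Proof.
elim: k f => [|k ih] f mf fB.
  rewrite /sint /=; split; first by rewrite -EFinD -EFinM.
  have [/fB f1 /fB f2] := enorm_pm1.
  by move: f1 f2; rewrite !ler_norml => /andP[? ?] /andP[? ?]; apply/andP; split; lra.
pose g t := sint (fun eta => f (cons_pt t eta)).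
have IH t : m1p1 t -> sphere_int (fun eta => (f (cons_pt t eta))%:E) = (g t)%:E /\
    `|g t| <= B.
  move=> tm; apply: ih.
    have := @smeas_cons k (fun z => (f z)%:E) t.
    by move=> H; apply/measurable_EFinP; apply: H; exact/measurable_EFinP.
  by move=> z z1; apply: fB; exact: enorm_cons_pt.
have mg : mbd g.
  split; last by exists B => t tm; have [] := IH t tm.
  apply: measurable_funTS; apply: (measurableT_comp (@fine_measurable R setT measurableT)).
  by apply: (@measurable_slice k (fun z => (f z)%:E)); exact/measurable_EFinP.
have E : sphere_int (fun z => (f z)%:E) = (wmean k g)%:E.
  rewrite /= wI1E /wmean EFinM; congr (_ * _)%E.
  rewrite /wI /Rintegral fineK; last first.
    apply: integrable_fin_num; first exact: measurable_m1p1.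
    exact: (wtM_integrable (wexp_ge k)).
  apply: eq_integral => t /set_mem tm; rewrite /= EFinM; congr (_ * _)%E.
  exact: (IH t tm).1.
have Sg : sint f = wmean k g by rewrite /sint E.
split; first by rewrite Sg.
rewrite Sg /wmean normrM gtr0_norm ?invr_gt0 ?wI_gt0//.
rewrite ler_pdivrMl ?wI_gt0// mulrC -(wI_Z _ (wexp_ge k) (mbd_cst 1)).
rewrite ler_norml; apply/andP; split.
  rewrite -mulN1r -(wI_Z _ (wexp_ge k)); last by apply: mbdM; exact: mbd_cst.
  apply: le_wI => //; first exact: wexp_ge.
    by do 2 (apply: mbdM; first exact: mbd_cst); exact: mbd_cst.
  by move=> t tm; have [_] := IH t tm; rewrite ler_norml => /andP[? ?]; lra.
apply: le_wI => //; [exact: wexp_ge|by apply: mbdM; exact: mbd_cst|].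
by move=> t tm; have [_] := IH t tm; rewrite ler_norml => /andP[? ?]; lra.
Qed.

Lemma sbd_cons k (f : 'rV[R]_k.+2 -> R) t : m1p1 t -> sbd f ->
  sbd (fun eta => f (cons_pt t eta)).
Proof.
move=> tm [mf [B fB]]; split.
  have := @smeas_cons k (fun z => (f z)%:E) t.
  by move=> H; apply/measurable_EFinP; apply: H; exact/measurable_EFinP.
by exists B => z z1; apply: fB; exact: enorm_cons_pt.
Qed.

Lemma sint_succ k (f : 'rV[R]_k.+2 -> R) : sbd f ->
  mbd (fun t => sint (fun eta => f (cons_pt t eta))) /\
  sint f = wmean k (fun t => sint (fun eta => f (cons_pt t eta))).
Proof.
move=> sf; have [mf [B fB]] := sf.
have IH t (tm : m1p1 t) := sphere_int_fin (sbd_cons tm sf).1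
  (fun z z1 => fB _ (enorm_cons_pt tm z1)).
have mg : mbd (fun t => sint (fun eta => f (cons_pt t eta))).
  split; last by exists B => t tm; have [] := IH t tm.
  apply: measurable_funTS; apply: (measurableT_comp (@fine_measurable R setT measurableT)).
  by apply: (@measurable_slice k (fun z => (f z)%:E)); exact/measurable_EFinP.
split => //; rewrite {1}/sint /= wI1E /wmean; apply: EFin_inj; rewrite fineK.
  rewrite EFinM; congr (_ * _)%E.
  rewrite /wI /Rintegral fineK; last first.
    apply: integrable_fin_num; first exact: measurable_m1p1.
    exact: (wtM_integrable (wexp_ge k)).
  apply: eq_integral => t /set_mem tm; rewrite /= EFinM; congr (_ * _)%E.
  exact: (IH t tm).1.
by have [] := sphere_int_fin mf fB; rewrite /= wI1E => ->.
Qed.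
End SphereFunctional.

(** * Linearity and monotonicity of weighted means and sphere integrals *)

Section SphereLinear.
Context {R : realType}.

Lemma wmean1 k : wmean k (fun=> 1) = 1 :> R.
Proof. by rewrite /wmean mulVf// gt_eqF// wI_gt0. Qed.

Lemma wmeanD k (f g : R -> R) : mbd f -> mbd g ->
  wmean k (fun t => f t + g t) = wmean k f + wmean k g.
Proof. by move=> mf mg; rewrite /wmean wI_D ?wexp_ge// mulrDr. Qed.

Lemma wmeanZ k c (g : R -> R) : mbd g ->
  wmean k (fun t => c * g t) = c * wmean k g.
Proof. by move=> mg; rewrite /wmean wI_Z ?wexp_ge// mulrCA. Qed.

Lemma le_wmean k (f g : R -> R) : mbd f -> mbd g ->
  (forall t, m1p1 t -> f t <= g t) -> wmean k f <= wmean k g.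
Proof.
move=> mf mg fg; rewrite ler_wpM2l ?invr_ge0 ?(ltW (wI_gt0 k))//.
exact: (le_wI (wexp_ge k)).
Qed.

Lemma eq_wmean k (f g : R -> R) : (forall t, m1p1 t -> f t = g t) ->
  wmean k f = wmean k g.
Proof. by move=> fg; congr (_ * _); exact: eq_wI. Qed.

Lemma wmean_cst k (c : R) : wmean k (fun=> c) = c.
Proof.
rewrite (@eq_wmean _ _ (fun=> c * 1)) ?wmeanZ ?wmean1 ?mulr1//.
exact: mbd_cst.
Qed.

Lemma wmeanB k (f g : R -> R) : mbd f -> mbd g ->
  wmean k (fun t => f t - g t) = wmean k f - wmean k g.
Proof. by move=> mf mg; rewrite /wmean wI_B ?wexp_ge// mulrBr. Qed.

Lemma normr_wmean k (f g : R -> R) : mbd f -> mbd g ->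
  (forall t, m1p1 t -> `|f t| <= g t) -> `|wmean k f| <= wmean k g.
Proof.
move=> sf sg fg; rewrite ler_norml; apply/andP; split.
  rewrite -mulN1r -wmeanZ//; apply: le_wmean => //.
    by apply: mbdM => //; exact: mbd_cst.
  by move=> z /fg; rewrite ler_norml => /andP[? ?]; lra.
by apply: le_wmean => // z /fg; rewrite ler_norml => /andP[].
Qed.

Lemma mbd_sum (I : Type) (r : seq I) (P : pred I) (f : I -> R -> R) :
  (forall i, mbd (f i)) -> mbd (fun t => \sum_(i <- r | P i) f i t).
Proof.
move=> mf; elim: r => [|i r ih].
  by under eq_fun do rewrite big_nil; exact: mbd_cst.
under eq_fun do rewrite big_cons; case: (P i) => //.
exact: mbdD.
Qed.

Lemma wmean_sum k (I : Type) (r : seq I) (P : pred I) (f : I -> R -> R) :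
  (forall i, mbd (f i)) ->
  wmean k (fun t => \sum_(i <- r | P i) f i t) = \sum_(i <- r | P i) wmean k (f i).
Proof.
move=> mf; elim: r => [|i r ih].
  rewrite big_nil (@eq_wmean k _ (fun=> 0 * 1)).
    by rewrite wmeanZ ?mul0r//; exact: mbd_cst.
  by move=> t _; rewrite big_nil mul0r.
rewrite big_cons; case: ifP => Pi; last first.
  by rewrite -ih; apply: eq_wmean => t _; rewrite big_cons Pi.
rewrite -ih -wmeanD//; last exact: mbd_sum.
by apply: eq_wmean => t _; rewrite big_cons Pi.
Qed.

Lemma eq_sint k (f g : 'rV[R]_k.+1 -> R) :
  (forall z, enorm z = 1 -> f z = g z) -> sint f = sint g.
Proof. by move=> fg; congr fine; apply: eq_sphere_int => z /fg ->. Qed.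

Lemma sbdD k (f g : 'rV[R]_k.+1 -> R) : sbd f -> sbd g -> sbd (fun z => f z + g z).
Proof.
move=> [mf [B fB]] [mg [C gC]]; split; first exact: measurable_funD.
by exists (B + C) => t tm; rewrite (le_trans (ler_normD _ _))// lerD// ?fB ?gC.
Qed.

Lemma sbdM k (f g : 'rV[R]_k.+1 -> R) : sbd f -> sbd g -> sbd (fun z => f z * g z).
Proof.
move=> [mf [B fB]] [mg [C gC]]; split; first exact: measurable_funM.
by exists (B * C) => t tm; rewrite normrM ler_pM// ?fB ?gC.
Qed.

Lemma sbd_cst k c : sbd (fun _ : 'rV[R]_k.+1 => c).
Proof. by split; [exact: measurable_cst|exists `|c|]. Qed.

Lemma sbdN k (f : 'rV[R]_k.+1 -> R) : sbd f -> sbd (fun z => - f z).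
Proof.
move=> mf; under eq_fun do rewrite -mulN1r.
by apply: sbdM => //; exact: sbd_cst.
Qed.

Lemma sbdB k (f g : 'rV[R]_k.+1 -> R) : sbd f -> sbd g -> sbd (fun z => f z - g z).
Proof. by move=> mf mg; apply: sbdD => //; exact: sbdN. Qed.

Lemma sbdX k (f : 'rV[R]_k.+1 -> R) j : sbd f -> sbd (fun z => f z ^+ j).
Proof.
move=> mf; elim: j => [|j ih].
  by under eq_fun do rewrite expr0; exact: sbd_cst.
by under eq_fun do rewrite exprS; exact: sbdM.
Qed.

Lemma sbd_norm k (f : 'rV[R]_k.+1 -> R) : sbd f -> sbd (fun z => `|f z|).
Proof.
move=> [mf [B fB]]; split; first exact: measurableT_comp.
by exists B => z z1; rewrite normr_id fB.
Qed.

Lemma sbd_sum k (I : Type) (r : seq I) (P : pred I) (f : I -> 'rV[R]_k.+1 -> R) :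
  (forall i, sbd (f i)) -> sbd (fun t => \sum_(i <- r | P i) f i t).
Proof.
move=> mf; elim: r => [|i r ih].
  by under eq_fun do rewrite big_nil; exact: sbd_cst.
under eq_fun do rewrite big_cons; case: (P i) => //.
exact: sbdD.
Qed.

Lemma sbd_coord k (i : 'I_k.+1) : sbd (fun z : 'rV[R]_k.+1 => z 0 i).
Proof.
split.
  under eq_fun do rewrite mxE; exact: measurable_tnth.
exists 1 => z z1; rewrite -(ler_pXn2r (n := 2)) ?nnegrE// expr1n -normrX.
rewrite ger0_norm ?sqr_ge0// -(expr1n _ 2) -z1 sqr_enorm (bigD1 i)//=.
by rewrite lerDl sumr_ge0// => j _; exact: sqr_ge0.
Qed.

Lemma sbd_comp k (f : R -> R) (g : 'rV[R]_k.+1 -> R) : continuous f -> sbd g ->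
  sbd (fun z => f (g z)).
Proof.
move=> cf [mg [B gB]]; split.
  by apply: (measurableT_comp (continuous_measurable_fun cf) mg).
have [c1 _ c1P] := @EVT_max R (fun t => `|f t|) (- `|B|) `|B|
  (ltac:(by rewrite ge0_cp)) ltac:(apply: continuous_subspaceT => x;
    apply: continuous_comp; [exact: cf|exact: norm_continuous]).
exists `|f c1| => z /gB zB; apply: c1P; rewrite in_itv/= -ler_norml.
exact: le_trans zB (ler_norm _).
Qed.

Lemma sint0 (f : 'rV[R]_1 -> R) : sint f = (f 1%:M + f (-1)%:M) / 2.
Proof. by []. Qed.

Lemma sintD k (f g : 'rV[R]_k.+1 -> R) : sbd f -> sbd g ->
  sint (fun z => f z + g z) = sint f + sint g.
Proof.
elim: k f g => [|k ih] f g mf mg; first by rewrite !sint0; lra.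
rewrite (sint_succ (sbdD mf mg)).2 (sint_succ mf).2 (sint_succ mg).2.
rewrite -wmeanD; last 2 first.
- exact: (sint_succ mf).1.
- exact: (sint_succ mg).1.
by apply: eq_wmean => t tm; rewrite ih//; exact: sbd_cons.
Qed.

Lemma sintZ k c (f : 'rV[R]_k.+1 -> R) : sbd f ->
  sint (fun z => c * f z) = c * sint f.
Proof.
elim: k f => [|k ih] f mf; first by rewrite !sint0; lra.
rewrite (sint_succ (sbdM (sbd_cst k.+1 c) mf)).2 (sint_succ mf).2.
rewrite -wmeanZ; last exact: (sint_succ mf).1.
by apply: eq_wmean => t tm; rewrite ih//; exact: sbd_cons.
Qed.

Lemma le_sint k (f g : 'rV[R]_k.+1 -> R) : sbd f -> sbd g ->
  (forall z, enorm z = 1 -> f z <= g z) -> sint f <= sint g.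
Proof.
elim: k f g => [|k ih] f g mf mg fg.
  have [/fg h1 /fg h2] := @enorm_pm1 R.
  by rewrite !sint0; lra.
rewrite (sint_succ mf).2 (sint_succ mg).2; apply: le_wmean.
- exact: (sint_succ mf).1.
- exact: (sint_succ mg).1.
move=> t tm; apply: ih; [exact: sbd_cons|exact: sbd_cons|].
by move=> z z1; apply: fg; exact: enorm_cons_pt.
Qed.

Lemma sint_cst k c : sint (fun _ : 'rV[R]_k.+1 => c) = c.
Proof.
elim: k => [|k ih]; first by rewrite sint0; lra.
rewrite (sint_succ (sbd_cst k.+1 c)).2.
by rewrite (@eq_wmean k _ (fun=> c * 1)) ?wmeanZ ?wmean1 ?mulr1// ?ih//; exact: mbd_cst.
Qed.

Lemma sintB k (f g : 'rV[R]_k.+1 -> R) : sbd f -> sbd g ->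
  sint (fun z => f z - g z) = sint f - sint g.
Proof.
move=> mf mg; rewrite sintD//; last exact: sbdN.
congr (_ + _); rewrite -mulN1r -sintZ//; apply: eq_sint => z _.
by rewrite mulN1r.
Qed.

Lemma sint_sum k (I : Type) (r : seq I) (P : pred I) (f : I -> 'rV[R]_k.+1 -> R) :
  (forall i, sbd (f i)) ->
  sint (fun t => \sum_(i <- r | P i) f i t) = \sum_(i <- r | P i) sint (f i).
Proof.
move=> mf; elim: r => [|i r ih].
  rewrite big_nil (eq_sint (g := fun=> 0)) ?sint_cst//.
  by move=> t _; rewrite big_nil.
rewrite big_cons; case: ifP => Pi; last first.
  by rewrite -ih; apply: eq_sint => t _; rewrite big_cons Pi.
rewrite -ih -sintD//; last exact: sbd_sum.
by apply: eq_sint => t _; rewrite big_cons Pi.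
Qed.

Lemma normr_sint k (f g : 'rV[R]_k.+1 -> R) : sbd f -> sbd g ->
  (forall z, enorm z = 1 -> `|f z| <= g z) -> `|sint f| <= sint g.
Proof.
move=> sf sg fg; rewrite ler_norml; apply/andP; split.
  rewrite -mulN1r -sintZ//; apply: le_sint => //.
    by apply: sbdM => //; exact: sbd_cst.
  by move=> z /fg; rewrite ler_norml => /andP[? ?]; lra.
by apply: le_sint => // z /fg; rewrite ler_norml => /andP[].
Qed.
End SphereLinear.

(** * Moments of a linear form on the sphere *)

Section Moments.
Context {R : realType}.

Lemma wI_odd (e : R) j : - 2^-1 <= e -> wI e (fun t => t ^+ (j.*2.+1)) = 0.
Proof.
move=> e2; elim: j => [|j ih].
  have : wI e (fun t => (1 - t ^+ 2) * 0 - 2 * (e + 1) * t * 1) = 0.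
    apply: (@wI_by_parts R e (fun=> 1) (fun=> 0) e2).
    - by move=> t _; exact: cst_continuous.
    - exact: mbd_cst.
    - exact: mbd_cst.
  rewrite (@eq_wI R e _ (fun t => - (2 * (e + 1)) * t ^+ 1)); last first.
    by move=> t _; rewrite expr1; ring.
  rewrite wI_Z//; last by apply: mbdX; exact: mbd_id.
  by move/eqP; rewrite mulf_eq0 => /orP[|/eqP//]; rewrite oppr_eq0 gt_eqF//; lra.
have := wI_moment_rec j.*2.+1 e2; rewrite ih mulr0 => /eqP.
rewrite mulf_eq0 => /orP[|/eqP//]; rewrite gt_eqF//.
by have : (0 : R) <= j.*2.+1%:R by []; lra.
Qed.

(** Beta integrals at half-integers. The power of 1 - t^2 raises the exponent of the weight by i;
    [wI_succ1] gives the new mass, the moment recursion accounts for the power of t, and the two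
    denominators join into one product. *)
Lemma wmean_even k a i : wmean k (fun t : R => t ^+ a.*2 * (1 - t ^+ 2) ^+ i) =
  \prod_(m < a) (m.*2.+1)%:R * \prod_(m < i) (m.*2 + k.+1)%:R /
  \prod_(m < a + i) (m.*2 + k.+2)%:R.
Proof.
pose e := @wexp R k; have e2 : - 2^-1 <= e := wexp_ge k.
have ei (l : nat) : - 2^-1 <= e + l%:R by have : (0 : R) <= l%:R by []; lra.
have H1 l g : wI e (fun t => (1 - t ^+ 2) ^+ l * g t) = wI (e + l%:R) g.
  elim: l g => [|l ih] g.
    by rewrite addr0; apply: eq_wI => t _; rewrite expr0 mul1r.
  rewrite -natr1 addrA wI_succ -ih; apply: eq_wI => t _.
  by rewrite exprSr mulrA.
have H2 l : wI (e + l%:R) (fun=> 1) = wI e (fun=> 1) *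
    \prod_(m < l) ((m.*2 + k.+1)%:R / (m.*2 + k.+2)%:R).
  elim: l => [|l ih]; first by rewrite big_ord0 addr0 mulr1.
  rewrite big_ord_recr/= [RHS]mulrA -ih -natr1 addrA.
  apply: (mulfI (_ : 2 * (e + l%:R) + 3 != 0)); first by rewrite gt_eqF//; have := ei l; lra.
  rewrite wI_succ1//.
  have -> : (l.*2 + k.+1)%:R = 2 * (e + l%:R) + 2 :> R.
    by rewrite natrD -addnn natrD -natr1 /e /wexp; lra.
  have -> : (l.*2 + k.+2)%:R = 2 * (e + l%:R) + 3 :> R.
    by rewrite natrD -addnn natrD -addn2 natrD /e /wexp; lra.
  by field; rewrite gt_eqF//; have := ei l; lra.
have H3 l b : wI (e + l%:R) (fun t => t ^+ b.*2) = wI (e + l%:R) (fun=> 1) *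
    \prod_(m < b) (m.*2.+1%:R / ((l + m).*2 + k.+2)%:R).
  elim: b => [|b ih].
    by rewrite big_ord0 mulr1; apply: eq_wI => t _; rewrite expr0.
  rewrite big_ord_recr/= [RHS]mulrA -ih.
  have c0 : 2 * (e + l%:R) + 3 + b.*2%:R != 0.
    by rewrite gt_eqF//; have : (0 : R) <= b.*2%:R by []; have := ei l; lra.
  apply: (mulfI c0).
  have := wI_moment_rec b.*2 (ei l); rewrite -doubleS => H.
  have -> : 2 * (e + l%:R) + 3 + b.*2%:R = b.*2%:R + 2 * (e + l%:R) + 3 by ring.
  rewrite H.
  have -> : ((l + b).*2 + k.+2)%:R = 2 * (e + l%:R) + 3 + b.*2%:R :> R.
    by rewrite natrD doubleD natrD -(addnn l) natrD -addn2 natrD /e /wexp; lra.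
  by field.
have -> : wmean k (fun t : R => t ^+ a.*2 * (1 - t ^+ 2) ^+ i) =
    (wI e (fun=> 1))^-1 * wI (e + i%:R) (fun t => t ^+ a.*2).
  by congr (_ * _); rewrite -H1; apply: eq_wI => t _; rewrite mulrC.
rewrite H3 H2 !mulrA mulVf ?gt_eqF ?wI_gt0// mul1r.
rewrite (addnC a) big_split_ord/= !big_split/= !prodfV invfM.
by rewrite mulrACA [X in X * _ = _]mulrC.
Qed.

Lemma wmean_odd k a i :
  wmean k (fun t : R => t ^+ a.*2.+1 * (1 - t ^+ 2) ^+ i) = 0.
Proof.
have H1 (e : R) l g : wI e (fun t => (1 - t ^+ 2) ^+ l * g t) = wI (e + l%:R) g.
  elim: l g => [|l ih] g.
    by rewrite addr0; apply: eq_wI => t _; rewrite expr0 mul1r.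
  rewrite -natr1 addrA wI_succ -ih; apply: eq_wI => t _.
  by rewrite exprSr mulrA.
rewrite /wmean (_ : wI _ (fun t => t ^+ _ * _) = 0) ?mulr0//.
transitivity (wI (wexp k) (fun t => (1 - t ^+ 2) ^+ i * t ^+ a.*2.+1) : R).
  by apply: eq_wI => t _; rewrite mulrC.
rewrite H1 wI_odd//.
by have := @wexp_ge R k; have : (0 : R) <= i%:R by []; lra.
Qed.

(** The j-th moment of a coordinate of a uniform point of the unit sphere of R^(k+1), as a quotient
    of double factorials. *)
Definition smom k j : R := if odd j then 0 else
  \prod_(m < j./2) (m.*2.+1)%:R / \prod_(m < j./2) (m.*2 + k.+1)%:R.

Lemma wmean_pow k j : wmean k (fun t : R => t ^+ j) = smom k.+1 j.
Proof.
rewrite /smom; case: ifP => oj.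
  rewrite -(odd_double_half j) oj add1n -(wmean_odd k j./2 0).
  by apply: eq_wmean => t _; rewrite expr0 mulr1.
have := wmean_even k j./2 0; rewrite big_ord0 mulr1 addn0 => <-.
by apply: eq_wmean => t _; rewrite expr0 mulr1 even_halfK ?oj.
Qed.

Definition dotp n (x y : 'rV[R]_n) : R := \sum_i x 0 i * y 0 i.

Lemma sbd_dotp k (v : 'rV[R]_k.+1) : sbd (fun z => dotp z v).
Proof.
apply: sbd_sum => i; apply: sbdM; [exact: sbd_coord|exact: sbd_cst].
Qed.

Lemma sum_even_ord (F : nat -> R) J : (forall i, odd i -> F i = 0) ->
  \sum_(i < J.*2.+1) F i = \sum_(i < J.+1) F i.*2.
Proof.
move=> F0; elim: J => [|J ih]; first by rewrite !big_ord1.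
rewrite doubleS big_ord_recr/= big_ord_recr/= ih.
by rewrite [RHS]big_ord_recr/= F0 ?addr0//= odd_double.
Qed.

(** From (2n)! = 2^n n! (2n - 1)!! at J, I and J - I. *)
Lemma bin_double J I : (I <= J)%N ->
  'C(J.*2, I.*2)%:R * (\prod_(m < J - I) (m.*2.+1)%:R * \prod_(m < I) (m.*2.+1)%:R) =
  'C(J, I)%:R * \prod_(m < J) (m.*2.+1)%:R :> R.
Proof.
move=> IJ.
have f2 n : (n.*2)`!%:R = 2 ^+ n * n`!%:R * \prod_(m < n) (m.*2.+1)%:R :> R.
  elim: n => [|n ih]; first by rewrite big_ord0 expr0 !mul1r.
  rewrite doubleS !factS !natrM ih big_ord_recr/= exprS.
  by rewrite -[n.*2.+2]/(n.+1.*2) -[n.+1.*2]muln2 natrM; ring.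
have n0 n : n`!%:R != 0 :> R by rewrite pnatr_eq0 -lt0n fact_gt0.
have e1 : 'C(J.*2, I.*2)%:R * ((I.*2)`!%:R * ((J - I).*2)`!%:R) = (J.*2)`!%:R :> R.
  by rewrite -!natrM doubleB bin_fact ?leq_double.
have e2 : 'C(J, I)%:R * (I`!%:R * (J - I)`!%:R) = J`!%:R :> R.
  by rewrite -!natrM bin_fact.
apply: (mulfI (mulf_neq0 (expf_neq0 J (_ : 2 != 0 :> R)) (mulf_neq0 (n0 I) (n0 (J - I)%N)))).
  by rewrite pnatr_eq0.
transitivity ((J.*2)`!%:R : R).
  by rewrite -e1 !f2 -{1}(subnKC IJ) exprD; ring.
by rewrite f2 -e2; ring.
Qed.

(** Rotation invariance for powers of a linear form. With v = (a, v'), the form on a slice is t a +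
    sqrt(1 - t^2) <eta, v'>. After binomial expansion the odd powers integrate to 0, and in the even
    ones the double factorials turn C(2J, 2I) into C(J, I), so that the sum is (a^2 + |v'|^2)^J. *)
Lemma sint_dotp_pow k (v : 'rV[R]_k.+1) j :
  sint (fun z => dotp z v ^+ j) = enorm v ^+ j * smom k j.
Proof.
elim: k v j => [|k ih] v j.
  rewrite sint0 /dotp !big_ord1 !mxE eqxx mulr1n mul1r mulN1r /enorm big_ord1.
  rewrite sqrtr_sqr /smom exprNn -signr_odd; case: ifP => oj.
    by rewrite expr1 mulr0 mulN1r subrr mul0r.
  rewrite expr0 mul1r -[in RHS](even_halfK (negbT oj)) -mul2n exprM.
  rewrite [`|_| ^+ 2]real_normK ?num_real// -exprM mul2n even_halfK ?oj//.
  under [X in _ / X]eq_bigr do rewrite addn1.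
  rewrite divff; first by lra.
  by apply/prodf_neq0 => i _; rewrite pnatr_eq0.
pose a := v 0 0; pose v' : 'rV[R]_k.+1 := \row_i v 0 (lift 0 i).
have nv : enorm v ^+ 2 = a ^+ 2 + enorm v' ^+ 2.
  by rewrite !sqr_enorm big_ord_recl; congr (_ + _); apply: eq_bigr => i _; rewrite mxE.
have dE t eta : dotp (cons_pt t eta) v = Num.sqrt (1 - t ^+ 2) * dotp eta v' + t * a.
  rewrite /dotp big_ord_recl addrC cons_ptE unlift_none/= mulr_sumr; congr (_ + _).
  by apply: eq_bigr => i _; rewrite cons_ptE liftK/= mxE mulrA.
have sb i : sbd (fun z : 'rV[R]_k.+2 => dotp z v ^+ i) by apply: sbdX; exact: sbd_dotp.
have sb' i : sbd (fun z : 'rV[R]_k.+1 => dotp z v' ^+ i) by apply: sbdX; exact: sbd_dotp.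
rewrite (sint_succ (sb j)).2.
rewrite (@eq_wmean _ k _ (fun t => \sum_(i < j.+1) ('C(j, i)%:R * a ^+ (j - i) *
    (enorm v' ^+ i * smom k i)) * (t ^+ (j - i) * (1 - t ^+ 2) ^+ i./2))); last first.
  move=> t tm.
  rewrite (@eq_sint _ _ _ (fun eta => \sum_(i < j.+1) ('C(j, i)%:R * (t * a) ^+ (j - i) *
     Num.sqrt (1 - t ^+ 2) ^+ i) * dotp eta v' ^+ i)); last first.
    move=> eta _; rewrite dE addrC exprDn; apply: eq_bigr => i _.
    by rewrite [(Num.sqrt _ * _) ^+ _]exprMn -mulr_natl !mulrA.
  rewrite sint_sum; last by move=> i; apply: sbdM => //; exact: sbd_cst.
  apply: eq_bigr => i _; rewrite sintZ// ih.
  have [oi|oi] := boolP (odd i); first by rewrite /smom oi !(mulr0, mul0r).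
  have -> : Num.sqrt (1 - t ^+ 2) ^+ i = (1 - t ^+ 2) ^+ i./2.
    rewrite -[in LHS](even_halfK oi) -mul2n exprM sqr_sqrtr//.
    exact: ltW (one_minus_sqr_gt0 tm).
  by rewrite exprMn; ring.
have mb l i : mbd (fun t : R => t ^+ l * (1 - t ^+ 2) ^+ i).
  apply: mbdM; apply: mbdX; first exact: mbd_id.
  by apply: mbdB; [exact: mbd_cst|apply: mbdX; exact: mbd_id].
rewrite wmean_sum; last by move=> i; apply: mbdM; [exact: mbd_cst|exact: mb].
under eq_bigr => i _ do rewrite wmeanZ//.
have [oj|ej] := boolP (odd j).
  rewrite {2}/smom oj mulr0 big1// => i _.
  have [oi|oi] := boolP (odd i); first by rewrite /smom oi !(mulr0, mul0r).
  have : odd (j - i) by rewrite oddB ?oj ?(negbTE oi)// -ltnS.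
  move=> oji; rewrite -(odd_double_half (j - i)) oji add1n wmean_odd mulr0//.
set J := j./2; have jE : j = J.*2 by rewrite even_halfK.
rewrite jE; rewrite (@sum_even_ord (fun i => 'C(J.*2, i)%:R * a ^+ (J.*2 - i) *
  (enorm v' ^+ i * smom k i) * wmean k (fun t => t ^+ (J.*2 - i) * (1 - t ^+ 2) ^+ i./2))); last first.
  by move=> i oi; rewrite /smom oi !(mulr0, mul0r).
have -> : enorm v ^+ J.*2 = (a ^+ 2 + enorm v' ^+ 2) ^+ J.
  by rewrite -mul2n exprM nv.
rewrite exprDn mulr_suml; apply: eq_bigr => -[I /= IJ] _.
rewrite ltnS in IJ; rewrite -doubleB doubleK wmean_even /smom !odd_double !doubleK.
rewrite subnK// -(mulr_natl _ 'C(J, I)) -!exprM !mul2n.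
have := bin_double IJ.
set b2 := 'C(J.*2, I.*2)%:R; set b1 := 'C(J, I)%:R.
set p1 := \prod_(m < J - I) _; set p2 := \prod_(m < I) (m.*2.+1)%:R.
set p3 := \prod_(m < J) (m.*2.+1)%:R => bd.
set q1 := \prod_(m < I) _; set q2 := \prod_(m < J) _.
have q10 : q1 != 0 by apply/prodf_neq0 => i _; rewrite pnatr_eq0 addnS.
have q20 : q2 != 0 by apply/prodf_neq0 => i _; rewrite pnatr_eq0 addnS.
transitivity (a ^+ (J - I).*2 * enorm v' ^+ I.*2 * (b2 * (p1 * p2)) / q2).
  by field; rewrite q10 q20.
by rewrite bd; field.
Qed.
End Moments.

(** * Polynomial approximation and zonal integrals about any axis *)

Section Weierstrass.
Context {R : realType}.

Lemma uniform_continuity_segment (f : R -> R) (a b e : R) : continuous f -> 0 < e ->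
  exists2 d : R, 0 < d & forall x y, a <= x <= b -> `|x - y| < d -> `|f x - f y| < e.
Proof.
move=> cf e0.
have /compact_near_coveringP := @segment_compact R a b.
move=> /(_ R (0^'+) (fun d x => forall y, `|x - y| < d -> `|f x - f y| < e)).
move=> /(_ _) H.
have {}H : \forall d \near 0^'+, `[a, b] `<=`
    (fun x => forall y, `|x - y| < d -> `|f x - f y| < e).
  apply: H => x _.
  have /cvgrPdist_lt/(_ (e / 2)) : f y @[y --> x] --> f x by exact: cf.
  rewrite divr_gt0// => /(_ isT) /nbhs_ballP[eta /= eta0 He].
  exists (ball x (eta / 2), [set d | 0 < d < eta / 2]) => /=.
    split; first by apply: nbhsx_ballx; rewrite divr_gt0.
    near=> d; apply/andP; split; first by [].
    near: d; apply: nbhs_right_lt; by rewrite divr_gt0.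
  move=> [x' d] /= [xx' /andP[d0 dh]] y x'y.
  have h1 : `|f x - f x'| < e / 2.
    by apply: He; apply: le_ball xx'; lra.
  have h2 : `|f x - f y| < e / 2.
    apply: He; rewrite -ball_normE/= in xx' *.
    rewrite (_ : x - y = (x - x') + (x' - y)); last by ring.
    by apply: le_lt_trans (ler_normD _ _) _; lra.
  rewrite (_ : f x' - f y = (f x - f y) - (f x - f x')); last by ring.
  by apply: le_lt_trans (ler_normB _ _) _; lra.
have [d dP] := filter_ex (filterI (nbhs_right_gt (0 : R)) H).
exists d; first exact: dP.1.
by move=> x y xab; apply: dP.2; rewrite /= in_itv.
Unshelve. all: by end_near. Qed.

(* The Bernstein operator of order [n], written through Pascal's recursion so
   that no binomial coefficient is needed. *)
Fixpoint bernstein (y : R) (n : nat) (phi : nat -> R) : R :=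
  if n is n'.+1 then
    (1 - y) * bernstein y n' phi + y * bernstein y n' (phi \o S)
  else phi 0%N.

Fixpoint bernstein_poly (p : {poly R}) (n : nat) (phi : nat -> R) : {poly R} :=
  if n is n'.+1 then
    (1 - p) * bernstein_poly p n' phi + p * bernstein_poly p n' (phi \o S)
  else (phi 0%N)%:P.

Lemma horner_bernstein p n phi x :
  (bernstein_poly p n phi).[x] = bernstein p.[x] n phi.
Proof. by elim: n phi => [|n ih] phi /=; rewrite !hornerE// !ih. Qed.

Lemma bernsteinD y n phi psi :
  bernstein y n (fun k => phi k + psi k) = bernstein y n phi + bernstein y n psi.
Proof.
elim: n phi psi => [//|n ih] phi psi /=.
rewrite ih (_ : _ \o S = fun k => (phi \o S) k + (psi \o S) k)// ih; ring.
Qed.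

Lemma bernsteinZ y n c phi :
  bernstein y n (fun k => c * phi k) = c * bernstein y n phi.
Proof.
elim: n phi => [//|n ih] phi /=.
rewrite ih (_ : _ \o S = fun k => c * (phi \o S) k)// ih; ring.
Qed.

Lemma bernstein_cst y n c : bernstein y n (fun=> c) = c.
Proof.
elim: n => [//|n ih] /=.
rewrite (_ : _ \o S = fun=> c)// ih; ring.
Qed.

Lemma le_bernstein y n phi psi : 0 <= y <= 1 ->
  (forall k, (k <= n)%N -> phi k <= psi k) ->
  bernstein y n phi <= bernstein y n psi.
Proof.
move=> /andP[y0 y1]; elim: n phi psi => [|n ih] phi psi le /=; first exact: le.
apply: lerD; apply: ler_wpM2l; rewrite ?subr_ge0//; apply: ih => k kn.
  by apply: le; exact: leqW.
exact: le.
Qed.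

(** Squared bias plus variance of the binomial law with parameters n and y. *)
Lemma bernstein_sqr y n a :
  bernstein y n (fun k => (k%:R - a) ^+ 2) = (n%:R * y - a) ^+ 2 + n%:R * y * (1 - y).
Proof.
elim: n a => [|n ih] a /=; first by ring.
rewrite ih (_ : _ \o S = fun k => (k%:R - (a - 1)) ^+ 2).
  by rewrite ih -natr1; ring.
by apply/funext => k /=; rewrite -natr1; ring.
Qed.

(** Bernstein's proof: the error is at most e / 2 from nodes near the point, and nodes away from it
    contribute at most a multiple of the variance, as in Chebyshev's inequality. *)
Lemma weierstrass (f : R -> R) (B e : R) : continuous f -> 0 < B -> 0 < e ->
  exists p : {poly R}, forall x, `|x| <= B -> `|f x - p.[x]| <= e.
Proof.
move=> cf B0 e0.
have [d d0 dP] := @uniform_continuity_segment f (- B) B (e / 2) cf ltac:(lra).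
have [c1 _ c1P] := @EVT_max R (fun t => `|f t|) (- B) B ltac:(lra)
  ltac:(apply: continuous_subspaceT => x; apply: continuous_comp;
        [exact: cf|exact: norm_continuous]).
set M := `|f c1| in c1P.
have M0 : 0 <= M by exact: normr_ge0.
have fM x : `|x| <= B -> `|f x| <= M by rewrite ler_norml => xB; apply: c1P; rewrite in_itv.
(* Where |x - z| >= d, the oscillation 2 M is at most 2 M (x - z)^2 / d^2; the factor (2 B)^2 comes
   from rescaling [-B, B] to [0, 1]. *)
pose K := 2 * M / d ^+ 2 * (2 * B) ^+ 2.
have K0 : 0 <= K by rewrite !mulr_ge0 ?invr_ge0 ?sqr_ge0//; lra.
have [N NP] : exists N : nat, K / (e / 2) < N%:R.
  have := archi_boundP (divr_ge0 K0 (ltW (_ : 0 < e / 2))).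
  by move=> H; eexists; apply: H; lra.
set n := N.+1; have n0 : 0 < n%:R :> R by rewrite ltr0n.
pose Y : {poly R} := ('X + B%:P) * ((2 * B)^-1)%:P.
pose phi (k : nat) := f (2 * B * (k%:R / n%:R) - B).
exists (bernstein_poly Y n phi) => x xB.
have [xB1 xB2] : - B <= x /\ x <= B by move: xB; rewrite ler_norml => /andP[].
rewrite horner_bernstein; set y := Y.[x].
have yE : y = (x + B) / (2 * B) by rewrite /y !hornerE.
have xE : x = 2 * B * y - B by rewrite yE; field; lra.
have y0 : 0 <= y by rewrite yE divr_ge0//; lra.
have y1 : y <= 1 by rewrite yE ler_pdivrMr ?mul1r; lra.
have y01 : 0 <= y <= 1 by rewrite y0 y1.
pose psi (k : nat) := e / 2 + K / n%:R ^+ 2 * (k%:R - n%:R * y) ^+ 2.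
have key k : (k <= n)%N -> `|f x - phi k| <= psi k.
  move=> kn; rewrite /psi; set z := 2 * B * (k%:R / n%:R) - B.
  have kn0 : 0 <= k%:R / n%:R :> R by rewrite divr_ge0.
  have kn1 : k%:R / n%:R <= 1 :> R by rewrite ler_pdivrMr// mul1r ler_nat.
  have zB : `|z| <= B by rewrite ler_norml; apply/andP; split; rewrite /z; nra.
  have xz : x - z = 2 * B / n%:R * (n%:R * y - k%:R).
    by rewrite xE /z; field; rewrite gt_eqF.
  have q0 : 0 <= K / n%:R ^+ 2 * (k%:R - n%:R * y) ^+ 2.
    by apply: mulr_ge0; [apply: divr_ge0 => //; exact: sqr_ge0|exact: sqr_ge0].
  have [xzd|xzd] := ltP `|x - z| d.
    by have := dP x z (ltac:(by rewrite xB1 xB2)) xzd; rewrite /phi -/z; lra.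
  have h : `|f x - f z| <= 2 * M.
    by apply: le_trans (ler_normB _ _) _; have := fM x xB; have := fM z zB; lra.
  rewrite /phi -/z; apply: le_trans h _.
  have -> : K / n%:R ^+ 2 * (k%:R - n%:R * y) ^+ 2 = 2 * M * ((x - z) / d) ^+ 2.
    by rewrite xz /K; field; rewrite !gt_eqF.
  have : 1 <= ((x - z) / d) ^+ 2.
    rewrite -[X in _ <= X]ger0_norm ?sqr_ge0// normrX exprn_ege1//.
    by rewrite normf_div (gtr0_norm d0) ler_pdivlMr// mul1r.
  by nra.
have le1 : f x - bernstein y n phi <= bernstein y n psi.
  rewrite -[f x](bernstein_cst y n) -[X in _ - X]mul1r -mulNr -bernsteinZ -bernsteinD.
  apply: le_bernstein => // k kn; rewrite mulN1r.
  exact: le_trans (ler_norm _) (key k kn).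
have le2 : - (f x - bernstein y n phi) <= bernstein y n psi.
  rewrite opprB -[f x](bernstein_cst y n) -[X in _ - X]mul1r -mulNr -bernsteinZ -bernsteinD.
  apply: le_bernstein => // k kn; rewrite mulN1r -opprB.
  by apply: le_trans (ler_norm _) _; rewrite normrN; exact: key.
have : bernstein y n psi <= e.
  rewrite /psi bernsteinD bernstein_cst bernsteinZ bernstein_sqr subrr expr0n/= add0r.
  have -> : K / n%:R ^+ 2 * (n%:R * y * (1 - y)) = K / n%:R * (y * (1 - y)).
    by field; rewrite gt_eqF.
  have h1 : K / n%:R <= e / 2.
    rewrite ler_pdivrMr// mulrC -ler_pdivrMr; last by lra.
    by apply: ltW; apply: lt_le_trans NP _; rewrite ler_nat.
  have : 0 <= K / n%:R by rewrite divr_ge0.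
  have : y * (1 - y) <= 1 by nra.
  have : 0 <= y * (1 - y) by nra.
  by nra.
by move=> le3; rewrite ler_norml; apply/andP; split; lra.
Qed.

Lemma cauchy_schwarz n (x y : 'rV[R]_n) : `|dotp x y| <= enorm x * enorm y.
Proof.
suff H : dotp x y ^+ 2 <= (enorm x * enorm y) ^+ 2.
  rewrite -(ler_pXn2r (n := 2)) ?nnegrE ?mulr_ge0 ?enorm_ge0//.
  by rewrite -normrX ger0_norm// sqr_ge0.
have q t : 0 <= enorm x ^+ 2 * t ^+ 2 - 2 * dotp x y * t + enorm y ^+ 2.
  rewrite !sqr_enorm /dotp mulr_suml -mulrA mulr_suml mulr_sumr.
  rewrite -sumrB -big_split/= sumr_ge0// => i _.
  rewrite (_ : _ + _ = (x 0 i * t - y 0 i) ^+ 2); last by ring.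
  exact: sqr_ge0.
have [x0|x0] := eqVneq (enorm x ^+ 2) 0.
  have h : dotp x y = 0.
    rewrite /dotp big1// => i _.
    have : \sum_i x 0 i ^+ 2 == 0 by rewrite -sqr_enorm x0.
    rewrite psumr_eq0 => [/allP/(_ i)|j _]; last exact: sqr_ge0.
    by rewrite mem_index_enum sqrf_eq0/= => /(_ isT)/eqP ->; rewrite mul0r.
  by rewrite h expr0n/= sqr_ge0.
have := q (dotp x y / enorm x ^+ 2).
have xp : 0 < enorm x ^+ 2 by rewrite lt_neqAle eq_sym x0 sqr_ge0.
rewrite (_ : _ + _ = (enorm x ^+ 2 * enorm y ^+ 2 - dotp x y ^+ 2) / enorm x ^+ 2); last first.
  by field; rewrite -[enorm x]/(enorm x) -sqrf_eq0.
by rewrite pmulr_lge0 ?invr_gt0// exprMn subr_ge0.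
Qed.

(** Both sides agree on powers, with the common value |v|^j [smom k.+1 j], hence on polynomials.
    Both are means, so a uniform error e / 2 in f costs at most e / 2 on each side. *)
Lemma sint_zonal k (f : R -> R) (v : 'rV[R]_k.+2) : continuous f ->
  sint (fun z => f (dotp z v)) = wmean k (fun t => f (enorm v * t)).
Proof.
move=> cf.
have sf : sbd (fun z : 'rV[R]_k.+2 => f (dotp z v)).
  by apply: sbd_comp => //; exact: sbd_dotp.
have mf : mbd (fun t => f (enorm v * t)).
  apply: mbd_continuous => t; apply: continuous_comp; last exact: cf.
  by apply: continuousM; [exact: cst_continuous|].
apply/eqP; rewrite -subr_eq0 -normr_eq0 eq_le normr_ge0 andbT.
apply/ler_addgt0Pl => e e0; rewrite addr0.
(* The margin 1 keeps the interval nondegenerate when v = 0. *)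
have [p pP] := @weierstrass f (enorm v + 1) (e / 2) cf
  (ltac:(have := enorm_ge0 v; lra)) ltac:(lra).
have sp : sbd (fun z : 'rV[R]_k.+2 => p.[dotp z v]).
  under eq_fun do rewrite horner_coef.
  by apply: sbd_sum => i; apply: sbdM; [exact: sbd_cst|apply: sbdX; exact: sbd_dotp].
have mp : mbd (fun t => p.[enorm v * t]).
  under eq_fun do rewrite horner_coef.
  apply: mbd_sum => i; apply: mbdM; [exact: mbd_cst|apply: mbdX].
  by apply: mbdM; [exact: mbd_cst|exact: mbd_id].
have eqp : sint (fun z => p.[dotp z v]) = wmean k (fun t => p.[enorm v * t]).
  rewrite (@eq_sint _ _ _ (fun z => \sum_(i < size p) p`_i * dotp z v ^+ i)); last first.
    by move=> z _; rewrite horner_coef.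
  rewrite (@eq_wmean _ _ _ (fun t => \sum_(i < size p) p`_i * enorm v ^+ i * t ^+ i)); last first.
    by move=> t _; rewrite horner_coef; apply: eq_bigr => i _; rewrite exprMn mulrA.
  rewrite sint_sum; last first.
    by move=> i; apply: sbdM; [exact: sbd_cst|apply: sbdX; exact: sbd_dotp].
  rewrite wmean_sum; last first.
    by move=> i; apply: mbdM; [exact: mbd_cst|apply: mbdX; exact: mbd_id].
  apply: eq_bigr => i _; rewrite sintZ; last by apply: sbdX; exact: sbd_dotp.
  rewrite wmeanZ; last by apply: mbdX; exact: mbd_id.
  by rewrite sint_dotp_pow wmean_pow mulrA.
have h1 : `|sint (fun z => f (dotp z v)) - sint (fun z => p.[dotp z v])| <= e / 2.
  rewrite -sintB// -[e / 2](@sint_cst _ k.+1); apply: normr_sint.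
  - exact: sbdB.
  - exact: sbd_cst.
  move=> z z1; apply: pP; apply: le_trans (cauchy_schwarz _ _) _.
  by rewrite z1 mul1r; lra.
have h2 : `|wmean k (fun t => f (enorm v * t)) - wmean k (fun t => p.[enorm v * t])| <= e / 2.
  rewrite -wmeanB// -[e / 2](@wmean_cst _ k); apply: normr_wmean.
  - exact: mbdB.
  - exact: mbd_cst.
  move=> t; rewrite /m1p1/= in_itv/= -ltr_norml => t1; apply: pP.
  by rewrite normrM ger0_norm ?enorm_ge0//; have := enorm_ge0 v; nra.
rewrite (_ : _ - _ = (sint (fun z => f (dotp z v)) - sint (fun z => p.[dotp z v])) -
  (wmean k (fun t => f (enorm v * t)) - wmean k (fun t => p.[enorm v * t]))); last first.
  by rewrite eqp; ring.
by apply: le_trans (ler_normB _ _) _; lra.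
Qed.
End Weierstrass.

(** * Euclidean linear algebra *)

Section LinearAlgebra.
Context {R : realType}.

Lemma dotpE n (x y : 'rV[R]_n) : dotp x y = (x *m y^T) 0 0.
Proof. by rewrite mxE; apply: eq_bigr => i _; rewrite mxE. Qed.

Lemma dotpp n (x : 'rV[R]_n) : dotp x x = enorm x ^+ 2.
Proof. by rewrite sqr_enorm; apply: eq_bigr => i _; rewrite expr2. Qed.

Lemma dotpC n (x y : 'rV[R]_n) : dotp x y = dotp y x.
Proof. by apply: eq_bigr => i _; rewrite mulrC. Qed.

Lemma dotpDl n (x y z : 'rV[R]_n) : dotp (x + y) z = dotp x z + dotp y z.
Proof. by rewrite /dotp -big_split/=; apply: eq_bigr => i _; rewrite mxE mulrDl. Qed.

Lemma dotpZl n c (x z : 'rV[R]_n) : dotp (c *: x) z = c * dotp x z.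
Proof. by rewrite /dotp mulr_sumr; apply: eq_bigr => i _; rewrite mxE mulrA. Qed.

Lemma dotpNl n (x z : 'rV[R]_n) : dotp (- x) z = - dotp x z.
Proof. by rewrite -scaleN1r dotpZl mulN1r. Qed.

Lemma dotpBl n (x y z : 'rV[R]_n) : dotp (x - y) z = dotp x z - dotp y z.
Proof. by rewrite dotpDl dotpNl. Qed.

Lemma dotpDr n (x y z : 'rV[R]_n) : dotp z (x + y) = dotp z x + dotp z y.
Proof. by rewrite dotpC dotpDl !(dotpC z). Qed.

Lemma dotpZr n c (x z : 'rV[R]_n) : dotp z (c *: x) = c * dotp z x.
Proof. by rewrite dotpC dotpZl (dotpC z). Qed.

Lemma dotpBr n (x y z : 'rV[R]_n) : dotp z (x - y) = dotp z x - dotp z y.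
Proof. by rewrite dotpC dotpBl !(dotpC z). Qed.

Lemma dotp0l n (z : 'rV[R]_n) : dotp 0 z = 0.
Proof. by rewrite /dotp big1// => i _; rewrite mxE mul0r. Qed.

Lemma enorm0 n : enorm (0 : 'rV[R]_n) = 0.
Proof. by apply/eqP; rewrite -sqrf_eq0 -dotpp dotp0l. Qed.

Lemma enorm_eq0 n (x : 'rV[R]_n) : (enorm x == 0) = (x == 0).
Proof.
apply/eqP/eqP => [x0|->]; last exact: enorm0.
apply/rowP => i; rewrite mxE.
have : \sum_i x 0 i ^+ 2 == 0 by rewrite -sqr_enorm x0 expr0n.
rewrite psumr_eq0 => [/allP/(_ i)|j _]; last exact: sqr_ge0.
by rewrite mem_index_enum sqrf_eq0/= => /(_ isT)/eqP.
Qed.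

Lemma enormZ n c (x : 'rV[R]_n) : enorm (c *: x) = `|c| * enorm x.
Proof.
apply/eqP; rewrite -(eqrXn2 (n := 2)) ?enorm_ge0 ?mulr_ge0 ?enorm_ge0//.
by rewrite exprMn -!dotpp dotpZl dotpZr mulrA -expr2 real_normK ?num_real.
Qed.

Lemma enormN n (x : 'rV[R]_n) : enorm (- x) = enorm x.
Proof. by rewrite -scaleN1r enormZ normrN1 mul1r. Qed.

Lemma ler_enormD n (x y : 'rV[R]_n) : enorm (x + y) <= enorm x + enorm y.
Proof.
rewrite -(ler_pXn2r (n := 2)) ?nnegrE ?addr_ge0 ?enorm_ge0//.
rewrite -dotpp dotpDl !dotpDr !dotpp (dotpC y).
have := le_trans (ler_norm _) (cauchy_schwarz x y); lra.
Qed.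

Lemma enormB n (x y : 'rV[R]_n) : enorm (x - y) = enorm (y - x).
Proof. by rewrite -enormN opprB. Qed.

Lemma ler_enormB n (x y : 'rV[R]_n) : enorm x - enorm y <= enorm (x - y).
Proof. by rewrite lerBlDr -{1}(subrK y x) ler_enormD. Qed.

(** Testing against all w replaces an estimate of a vector-valued integral by one of scalar
    integrals. *)
Lemma enorm_le_dual n (x : 'rV[R]_n) B : 0 <= B ->
  (forall w, dotp x w <= B * enorm w) -> enorm x <= B.
Proof.
move=> B0 H; have := H x; rewrite dotpp expr2.
have [->|x0] := eqVneq (enorm x) 0; first by [].
by rewrite ler_pM2r// lt_neqAle eq_sym x0 enorm_ge0.
Qed.

Definition isometric_mx n (Q : 'M[R]_n) := forall x : 'rV[R]_n, enorm (x *m Q) = enorm x.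

(** The reflection in the hyperplane orthogonal to x - e exchanges x and e; it degenerates for x =
    e, where the identity serves. As an involution it has determinant of modulus 1. *)
Lemma householder n (x : 'rV[R]_n.+1) : enorm x = 1 ->
  exists Q : 'M[R]_n.+1, [/\ `|\det Q| = 1, isometric_mx Q,
    delta_mx 0 0 *m Q = x & x *m Q = delta_mx 0 0].
Proof.
move=> x1; pose e : 'rV[R]_n.+1 := delta_mx 0 0.
have e1 : enorm e = 1.
  apply: enorm_eq1; rewrite (bigD1 0)//= !mxE !eqxx expr1n big1 ?addr0// => i i0.
  by rewrite mxE eqxx (negbTE i0) expr0n.
have [xe|xe] := eqVneq x e.
  exists 1%:M; split; [by rewrite det1 normr1|by move=> z; rewrite mulmx1| |].
    by rewrite mulmx1 -/e xe.
  by rewrite mulmx1 xe.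
have [z zE] : exists z, z = x - e by exists (x - e).
have z0 : enorm z != 0 by rewrite enorm_eq0 zE subr_eq0.
pose c := 2 / enorm z ^+ 2.
pose Q : 'M[R]_n.+1 := 1%:M - c *: (z^T *m z).
have actE y : y *m Q = y - (c * dotp y z) *: z.
  rewrite mulmxBr mulmx1 -scalemxAr mulmxA; congr (_ - _).
  have -> : y *m z^T = (dotp y z)%:M.
    by apply/matrixP => i j; rewrite !ord1 [RHS]mxE eqxx mulr1n dotpE.
  by rewrite mul_scalar_mx scalerA.
have isoQ : isometric_mx Q.
  move=> y; apply/eqP; rewrite -(eqrXn2 (n := 2)) ?enorm_ge0//; apply/eqP.
  rewrite actE -dotpp dotpBl !dotpBr !dotpZl !dotpZr !dotpp (dotpC z y) /c.
  by field.
have QQ : Q *m Q = 1%:M.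
  apply/row_matrixP => i; rewrite row_mul !rowE mulmx1 !actE.
  by rewrite dotpBl dotpZl dotpp -addrA -opprD -scalerDl [X in X *: z](_ : _ = 0) ?scale0r ?subr0 //; rewrite /c; field.
have zz : enorm z ^+ 2 = 2 - 2 * dotp x e.
  rewrite -dotpp zE dotpBl !dotpBr !dotpp x1 e1 (dotpC e); ring.
have xQ : x *m Q = e.
  have cxz : c * dotp x z = 1.
    rewrite {1}zE dotpBr dotpp x1 /c zz; field.
    by rewrite -zz sqrf_eq0.
  by rewrite actE cxz scale1r zE opprB addrC subrK.
exists Q; split => //; last by rewrite -/e -xQ -mulmxA QQ mulmx1.
have := congr1 determinant QQ; rewrite det_mulmx det1 -expr2 => d2.
by apply/eqP; rewrite -(eqrXn2 (n := 2))// expr1n -normrX d2 normr1.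
Qed.

(** A reflection takes the first row to a multiple of the first basis vector and preserves row
    lengths and the modulus of the determinant; expansion then leaves a minor whose rows are
    truncations of the others. *)
Lemma hadamard n (A : 'M[R]_n) : `|\det A| <= \prod_i enorm (row i A).
Proof.
elim: n A => [|n ih] A; first by rewrite det_mx00 normr1 big_ord0.
have [r0|r0] := eqVneq (enorm (row 0 A)) 0.
  rewrite (_ : \det A = 0) ?normr0 ?prodr_ge0// => [i _|]; first exact: enorm_ge0.
  move/eqP : r0; rewrite enorm_eq0 => /eqP r0.
  rewrite (expand_det_row _ 0) big1// => j _.
  by have := congr1 (fun v : 'rV_n.+1 => v 0 j) r0; rewrite !mxE => ->; rewrite mul0r.
pose x := (enorm (row 0 A))^-1 *: row 0 A.
have x1 : enorm x = 1.
  by rewrite enormZ normfV ger0_norm ?enorm_ge0// mulVf.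
have [Q [dQ iQ _ xQ]] := householder x1.
pose B := A *m Q.
have rB i : enorm (row i B) = enorm (row i A) by rewrite row_mul iQ.
have r0B : row 0 B = enorm (row 0 A) *: delta_mx 0 0.
  by rewrite row_mul -xQ -scalemxAl scalerA divff// scale1r.
have -> : `|\det A| = `|\det B| by rewrite det_mulmx normrM dQ mulr1.
rewrite (expand_det_row _ 0) (bigD1 0)//= big1 ?addr0; last first.
  move=> j j0; have := congr1 (fun v : 'rV_n.+1 => v 0 j) r0B.
  by rewrite !mxE !eqxx (negbTE j0) mulr0 => ->; rewrite mul0r.
have := congr1 (fun v : 'rV_n.+1 => v 0 0) r0B.
rewrite !mxE !eqxx mulr1 => ->.
rewrite big_ord_recl normrM ger0_norm ?enorm_ge0// ler_wpM2l ?enorm_ge0//.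
rewrite /cofactor addn0 expr0 mul1r; apply: le_trans (ih _) _.
apply: ler_prod => i _; rewrite enorm_ge0/= -rB.
rewrite -(ler_pXn2r (n := 2)) ?nnegrE ?enorm_ge0// !sqr_enorm big_ord_recl.
rewrite (_ : \sum_(j < n) _ = \sum_(j < n) row (lift ord0 i) B 0 (lift ord0 j) ^+ 2).
  by rewrite lerDr sqr_ge0.
by apply: eq_bigr => j _; rewrite !mxE.
Qed.

(** A lower bound for the smallest singular value. For an orthogonal Q with first row x / |x|,
    Hadamard's inequality bounds |det A| = |det(Q A)| by |x A| / |x| times n factors, each at most
    L. *)
Lemma enorm_mulmx_ge n (A : 'M[R]_n.+1) L (x : 'rV[R]_n.+1) :
  (forall y : 'rV[R]_n.+1, enorm (y *m A) <= L * enorm y) ->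
  `|\det A| * enorm x <= L ^+ n * enorm (x *m A).
Proof.
move=> AL.
have [->|x0] := eqVneq x 0; first by rewrite mul0mx enorm0 !mulr0.
have ex0 : enorm x != 0 by rewrite enorm_eq0.
have xp : 0 < enorm x by rewrite lt_neqAle eq_sym ex0 enorm_ge0.
pose y := (enorm x)^-1 *: x.
have y1 : enorm y = 1 by rewrite enormZ normfV ger0_norm ?enorm_ge0// mulVf.
have [Q [dQ iQ eQ _]] := householder y1.
have rQ i : enorm (row i Q) = 1.
  rewrite rowE iQ; apply: enorm_eq1; rewrite (bigD1 i)//= !mxE !eqxx expr1n.
  by rewrite big1 ?addr0// => j ji; rewrite mxE eqxx (negbTE ji) expr0n.
have := hadamard (Q *m A); rewrite det_mulmx normrM dQ mul1r big_ord_recl.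
rewrite row_mul rowE eQ => h.
have h2 : `|\det A| <= enorm (y *m A) * L ^+ n.
  apply: le_trans h _; rewrite ler_wpM2l ?enorm_ge0//.
  rewrite -[X in _ <= _ ^+ X]card_ord -prodr_const; apply: ler_prod => i _.
  by rewrite enorm_ge0/= row_mul; apply: le_trans (AL _) _; rewrite rQ mulr1.
have nx : `|(enorm x)^-1| = (enorm x)^-1 by rewrite ger0_norm// invr_ge0 enorm_ge0.
rewrite -scalemxAl enormZ nx in h2.
rewrite -ler_pdivlMr//; apply: le_trans h2 _.
by rewrite le_eqVlt; apply/orP; left; apply/eqP; ring.
Qed.
End LinearAlgebra.

(** * Taylor estimates and power series *)

Section Taylor.
Context {R : realType}.

(** With B uniform in an integration variable, a quadratic remainder estimate can itself be
    integrated; this is how differentiation under the integral sign is done throughout. *)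
Lemma is_derive_quad (F : R -> R) (x d del B : R) : 0 < del ->
  (forall h, `|h| < del -> `|F (x + h) - F x - h * d| <= B * h ^+ 2) ->
  is_derive x 1 F d.
Proof.
move=> del0 H.
have cv : h^-1 *: (F (h *: 1 + x) - F x) @[h --> 0^'] --> d.
  apply/cvgrPdist_le => e e0; near=> h.
  have h0 : h != 0 by near: h; exact: nbhs_dnbhs_neq.
  have hd : `|h| < del by near: h; exact: (@dnbhs0_lt _ R^o).
  have hB : `|h| < e / (`|B| + 1).
    near: h; apply: (@dnbhs0_lt _ R^o); rewrite divr_gt0//.
  have -> : h *: (1 : R) + x = x + h by rewrite addrC; congr (_ + _); exact: mulr1.
  rewrite -[h^-1 *: _]/(h^-1 * _).
  have -> : d - h^-1 * (F (x + h) - F x) = - (h^-1 * (F (x + h) - F x - h * d)).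
    by field.
  rewrite normrN normrM normfV.
  have h1 : 0 < `|h| by rewrite normr_gt0.
  rewrite ler_pdivrMl//; apply: le_trans (H h hd) _.
  have -> : h ^+ 2 = `|h| ^+ 2 by rewrite real_normK ?num_real.
  rewrite expr2 mulrA mulrC ler_pM2l//.
  rewrite ltr_pdivlMr in hB; last by have := normr_ge0 B; lra.
  have := ler_norm B; nra.
by apply: DeriveDef; [apply/cvg_ex; exists d|exact: cvg_lim].
Unshelve. all: by end_near. Qed.

Lemma mvt_near (g g1 : R -> R) (x h : R) :
  (forall s, `|s - x| <= `|h| -> is_derive s 1 g (g1 s)) ->
  exists2 c, `|c - x| <= `|h| & g (x + h) - g x = g1 c * h.
Proof.
move=> H.
have cont (a b : R) : (forall s : R, s \in `[a, b] -> is_derive s 1 g (g1 s)) ->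
    {within `[a, b], continuous g}.
  by move=> dg; apply: derivable_within_continuous => s /dg [].
have [h0|h0] := leP 0 h.
  have dg s : s \in `[x, x + h] -> is_derive s 1 g (g1 s).
    rewrite in_itv/= => /andP[? ?]; apply: H.
    by rewrite (ger0_norm h0) ger0_norm; lra.
  have xh : x <= x + h by rewrite lerDl.
  have cg := cont _ _ dg.
  have dg' s : s \in `]x, x + h[ -> is_derive s 1 g (g1 s).
    by move=> sx; apply: dg; exact: subset_itv_oo_cc.
  have [c cP E] := MVT_segment xh dg' cg.
  exists c; last by rewrite E; congr (_ * _); ring.
  move: cP; rewrite in_itv/= => /andP[? ?].
  by rewrite (ger0_norm h0) ger0_norm; lra.
have dg s : s \in `[x + h, x] -> is_derive s 1 g (g1 s).
  rewrite in_itv/= => /andP[? ?]; apply: H.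
  by rewrite (ltr0_norm h0) ler0_norm; lra.
have xh : x + h <= x by rewrite gerDl ltW.
have cg := cont _ _ dg.
have dg' s : s \in `]x + h, x[ -> is_derive s 1 g (g1 s).
  by move=> sx; apply: dg; exact: subset_itv_oo_cc.
have [c cP E] := MVT_segment xh dg' cg.
exists c.
  move: cP; rewrite in_itv/= => /andP[? ?].
  by rewrite (ltr0_norm h0) ler0_norm; lra.
by rewrite -opprB E; ring.
Qed.

(** Two mean value steps. The constant is B and not B / 2, as only the order in h matters for
    [is_derive_quad]. *)
Lemma taylor2 (g g1 g2 : R -> R) (x h B : R) :
  (forall s, `|s - x| <= `|h| -> is_derive s 1 g (g1 s)) ->
  (forall s, `|s - x| <= `|h| -> is_derive s 1 g1 (g2 s)) ->
  (forall s, `|s - x| <= `|h| -> `|g2 s| <= B) ->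
  `|g (x + h) - g x - h * g1 x| <= B * h ^+ 2.
Proof.
move=> d1 d2 b.
have [c cP ->] := mvt_near d1.
have [s sP E] : exists2 s, `|s - x| <= `|c - x| & g1 (x + (c - x)) - g1 x = g2 s * (c - x).
  by apply: mvt_near => s sc; apply: d2; exact: le_trans sc cP.
have -> : g1 c * h - h * g1 x = (g1 (x + (c - x)) - g1 x) * h.
  by rewrite (_ : x + (c - x) = c); ring.
rewrite E !normrM -mulrA; apply: ler_pM => //.
- by apply: b; exact: le_trans sP cP.
have -> : h ^+ 2 = `|h| * `|h| by rewrite -expr2 real_normK ?num_real.
by rewrite ler_wpM2r.
Qed.

(** The sum of the two end values covers both signs of the exponent at once. *)
Lemma powR_le_ends (y m M e : R) : 0 < m -> m <= y <= M -> y `^ e <= m `^ e + M `^ e.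
Proof.
move=> m0 /andP[my yM].
have y0 : 0 < y by lra.
have M0 : 0 < M by lra.
have [e0|e0] := leP 0 e.
  have : y `^ e <= M `^ e by apply: ge0_ler_powR => //; rewrite nnegrE ltW.
  by have := powR_ge0 m e; lra.
have : y `^ e <= m `^ e.
  rewrite -[e]opprK 2!(powRN _ (- e)) lef_pV2 ?posrE ?powR_gt0//.
  by apply: ge0_ler_powR; rewrite ?nnegrE; lra.
by have := powR_ge0 M e; lra.
Qed.

Lemma is_derive_powR_comp (q : R -> R) (a s q1 : R) : 0 < q s -> is_derive s 1 q q1 ->
  is_derive s 1 (fun s => q s `^ a) (a * q s `^ (a - 1) * q1).
Proof.
move=> q0 dq; exact: (is_derive1_comp (is_derive1_powR a q0) dq).
Qed.

(** Bounds, term by term, the second derivative of q^a p^c when q and p lie in [m, M] and their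
    first two derivatives are at most M in modulus. *)
Definition qp_bound (a c m M : R) : R :=
  let E e := m `^ e + M `^ e in
  `|a * (a - 1)| * M ^+ 2 * E (a - 2) * E c + `|a| * M * E (a - 1) * E c +
  2 * `|a * c| * M ^+ 2 * E (a - 1) * E (c - 1) +
  `|c * (c - 1)| * M ^+ 2 * E a * E (c - 2) + `|c| * M * E a * E (c - 1).

Definition qp_deriv (a c : R) (q q1 p p1 : R -> R) (s : R) : R :=
  a * q1 s * q s `^ (a - 1) * p s `^ c + c * p1 s * q s `^ a * p s `^ (c - 1).

(** Along a line the Poisson kernel is such a product, with q and p quadratic in the parameter; the
    zonal integrals use the case a = 0. *)
Lemma qp_taylor (a c m M x h : R) (q q1 q2 p p1 p2 : R -> R) : 0 < m ->
  (forall s, `|s - x| <= `|h| -> [/\ is_derive s 1 q (q1 s), is_derive s 1 q1 (q2 s),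
     is_derive s 1 p (p1 s) & is_derive s 1 p1 (p2 s)]) ->
  (forall s, `|s - x| <= `|h| -> [/\ m <= q s <= M, m <= p s <= M,
     `|q1 s| <= M, `|p1 s| <= M & `|q2 s| <= M /\ `|p2 s| <= M]) ->
  `|q (x + h) `^ a * p (x + h) `^ c - q x `^ a * p x `^ c -
    h * qp_deriv a c q q1 p p1 x| <= qp_bound a c m M * h ^+ 2.
Proof.
move=> m0 D Bd.
pose g2 s := a * (a - 1) * q1 s ^+ 2 * (q s `^ (a - 2) * p s `^ c) +
  a * q2 s * (q s `^ (a - 1) * p s `^ c) +
  2 * (a * c) * (q1 s * p1 s) * (q s `^ (a - 1) * p s `^ (c - 1)) +
  c * (c - 1) * p1 s ^+ 2 * (q s `^ a * p s `^ (c - 2)) +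
  c * p2 s * (q s `^ a * p s `^ (c - 1)).
apply: (@taylor2 (fun s => q s `^ a * p s `^ c) (qp_deriv a c q q1 p p1) g2).
- move=> s sh; have [dq dq1 dp dp1] := D s sh.
  have [/andP[mq _] /andP[mp _] _ _ _] := Bd s sh.
  have q0 : 0 < q s by lra. have p0 : 0 < p s by lra.
  have da := is_derive_powR_comp a q0 dq; have dc := is_derive_powR_comp c p0 dp.
  apply: is_derive_eq; rewrite /qp_deriv /GRing.scale/=; ring.
- move=> s sh; have [dq dq1 dp dp1] := D s sh.
  have [/andP[mq _] /andP[mp _] _ _ _] := Bd s sh.
  have q0 : 0 < q s by lra. have p0 : 0 < p s by lra.
  have da := is_derive_powR_comp a q0 dq; have dc := is_derive_powR_comp c p0 dp.
  have da1 := is_derive_powR_comp (a - 1) q0 dq.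
  have dc1 := is_derive_powR_comp (c - 1) p0 dp.
  have ea : a - 1 - 1 = a - 2 by ring. have ec : c - 1 - 1 = c - 2 by ring.
  rewrite ea in da1; rewrite ec in dc1.
  rewrite /qp_deriv; apply: is_derive_eq; rewrite /g2 /GRing.scale/=; ring.
move=> s sh; have [mq mp b1 b2 [b3 b4]] := Bd s sh.
have qe e := powR_le_ends e m0 mq; have pe e := powR_le_ends e m0 mp.
have M0 : 0 <= M by apply: le_trans b1.
have sq1 : `|q1 s ^+ 2| <= M ^+ 2 by rewrite normrX ler_pXn2r ?nnegrE.
have sp1 : `|p1 s ^+ 2| <= M ^+ 2 by rewrite normrX ler_pXn2r ?nnegrE.
have qp1 : `|q1 s * p1 s| <= M ^+ 2 by rewrite normrM expr2 ler_pM.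
have ab e f : `|q s `^ e * p s `^ f| <= (m `^ e + M `^ e) * (m `^ f + M `^ f).
  rewrite ger0_norm ?mulr_ge0 ?powR_ge0//.
  by apply: ler_pM; rewrite ?powR_ge0.
have T (u v U V : R) : `|u| <= U -> `|v| <= V -> `|u + v| <= U + V.
  by move=> uU vV; apply: le_trans (ler_normD _ _) _; exact: lerD.
rewrite /g2 /qp_bound.
apply: (T _ _ _ _ (T _ _ _ _ (T _ _ _ _ (T _ _ _ _ _ _) _) _) _).
- by rewrite normrM (normrM (_ * _)) -[X in _ <= X]mulrA; do 2 apply: ler_pM => //.
- by rewrite normrM (normrM a) -[X in _ <= X]mulrA; do 2 apply: ler_pM => //.
- rewrite normrM (normrM (2 * _)) (normrM 2) (ger0_norm (_ : 0 <= 2)) //.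
  by rewrite -[X in _ <= X]mulrA; do 2 apply: ler_pM => //.
- by rewrite normrM (normrM (_ * _)) -[X in _ <= X]mulrA; do 2 apply: ler_pM => //.
- by rewrite normrM (normrM c) -[X in _ <= X]mulrA; do 2 apply: ler_pM => //.
Qed.
End Taylor.

(** * Power series and the hypergeometric differential equation *)

Section PowerSeries.
Context {R : realType}.

(* Radius of convergence at least 1. *)
Definition subexp (c : nat -> R) := forall rho : R, 0 < rho < 1 ->
  exists A, forall k, `|c k| * rho ^+ k <= A.

Lemma subexp_cvg c z : subexp c -> `|z| < 1 -> cvgn (pseries c z).
Proof.
move=> sc z1; pose rho := (1 + `|z|) / 2.
have z0 := normr_ge0 z.
have r0 : 0 < rho by rewrite /rho; lra.
have [A AP] := sc rho ltac:(rewrite /rho; apply/andP; split; lra).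
have A0 : 0 <= A by apply: le_trans (AP 0%N); rewrite expr0 mulr1.
apply: normed_cvg; apply: (@series_le_cvg _ _ (geometric A (`|z| / rho))).
- by move=> n /=; exact: normr_ge0.
- by move=> n /=; rewrite mulr_ge0// exprn_ge0// divr_ge0// ltW.
- move=> n /=; rewrite normrM normrX exprMn exprVn.
  rewrite [X in _ <= X]mulrCA [X in X <= _]mulrC ler_wpM2l ?exprn_ge0//.
  by rewrite ler_pdivlMr ?exprn_gt0// AP.
apply: is_cvg_geometric_series; rewrite ger0_norm ?divr_ge0 ?(ltW r0)//.
by rewrite ltr_pdivrMr// mul1r /rho; lra.
Qed.

Lemma bernoulli_ge (h : R) n : 0 <= h -> 1 + n%:R * h <= (1 + h) ^+ n.
Proof.
move=> h0; elim: n => [|n ih]; first by rewrite mul0r addr0 expr0.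
rewrite exprSr -natr1.
have : (1 + n%:R * h) * (1 + h) <= (1 + h) ^+ n * (1 + h) by rewrite ler_wpM2r//; lra.
have : 0 <= n%:R * h * h by rewrite !mulr_ge0.
by lra.
Qed.

(** The factor k is paid for by a larger radius s = rho (1 + h), since k h <= (1 + h)^k by
    Bernoulli's inequality. *)
Lemma subexp_natmul c : subexp c -> subexp (fun k => k%:R * c k).
Proof.
move=> sc rho /andP[r0 r1]; pose s := (1 + rho) / 2.
have s0 : 0 < s by rewrite /s; lra.
have [A AP] := sc s ltac:(rewrite /s; apply/andP; split; lra).
pose h := s / rho - 1.
have h0 : 0 < h.
  by rewrite subr_gt0 ltr_pdivlMr// mul1r /s; lra.
exists (A / h) => k.
rewrite ler_pdivlMr// normrM ger0_norm//.
have -> : k%:R * `|c k| * rho ^+ k * h = k%:R * h * (`|c k| * rho ^+ k) by ring.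
apply: le_trans (AP k); rewrite mulrCA ler_wpM2l//.
have -> : s = rho * (1 + h) by rewrite /h; field; rewrite gt_eqF.
rewrite exprMn mulrC ler_wpM2l ?exprn_ge0 ?(ltW r0)//.
by apply: le_trans (bernoulli_ge k (ltW h0)); lra.
Qed.

Lemma subexp_diffs c : subexp c -> subexp (pseries_diffs c).
Proof.
move=> /subexp_natmul sc rho r01; have [A AP] := sc rho r01.
have r0 : 0 < rho by case/andP : r01.
exists (A / rho) => k; rewrite ler_pdivlMr//.
by apply: le_trans (AP k.+1); rewrite exprSr mulrA.
Qed.

Definition psum (c : nat -> R) z : R := limn (pseries c z).

Lemma is_derive_psum c (z : R) : subexp c -> `|z| < 1 ->
  is_derive z 1 (psum c) (psum (pseries_diffs c) z).
Proof.
move=> sc z1; pose K := (1 + `|z|) / 2; have z0 := normr_ge0 z.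
have K0 : 0 <= K by rewrite /K; lra.
have K1 : `|K| < 1 by rewrite ger0_norm// /K; lra.
apply: (@pseries_snd_diffs _ _ K).
- exact: subexp_cvg.
- by apply: subexp_cvg => //; exact: subexp_diffs.
- by apply: subexp_cvg => //; do 2 apply: subexp_diffs.
- by rewrite (ger0_norm K0) /K; lra.
Qed.

Definition hcoef (a b c : R) (k : nat) : R := poch a k * poch b k / (poch c k * k`!%:R).

Lemma pochS (a : R) k : poch a k.+1 = poch a k * (a + k%:R).
Proof. by rewrite /poch big_ord_recr. Qed.

Lemma poch_gt0 (c : R) k : 0 < c -> 0 < poch c k.
Proof. by move=> c0; apply: prodr_gt0 => i _; rewrite ltr_pwDl. Qed.

Lemma hcoef_rec a b c k : 0 < c ->
  k.+1%:R * (c + k%:R) * hcoef a b c k.+1 = (a + k%:R) * (b + k%:R) * hcoef a b c k.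
Proof.
move=> c0; rewrite /hcoef !pochS factS natrM.
have p0 := poch_gt0 k c0.
have f0 : k`!%:R != 0 :> R by rewrite pnatr_eq0 -lt0n fact_gt0.
have c1 : c + k%:R != 0 by rewrite gt_eqF// ltr_pwDl.
have k1 : k.+1%:R != 0 :> R by rewrite pnatr_eq0.
move: (k.+1%:R) k1 => m k1.
by field; rewrite ?f0 ?c1 ?k1 ?(gt_eqF p0).
Qed.

Lemma hcoef0 (a b c : R) : hcoef a b c 0 = 1.
Proof. by rewrite /hcoef /poch !big_ord0 fact0 !mulr1 divr1. Qed.

Lemma bounded_prefix (u : nat -> R) N A : (forall k, (N <= k)%N -> u k <= A) ->
  exists A', forall k, u k <= A'.
Proof.
move=> H; exists (Num.max A (\big[Num.max/A]_(i < N) u i)) => k.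
have [Nk|kN] := leqP N k; first by rewrite le_max H.
by rewrite le_max (le_bigmax _ (fun i : 'I_N => u i) (Ordinal kN)) orbT.
Qed.

(** A ratio test: rho <= s^2 with s < 1, and past N both |a + k| s and |b + k| s are at most k, so
    the terms no longer increase. *)
Lemma subexp_hcoef a b c : 0 < c -> subexp (hcoef a b c).
Proof.
move=> c0 rho /andP[r0 r1]; pose s := (1 + rho) / 2.
have s0 : 0 < s by rewrite /s; lra.
have s1 : s < 1 by rewrite /s; lra.
have rs : rho <= s ^+ 2 by rewrite /s; nra.
pose T := Num.max `|a| `|b|.
have T0 : 0 <= T by rewrite le_max normr_ge0.
have [N NP] : exists N : nat, T * s / (1 - s) < N%:R.
  have := archi_boundP (_ : 0 <= T * s / (1 - s)).
  by move=> H; eexists; apply: H; rewrite divr_ge0 ?mulr_ge0//; lra.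
have dec k : (N < k)%N -> `|hcoef a b c k.+1| * rho ^+ k.+1 <= `|hcoef a b c k| * rho ^+ k.
  move=> Nk; have Nk' : N%:R <= k%:R :> R by rewrite ler_nat ltnW.
  have kp : 0 < k%:R :> R by rewrite ltr0n (leq_ltn_trans _ Nk).
  have b1 d : `|d| <= T -> `|d + k%:R| * s <= k%:R.
    move=> dT; have : `|d + k%:R| <= T + k%:R.
      by apply: le_trans (ler_normD _ _) _; rewrite lerD// ger0_norm.
    have : T * s < k%:R * (1 - s).
      by rewrite -ltr_pdivrMr; [exact: lt_le_trans NP Nk'|lra].
    by nra.
  have ba := b1 a ltac:(by rewrite le_max lexx).
  have bb := b1 b ltac:(by rewrite le_max lexx orbT).
  have E : k.+1%:R * (c + k%:R) * `|hcoef a b c k.+1| =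
      `|a + k%:R| * `|b + k%:R| * `|hcoef a b c k|.
    have ck : 0 <= k.+1%:R * (c + k%:R) by rewrite mulr_ge0// addr_ge0// ltW.
    by rewrite -{1}(ger0_norm ck) -!normrM hcoef_rec.
  move: (`|hcoef a b c k.+1|) (`|hcoef a b c k|) (normr_ge0 (hcoef a b c k.+1))
    (normr_ge0 (hcoef a b c k)) E => X Y X0 Y0 E.
  have -> : X * rho ^+ k.+1 = rho ^+ k * (X * rho) by rewrite exprSr; ring.
  rewrite [Y * _]mulrC ler_wpM2l ?exprn_ge0 ?(ltW r0)//.
  have na := normr_ge0 (a + k%:R); have nb := normr_ge0 (b + k%:R).
  rewrite -(ler_pM2l (_ : 0 < k%:R * k%:R)) ?mulr_gt0//.
  apply: (@le_trans _ _ (k.+1%:R * (c + k%:R) * X * s ^+ 2)).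
    rewrite [X in X <= _]mulrA; apply: ler_pM => //; [by rewrite !mulr_ge0|exact: ltW|].
    by rewrite ler_wpM2r//; apply: ler_pM; rewrite ?ler_nat// lerDr ltW.
  rewrite E.
  have -> : `|a + k%:R| * `|b + k%:R| * Y * s ^+ 2 =
     (`|a + k%:R| * s) * (`|b + k%:R| * s) * Y by ring.
  by rewrite ler_wpM2r// ler_pM// mulr_ge0// ltW.
apply: (@bounded_prefix _ N.+1 (`|hcoef a b c N.+1| * rho ^+ N.+1)).
move=> k /subnK <-; elim: (k - N.+1)%N => [|j ih]; first by rewrite add0n.
by apply: le_trans ih; rewrite addSn; apply: dec; rewrite addnS ltnS leq_addl.
Qed.

Lemma hyp2F1E (a b c z : R) : hyp2F1 a b c z = psum (hcoef a b c) z.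
Proof. by []. Qed.

Lemma hyp2F1_ode a b c z : 0 < c -> `|z| < 1 ->
  let d1 := pseries_diffs (hcoef a b c) in
  let d2 := pseries_diffs d1 in
  z * (1 - z) * psum d2 z + (c - (a + b + 1) * z) * psum d1 z -
  a * b * psum (hcoef a b c) z = 0.
Proof.
move=> c0 z1 d1 d2; set h := hcoef a b c.
have s0 : subexp h by exact: subexp_hcoef.
have s1 : subexp d1 by exact: subexp_diffs.
have s2 : subexp d2 by exact: subexp_diffs.
have cv u : subexp u -> pseries u z @ \oo --> psum u z.
  by move=> su; have := subexp_cvg su z1; rewrite cvg_limnE || exact.
(* What the partial sums of length N leave of the equation: by the recursion of the coefficients
   everything telescopes to this boundary term, which tends to 0. *)
pose r N := z ^+ N * (N.+1%:R * N%:R * h N.+1 * (1 - z) -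
   N%:R * (N%:R - 1) * h N - (a + b + 1) * N%:R * h N).
have E N : z * (1 - z) * pseries d2 z N + (c - (a + b + 1) * z) * pseries d1 z N -
    a * b * pseries h z N = r N.
  elim: N => [|N ih].
    by rewrite /pseries /series /= !big_geq// /r; ring.
  have ps u : pseries u z N.+1 = pseries u z N + u N * z ^+ N.
    by rewrite /pseries /series/= big_nat_recr.
  rewrite !ps.
  have rec := hcoef_rec a b N c0; rewrite -/h in rec.
  transitivity (r N + z ^+ N * ((z * (1 - z)) * d2 N + (c - (a + b + 1) * z) * d1 N - a * b * h N)).
    by rewrite -ih; ring.
  rewrite /r /d2 /d1 /pseries_diffs -/h exprSr.
  have e1 : N.+1%:R = N%:R + 1 :> R by rewrite natr1.
  have e2 : N.+2%:R = N%:R + 2 :> R by rewrite -addn2 natrD.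
  rewrite e1 in rec; rewrite e2 e1.
  have -> : a * b * h N = (N%:R + 1) * (c + N%:R) * h N.+1 - (a + b) * N%:R * h N - N%:R ^+ 2 * h N.
    by rewrite rec; ring.
  ring.
have t0 u : subexp u -> u N * z ^+ N @[N --> \oo] --> 0.
  by move=> su; apply: cvg_series_cvg_0; exact: subexp_cvg.
have r0 : r @ \oo --> 0.
  have -> : r = fun N => (1 - z) * (N%:R * d1 N * z ^+ N) -
      N%:R * (N%:R * h N) * z ^+ N + N%:R * h N * z ^+ N -
      (a + b + 1) * (N%:R * h N * z ^+ N).
    by apply/funext => N; rewrite /r /d1 /pseries_diffs -/h; ring.
  have n1 := subexp_natmul s0; have n2 := subexp_natmul n1.
  have m1 := subexp_natmul s1.
  rewrite (_ : (0 : R) = (1 - z) * 0 - 0 + 0 - (a + b + 1) * 0); last by ring.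
  apply: cvgB; [apply: cvgD; [apply: cvgB|]|].
  - by apply: cvgM; [exact: cvg_cst|exact: t0 m1].
  - exact: t0 n2.
  - exact: t0 n1.
  - by apply: cvgM; [exact: cvg_cst|exact: t0 n1].
have : (z * (1 - z) * pseries d2 z N + (c - (a + b + 1) * z) * pseries d1 z N -
    a * b * pseries h z N) @[N --> \oo] -->
  z * (1 - z) * psum d2 z + (c - (a + b + 1) * z) * psum d1 z - a * b * psum h z.
  by apply: cvgB; [apply: cvgD|]; apply: cvgM; (try exact: cvg_cst); exact: cv.
under eq_cvg do rewrite E.
by move=> /(cvg_unique _ r0) ->.
Qed.
End PowerSeries.

(** * Zonal integrals are hypergeometric *)

Section ZonalIntegrals.
Context {R : realType}.
Variable k : nat.
Notation nR := (k.+2%:R : R).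

(* The squared distance from a point of norm [r] to a unit vector, [t] being the
   cosine of the angle between them. *)
Definition ss (r t : R) : R := 1 + r ^+ 2 - 2 * r * t.

Lemma ss_bounds r t rho : rho < 1 -> `|r| <= rho -> `|t| <= 1 ->
  (1 - rho) ^+ 2 <= ss r t <= 4.
Proof.
rewrite /ss !ler_norml => r1 /andP[ra rb] /andP[ta tb].
have r2 : r ^+ 2 <= 1 by nra.
apply/andP; split; last by have [r0|r0] := leP 0 r; nra.
have [r0|r0] := leP 0 r.
  have : r * t <= r by nra.
  have : (1 - rho) ^+ 2 <= (1 - r) ^+ 2 by nra.
  by nra.
have : r * t <= - r by nra.
have : (1 - rho) ^+ 2 <= (1 + r) ^+ 2 by nra.
by nra.
Qed.

Lemma m1p1_norm (t : R) : m1p1 t -> `|t| <= 1.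
Proof. by rewrite /m1p1/= in_itv/= -ltr_norml => /ltW. Qed.

Lemma ss_gt0 r t : `|r| < 1 -> `|t| <= 1 -> 0 < ss r t.
Proof.
move=> r1 t1; have /andP[h _] := ss_bounds r1 (lexx _) t1.
by apply: lt_le_trans h; rewrite exprn_gt0// subr_gt0.
Qed.

Lemma mbd_ss r e : `|r| < 1 -> mbd (fun t => ss r t `^ e).
Proof.
move=> r1; split.
  apply: measurable_funTS; apply: (measurableT_comp (measurable_powR e)).
  exact: measurable_funB.
exists (((1 - `|r|) ^+ 2) `^ e + 4 `^ e) => t /m1p1_norm tm.
rewrite ger0_norm ?powR_ge0//; apply: powR_le_ends.
  by rewrite exprn_gt0// subr_gt0.
exact: ss_bounds.
Qed.

Lemma is_derive_wmean (f : R -> R -> R) (f' : R -> R) (x del B : R) : 0 < del ->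
  (forall h, `|h| < del -> mbd (f (x + h))) -> mbd f' ->
  (forall h t, `|h| < del -> m1p1 t ->
     `|f (x + h) t - f x t - h * f' t| <= B * h ^+ 2) ->
  is_derive x 1 (fun y => wmean k (f y)) (wmean k f').
Proof.
move=> d0 mf mf' H; apply: (is_derive_quad d0 (B := B)) => h hd.
have m0 : mbd (f x) by have := mf 0; rewrite normr0 addr0; exact.
have mh := mf h hd.
have mhf : mbd (fun t => h * f' t) by apply: mbdM => //; exact: mbd_cst.
have mff : mbd (fun t => f (x + h) t - f x t) by exact: mbdB.
rewrite -wmeanZ// -wmeanB// -wmeanB// -[B * h ^+ 2](@wmean_cst _ k).
apply: normr_wmean; [exact: mbdB|exact: mbd_cst|].
by move=> t tm; exact: H.
Qed.

Definition zI (m : R -> R) (e r : R) : R := wmean k (fun t => m t * ss r t `^ e).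

Lemma is_derive_zI (m : R -> R) (e r : R) : mbd m -> `|r| < 1 ->
  is_derive r 1 (zI m e) (e * zI (fun t => m t * (2 * r - 2 * t)) (e - 1) r).
Proof.
move=> mm r1; pose rho := (1 + `|r|) / 2.
have r0 := normr_ge0 r.
have rho1 : rho < 1 by rewrite /rho; lra.
pose del := (1 - `|r|) / 2.
have mt : mbd (fun t => m t * (2 * r - 2 * t)).
  apply: mbdM => //; apply: mbdB; first exact: mbd_cst.
  by apply: mbdM; [exact: mbd_cst|exact: mbd_id].
have ms : mbd (fun t => m t * (2 * r - 2 * t) * ss r t `^ (e - 1)).
  by apply: mbdM => //; exact: mbd_ss.
rewrite /zI -wmeanZ//.
have [C C0 mC] : exists2 C, 0 <= C & forall t, m1p1 t -> `|m t| <= C.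
  have [_ [C mC]] := mm; exists `|C| => // t tm; exact: le_trans (mC t tm) (ler_norm _).
(* The minimum with 1 is there because [qp_taylor] is used with q = 1, which must lie in [m, M] as
   well. *)
pose mlo := Num.min 1 ((1 - rho) ^+ 2).
have mlo0 : 0 < mlo by rewrite lt_min ltr01 exprn_gt0// subr_gt0.
apply: (@is_derive_wmean _ _ _ del (C * qp_bound 0 e mlo 4)).
- by rewrite /del; lra.
- move=> h hd; apply: mbdM => //; apply: mbd_ss.
  by apply: le_lt_trans (ler_normD _ _) _; rewrite /del in hd; lra.
- by apply: mbdM => //; exact: mbd_cst.
move=> h t hd tm.
have t1 := m1p1_norm tm.
have := @qp_taylor R 0 e mlo 4 r h (fun=> 1) (fun=> 0) (fun=> 0)
  (fun r => ss r t) (fun r => 2 * r - 2 * t) (fun=> 2) mlo0.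
rewrite /qp_deriv !powR1 !mul0r !mul1r add0r => H.
rewrite -[X in _ <= X]mulrA; apply: le_trans (ler_wpM2l C0 (H _ _)).
- rewrite (_ : _ - _ - _ = m t * (ss (r + h) t `^ e - ss r t `^ e -
    h * (e * (2 * r - 2 * t) * 1 * ss r t `^ (e - 1)))); last by ring.
  by rewrite normrM ler_wpM2r// mC.
- move=> s sh; split.
  + exact: is_derive_cst.
  + exact: is_derive_cst.
  + by rewrite /ss; apply: is_derive_eq; rewrite /GRing.scale/=; ring.
  + by apply: is_derive_eq; rewrite /GRing.scale/=; ring.
move=> s sh.
have srho : `|s| <= rho.
  rewrite -[s](subrK r); apply: le_trans (ler_normD _ _) _.
  by rewrite /rho; rewrite /del in hd; lra.
have /andP[b1 b2] := ss_bounds rho1 srho t1.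
move: srho t1; rewrite !ler_norml => /andP[? ?] /andP[? ?]; split.
- by rewrite ge_min lexx/=; lra.
- by rewrite ge_min b1 orbT.
- by apply/andP; split; lra.
- by apply/andP; split; lra.
- by split; apply/andP; split; lra.
Qed.
End ZonalIntegrals.

(** * Contiguous relations and the differential equation of zonal integrals *)

Section ZonalHypergeometric.
Context {R : realType}.
Variable k : nat.
Implicit Types r e t : R.
Notation nR := (k.+2%:R : R).

Definition zm j e r : R := zI k (fun t => t ^+ j) e r.

Lemma mbd_pow j : mbd (fun t : R => t ^+ j).
Proof. by apply: mbdX; exact: mbd_id. Qed.

Lemma zI_lin j e r (a b : R) : `|r| < 1 ->
  zI k (fun t => t ^+ j * (a - b * t)) e r = a * zm j e r - b * zm j.+1 e r.
Proof.
move=> r1; rewrite /zm /zI -!wmeanZ; last 2 first.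
- by apply: mbdM; [exact: mbd_pow|exact: mbd_ss].
- by apply: mbdM; [exact: mbd_pow|exact: mbd_ss].
rewrite -wmeanB; last 2 first.
- by apply: mbdM; [exact: mbd_cst|apply: mbdM; [exact: mbd_pow|exact: mbd_ss]].
- by apply: mbdM; [exact: mbd_cst|apply: mbdM; [exact: mbd_pow|exact: mbd_ss]].
by apply: eq_wmean => t _; rewrite exprSr; ring.
Qed.

Lemma is_derive_zm j e (r : R) : `|r| < 1 ->
  is_derive r 1 (zm j e) (e * (2 * r * zm j (e - 1) r - 2 * zm j.+1 (e - 1) r)).
Proof. by move=> r1; rewrite -zI_lin//; exact: (is_derive_zI k e (mbd_pow j) r1). Qed.

(** From 2 r t = 1 + r^2 - [ss r t]: a power of t is traded for a power of the squared distance. *)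
Lemma zm_rec j e r : `|r| < 1 ->
  2 * r * zm j.+1 e r = (1 + r ^+ 2) * zm j e r - zm j (e + 1) r.
Proof.
move=> r1.
have -> : zm j (e + 1) r = zI k (fun t => t ^+ j * ((1 + r ^+ 2) - 2 * r * t)) e r.
  apply: eq_wmean => t /m1p1_norm t1; have s0 := ss_gt0 r1 t1.
  rewrite powRD ?(gt_eqF s0) ?implybT// powRr1 ?ltW// -/(ss r t).
  by rewrite -mulrA; congr (_ * _); rewrite mulrC.
by rewrite zI_lin//; ring.
Qed.

(** Integration by parts applied to a power of [ss]. Together with [zm_rec] it expresses all
    integrals in the differential equation through two of them. *)
Lemma zm_by_parts e r : `|r| < 1 ->
  - (2 * r * e) * (zm 0 (e - 1) r - zm 2 (e - 1) r) = (nR - 1) * zm 1 e r.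
Proof.
move=> r1.
have dss (t : R) : is_derive t 1 (ss r) (- (2 * r)).
  by rewrite /ss; apply: is_derive_eq; rewrite /GRing.scale/=; ring.
have ds (e' t : R) : `|t| <= 1 -> is_derive t 1 (fun t => ss r t `^ e') (e' * ss r t `^ (e' - 1) * - (2 * r)).
  by move=> t1; apply: is_derive_powR_comp => //; exact: ss_gt0.
have mt j e' : mbd (fun t => t ^+ j * ss r t `^ e').
  by apply: mbdM; [exact: mbd_pow|exact: mbd_ss].
have H : wmean k (fun t => (1 - t ^+ 2) * (e * ss r t `^ (e - 1) * - (2 * r)) -
    2 * (wexp k + 1) * t * ss r t `^ e) = 0.
  rewrite /wmean; set I := wI _ (fun t => _ - _); suff -> : I = 0 by rewrite mulr0.
  apply: (@wI_by_parts R (wexp k) (fun t => ss r t `^ e)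
    (fun t => e * ss r t `^ (e - 1) * - (2 * r)) (wexp_ge k)).
  - by move=> t; rewrite in_itv/= -ler_norml => t1; exact: ds.
  - move=> t /m1p1_norm t1; apply/differentiable_continuous/derivable1_diffP.
    have d1 := ds (e - 1) t t1.
    have : is_derive t 1 (fun t => e * ss r t `^ (e - 1) * - (2 * r))
       (e * ((e - 1) * ss r t `^ (e - 1 - 1) * - (2 * r)) * - (2 * r)).
      by apply: is_derive_eq; rewrite /GRing.scale/=; ring.
    by case.
  - by apply: mbdM; [apply: mbdM; [exact: mbd_cst|exact: mbd_ss]|exact: mbd_cst].
  - exact: mbd_ss.
move: H.
rewrite (@eq_wmean _ _ _ (fun t => - (2 * r * e) * (t ^+ 0 * ss r t `^ (e - 1) -
   t ^+ 2 * ss r t `^ (e - 1)) - (nR - 1) * (t ^+ 1 * ss r t `^ e))); last first.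
  move=> t _; have nk : nR = k%:R + 2 by rewrite -addn2 natrD.
  have -> : 2 * (wexp k + 1) = nR - 1 by rewrite nk /wexp; field.
  by rewrite expr0 expr1; ring.
rewrite wmeanB; last 2 first.
- by apply: mbdM; [exact: mbd_cst|apply: mbdB; exact: mt].
- by apply: mbdM; [exact: mbd_cst|exact: mt].
rewrite (wmeanZ _ _ (mbdB (mt 0%N (e - 1)) (mt 2%N (e - 1)))).
rewrite (wmeanB _ (mt 0%N (e - 1)) (mt 2%N (e - 1))) (wmeanZ _ _ (mt 1%N e)).
by move/eqP; rewrite subr_eq0 => /eqP.
Qed.

Section ODE.
Variable lam : R.
Let bet : R := 2 * lam - nR + 1.

(* Euler's transformation puts this power of [1 - r ^+ 2] in front of the series. *)
Definition zV (r : R) : R := (1 - r ^+ 2) `^ bet * zm 0 (- lam) r.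
(** [zU1] and [zU2] are the first two derivatives of [zm 0 (- lam)], and [zV1] and [zV2] those of
    [zV]. *)
Definition zU1 (r : R) : R := - lam * (2 * r * zm 0 (- lam - 1) r - 2 * zm 1 (- lam - 1) r).
Definition zU2 (r : R) : R := - lam * (2 * zm 0 (- lam - 1) r +
  2 * r * ((- lam - 1) * (2 * r * zm 0 (- lam - 2) r - 2 * zm 1 (- lam - 2) r)) -
  2 * ((- lam - 1) * (2 * r * zm 1 (- lam - 2) r - 2 * zm 2 (- lam - 2) r))).
Definition zV1 (r : R) : R := - (2 * bet * r) * (1 - r ^+ 2) `^ (bet - 1) * zm 0 (- lam) r +
  (1 - r ^+ 2) `^ bet * zU1 r.
Definition zV2 (r : R) : R :=
  (4 * bet * (bet - 1) * r ^+ 2 * (1 - r ^+ 2) `^ (bet - 2) -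
     2 * bet * (1 - r ^+ 2) `^ (bet - 1)) * zm 0 (- lam) r -
  4 * bet * r * (1 - r ^+ 2) `^ (bet - 1) * zU1 r + (1 - r ^+ 2) `^ bet * zU2 r.

Lemma omr_gt0 (r : R) : `|r| < 1 -> 0 < 1 - r ^+ 2.
Proof. by rewrite ltr_norml => /andP[? ?]; nra. Qed.

Lemma is_derive_omr (e r : R) : `|r| < 1 ->
  is_derive r 1 (fun r : R => (1 - r ^+ 2) `^ e) (e * (1 - r ^+ 2) `^ (e - 1) * - (2 * r)).
Proof.
move=> r1; apply: is_derive_powR_comp; first exact: omr_gt0.
by apply: is_derive_eq; rewrite /GRing.scale/=; ring.
Qed.

Lemma is_derive_zm0 (r : R) : `|r| < 1 -> is_derive r 1 (zm 0 (- lam)) (zU1 r).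
Proof. by move=> r1; exact: is_derive_zm. Qed.

Lemma is_derive_zU1 (r : R) : `|r| < 1 -> is_derive r 1 zU1 (zU2 r).
Proof.
move=> r1; have d0 := is_derive_zm 0 (- lam - 1) r1.
have d1 := is_derive_zm 1 (- lam - 1) r1.
rewrite /zU1; apply: is_derive_eq; rewrite /zU2 /GRing.scale/=.
rewrite (_ : - lam - 1 - 1 = - lam - 2); last by ring.
move: (zm 0 (- lam - 1) r) (zm 0 (- lam - 2) r) (zm 1 (- lam - 2) r) (zm 2 (- lam - 2) r).
by move=> *; ring.
Qed.

Lemma is_derive_zV (r : R) : `|r| < 1 -> is_derive r 1 zV (zV1 r).
Proof.
move=> r1; have d0 := is_derive_zm0 r1; have dp := is_derive_omr bet r1.
rewrite /zV; apply: is_derive_eq; rewrite /zV1 /GRing.scale/=; ring.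
Qed.

Lemma is_derive_zV1 (r : R) : `|r| < 1 -> is_derive r 1 zV1 (zV2 r).
Proof.
move=> r1; have d0 := is_derive_zm0 r1; have d1 := is_derive_zU1 r1.
have dp := is_derive_omr bet r1; have dp1 := is_derive_omr (bet - 1) r1.
rewrite (_ : bet - 1 - 1 = bet - 2) in dp1; last by ring.
rewrite /zV1; apply: is_derive_eq; rewrite /zV2 /GRing.scale/=; ring.
Qed.

(** The hypergeometric equation in the variable r^2, multiplied by 4 r and rearranged. The integrals
    at exponents - lam and - lam - 2 are eliminated in favour of [zm 0] and [zm 1] at - lam - 1,
    after which the identity is one of rational functions. *)
Lemma zV_ode r : `|r| < 1 -> r != 0 ->
  (1 - r ^+ 2) * (r * zV2 r + (nR - 1) * zV1 r) =
  2 * (nR - 2 * lam) * r * ((nR - 1 - lam) * zV r + r * zV1 r).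
Proof.
move=> r1 r0; have y0 := omr_gt0 r1.
have pw e : (1 - r ^+ 2) `^ (e + 1) = (1 - r ^+ 2) `^ e * (1 - r ^+ 2).
  by rewrite powRD ?(gt_eqF y0) ?implybT// powRr1// ltW.
rewrite /zV /zV1 /zV2.
have -> : (1 - r ^+ 2) `^ (bet - 1) = (1 - r ^+ 2) `^ (bet - 2) * (1 - r ^+ 2).
  by rewrite -pw; congr (_ `^ _); ring.
have -> : (1 - r ^+ 2) `^ bet = (1 - r ^+ 2) `^ (bet - 2) * (1 - r ^+ 2) * (1 - r ^+ 2).
  by rewrite -!pw; congr (_ `^ _); ring.
have ra := zm_rec 0 (- lam - 1) r1.
have rb := zm_rec 0 (- lam - 2) r1.
have rc := zm_rec 1 (- lam - 2) r1.
have rd := zm_by_parts (- lam - 1) r1.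
have e1 : - lam - 1 + 1 = - lam by ring.
have e2 : - lam - 2 + 1 = - lam - 1 by ring.
have e3 : - lam - 1 - 1 = - lam - 2 by ring.
rewrite e1 in ra; rewrite e2 in rb; rewrite e2 in rc; rewrite e3 in rd.
rewrite /zU1 /zU2 /bet.
move: (zm 0 (- lam) r) (zm 0 (- lam - 1) r) (zm 1 (- lam - 1) r)
  (zm 0 (- lam - 2) r) (zm 1 (- lam - 2) r) (zm 2 (- lam - 2) r)
  ((1 - r ^+ 2) `^ _) ra rb rc rd => a0 b0 b1 c0 c1 c2 Y ra rb rc rd.
have -> : a0 = (1 + r ^+ 2) * b0 - 2 * r * b1 by rewrite ra; ring.
have yn0 : 1 - r ^+ 2 != 0 by rewrite gt_eqF.
(* Integration by parts determines the integrals at - lam - 2 only after multiplication by l, which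
   may vanish; so they are solved for with this factor attached. *)
pose l := - lam - 1.
have E1 : l * c1 = ((1 + r ^+ 2) * (l * c0) - l * b0) / (2 * r).
  apply: (mulfI (_ : 2 * r != 0)); first by rewrite mulf_neq0// pnatr_eq0.
  rewrite mulrCA (_ : 2 * r * c1 = (1 + r ^+ 2) * c0 - b0)//; field.
  by rewrite r0.
have E2 : l * c2 = ((1 + r ^+ 2) * (l * c1) - l * b1) / (2 * r).
  apply: (mulfI (_ : 2 * r != 0)); first by rewrite mulf_neq0// pnatr_eq0.
  rewrite mulrCA (_ : 2 * r * c2 = (1 + r ^+ 2) * c1 - b1)//; field.
  by rewrite r0.
have E3 : l * c0 = 
      (2 * r * (nR - 1) * b1 + (1 + r ^+ 2) * (l * b0) + 2 * r * (l * b1)) /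
      (1 - r ^+ 2) ^+ 2.
  have rd' : - (2 * r) * (l * c0 - l * c2) = (nR - 1) * b1 by rewrite -rd /l; ring.
  rewrite E2 E1 in rd'.
  apply: (mulIf (_ : (1 - r ^+ 2) ^+ 2 != 0)); first by rewrite expf_neq0.
  rewrite divfK ?expf_neq0//.
  have -> : 2 * r * (nR - 1) * b1 = 2 * r * ((nR - 1) * b1) by ring.
  by rewrite -rd'; field.
have -> : (- lam - 1) * (2 * r * c0 - 2 * c1) = 2 * r * (l * c0) - 2 * (l * c1).
  by rewrite /l; ring.
have -> : (- lam - 1) * (2 * r * c1 - 2 * c2) = 2 * r * (l * c1) - 2 * (l * c2).
  by rewrite /l; ring.
rewrite E2 E1 E3 /l; move: (k.+2%:R : R) => n.
by field; rewrite r0 yn0.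
Qed.

Lemma zm_at0 j e : zm j e 0 = smom k.+1 j.
Proof.
rewrite -wmean_pow; apply: eq_wmean => t _.
by rewrite /ss expr0n/= addr0 mulr0 mul0r subr0 powR1 mulr1.
Qed.

Lemma zV0 : zV 0 = 1.
Proof.
rewrite /zV zm_at0 expr0n/= subr0 powR1 mul1r /smom/= !big_ord0.
exact: divr1.
Qed.

Lemma zV10 : zV1 0 = 0.
Proof.
by rewrite /zV1 /zU1 !zm_at0 /smom/= !(mulr0, mul0r, oppr0, subr0, addr0).
Qed.

End ODE.

(** * The zonal integral equals its hypergeometric series *)

Section Identification.
Variable lam : R.
(** With lam = (n - alpha) / 2 and lam = (n + 2 - alpha) / 2 these are the parameters of the two
    series in G. *)
Let a : R := nR / 2 - lam.
Let b : R := nR - 1 - lam.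
Let c : R := nR / 2.
Let h := hcoef a b c.
Let d1 := pseries_diffs h.
Let d2 := pseries_diffs d1.

Definition hF r : R := psum h (r ^+ 2).
Definition hF1 r : R := 2 * r * psum d1 (r ^+ 2).
Definition hF2 r : R := 2 * psum d1 (r ^+ 2) + 4 * r ^+ 2 * psum d2 (r ^+ 2).

Let c0 : 0 < c. Proof. by rewrite divr_gt0// ltr0n. Qed.
Let sh : subexp h. Proof. exact: subexp_hcoef. Qed.
Let sd1 : subexp d1. Proof. exact: subexp_diffs. Qed.

Lemma sqr_norm_lt1 r : `|r| < 1 -> `|r ^+ 2| < 1.
Proof. by move=> r1; rewrite normrX exprn_ilt1. Qed.

Lemma is_derive_psum_sqr u (r : R) : subexp u -> `|r| < 1 ->
  is_derive r 1 (fun r : R => psum u (r ^+ 2)) (psum (pseries_diffs u) (r ^+ 2) * (2 * r)).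
Proof.
move=> su r1; have dq : is_derive r 1 (fun r : R => r ^+ 2) (2 * r).
  by apply: is_derive_eq; rewrite /GRing.scale/=; ring.
exact: (@is_derive1_comp R (psum u) (fun r : R => r ^+ 2) r _ _
  (is_derive_psum su (sqr_norm_lt1 r1)) dq).
Qed.

Lemma is_derive_hF (r : R) : `|r| < 1 -> is_derive r 1 hF (hF1 r).
Proof.
move=> r1; have d := is_derive_psum_sqr sh r1.
by rewrite /hF; apply: is_derive_eq; rewrite /hF1 mulrC.
Qed.

Lemma is_derive_hF1 (r : R) : `|r| < 1 -> is_derive r 1 hF1 (hF2 r).
Proof.
move=> r1; have d := is_derive_psum_sqr sd1 r1.
by rewrite /hF1; apply: is_derive_eq; rewrite /hF2 /GRing.scale/= -/d2; ring.
Qed.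

Lemma hF_ode r : `|r| < 1 ->
  (1 - r ^+ 2) * (r * hF2 r + (nR - 1) * hF1 r) =
  2 * (nR - 2 * lam) * r * ((nR - 1 - lam) * hF r + r * hF1 r).
Proof.
move=> r1; have := hyp2F1_ode a b c0 (sqr_norm_lt1 r1).
rewrite -/h -/d1 -/d2 /hF /hF1 /hF2 /= => E.
have -> : (1 - r ^+ 2) * (r * (2 * psum d1 (r ^+ 2) + 4 * r ^+ 2 * psum d2 (r ^+ 2)) +
    (nR - 1) * (2 * r * psum d1 (r ^+ 2))) =
  4 * r * (r ^+ 2 * (1 - r ^+ 2) * psum d2 (r ^+ 2) +
    (c - (a + b + 1) * r ^+ 2) * psum d1 (r ^+ 2) - a * b * psum h (r ^+ 2)) +
  2 * (nR - 2 * lam) * r * ((nR - 1 - lam) * psum h (r ^+ 2) + r * (2 * r * psum d1 (r ^+ 2))).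
  by rewrite /a /b /c; field.
by rewrite E mulr0 add0r.
Qed.

Lemma psum_at0 (u : nat -> R) : psum u 0 = u 0%N.
Proof.
apply/cvg_lim => //; rewrite -cvg_shiftS (_ : (fun n => _) = fun=> u 0%N).
  exact: cvg_cst.
apply/funext => N; rewrite /pseries /series/= big_nat_recl//= expr0 mulr1.
by rewrite big1 ?addr0// => i _; rewrite expr0n/= mulr0.
Qed.

Lemma hF0 : hF 0 = 1. Proof. by rewrite /hF expr0n/= psum_at0 /h hcoef0. Qed.

Lemma hF10 : hF1 0 = 0. Proof. by rewrite /hF1 mulr0 mul0r. Qed.

(* The singular term of the ODE has a favourable sign, so the energy
   [D ^+ 2 + D' ^+ 2] of the difference obeys a Gronwall inequality from 0. *)
Lemma zV_hF rho : 0 <= rho < 1 -> zV lam rho = hF rho.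
Proof.
move=> /andP[rho0 rho1].
have [->|rhon0] := eqVneq rho 0; first by rewrite zV0 hF0.
have rhop : 0 < rho by rewrite lt_neqAle eq_sym rhon0.
pose D0 r := zV lam r - hF r; pose D1 r := zV1 lam r - hF1 r.
pose D2 r := zV2 lam r - hF2 r.
have nr r : 0 <= r <= rho -> `|r| < 1.
  by move=> /andP[? ?]; rewrite ger0_norm//; lra.
have dD0 (r : R) : 0 <= r <= rho -> is_derive r 1 D0 (D1 r).
  by move=> /nr r1; have ? := is_derive_zV lam r1; have ? := is_derive_hF r1;
     apply: is_deriveB.
have dD1 (r : R) : 0 <= r <= rho -> is_derive r 1 D1 (D2 r).
  by move=> /nr r1; have ? := is_derive_zV1 lam r1; have ? := is_derive_hF1 r1;
     apply: is_deriveB.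
(* K is 1, for 2 D D' <= D^2 + D'^2, plus twice the constant C in D' D'' <= C (D^2 + D'^2), which
   the differential equation provides below; it makes [E'] nonpositive. *)
pose K := 1 + 2 * (`|2 * (nR - 2 * lam)| * (`|nR - 1 - lam| + 1) / (1 - rho ^+ 2)).
pose E r := (D0 r ^+ 2 + D1 r ^+ 2) * expR (- (K * r)).
pose E' r := (2 * D0 r * D1 r + 2 * D1 r * D2 r - K * (D0 r ^+ 2 + D1 r ^+ 2)) * expR (- (K * r)).
have dE (r : R) : r \in `[0, rho] -> is_derive r 1 E (E' r).
  rewrite in_itv/= => rr; have e0 := dD0 r rr; have e1 := dD1 r rr.
  have de : is_derive r 1 (fun r : R => expR (- (K * r))) (expR (- (K * r)) * - K).
    have dl : is_derive r 1 (fun r : R => - (K * r)) (- K).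
      by apply: is_derive_eq; rewrite /GRing.scale/=; ring.
    exact: (is_derive1_comp (is_derive_expR _) dl).
  by rewrite /E; apply: is_derive_eq; rewrite /E' /GRing.scale/=; ring.
have cE : {within `[0, rho], continuous E}.
  by apply: derivable_within_continuous => r /dE [].
have [xi xiP] := MVT rhop (fun r rr => dE r (subset_itv_oo_cc rr)) cE.
have E0 : E 0 = 0.
  by rewrite /E /D0 /D1 zV0 hF0 zV10 hF10 !subrr !expr0n/= addr0 mul0r.
rewrite E0 !subr0 => Erho.
move: xiP; rewrite in_itv/= => /andP[xi0 xi1].
have xin : `|xi| < 1 by apply: nr; rewrite !ltW.
have E'le : E' xi <= 0.
  rewrite /E' mulr_le0_ge0 ?expR_ge0//.
  have y0 := omr_gt0 xin; have yr : 0 < 1 - rho ^+ 2 by nra.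
  have ode : (1 - xi ^+ 2) * (xi * D2 xi + (nR - 1) * D1 xi) =
      2 * (nR - 2 * lam) * xi * ((nR - 1 - lam) * D0 xi + xi * D1 xi).
    have := zV_ode lam xin (lt0r_neq0 xi0); have := hF_ode xin.
    by rewrite /D0 /D1 /D2 => h1 h2; rewrite !mulrBr; move: h1 h2; rewrite -!mulrA; lra.
  move: (D0 xi) (D1 xi) (D2 xi) ode => u v w ode.
  have vw : v * w <= `|2 * (nR - 2 * lam)| * (`|nR - 1 - lam| + 1) / (1 - rho ^+ 2) * (u ^+ 2 + v ^+ 2).
    have -> : w = 2 * (nR - 2 * lam) * ((nR - 1 - lam) * u + xi * v) / (1 - xi ^+ 2) - (nR - 1) * v / xi.
      apply: (mulfI (mulf_neq0 (lt0r_neq0 y0) (lt0r_neq0 xi0))).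
      transitivity ((1 - xi ^+ 2) * (xi * w + (nR - 1) * v) - (1 - xi ^+ 2) * (nR - 1) * v); first by ring.
      by rewrite ode; field; rewrite (lt0r_neq0 xi0) (lt0r_neq0 y0).
    have n1 : 0 <= nR - 1 by rewrite subr_ge0 ler1n.
    have -> : v * (2 * (nR - 2 * lam) * ((nR - 1 - lam) * u + xi * v) / (1 - xi ^+ 2) - (nR - 1) * v / xi) =
      2 * (nR - 2 * lam) * (v * ((nR - 1 - lam) * u + xi * v)) / (1 - xi ^+ 2) - (nR - 1) * (v ^+ 2 / xi).
      by field; rewrite (lt0r_neq0 xi0) (lt0r_neq0 y0).
    have s1 : 0 <= (nR - 1) * (v ^+ 2 / xi) by rewrite mulr_ge0// divr_ge0 ?sqr_ge0// ltW.
    suff : 2 * (nR - 2 * lam) * (v * ((nR - 1 - lam) * u + xi * v)) / (1 - xi ^+ 2) <=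
      `|2 * (nR - 2 * lam)| * (`|nR - 1 - lam| + 1) / (1 - rho ^+ 2) * (u ^+ 2 + v ^+ 2) by lra.
    apply: le_trans (ler_norm _) _.
    rewrite normrM (normrM (_ * _)) normfV (gtr0_norm y0).
    have -> : `|2 * (nR - 2 * lam)| * (`|nR - 1 - lam| + 1) / (1 - rho ^+ 2) * (u ^+ 2 + v ^+ 2) =
      `|2 * (nR - 2 * lam)| * ((`|nR - 1 - lam| + 1) * (u ^+ 2 + v ^+ 2)) / (1 - rho ^+ 2) by ring.
    apply: ler_pM; rewrite ?mulr_ge0// ?invr_ge0 ?(ltW y0)//; last first.
      by rewrite lef_pV2 ?posrE//; nra.
    rewrite ler_wpM2l// normrM.
    have uv : `|u| * `|v| <= u ^+ 2 + v ^+ 2.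
      have : 0 <= (`|u| - `|v|) ^+ 2 by exact: sqr_ge0.
      have -> : u ^+ 2 = `|u| ^+ 2 by rewrite real_normK ?num_real.
      have -> : v ^+ 2 = `|v| ^+ 2 by rewrite real_normK ?num_real.
      have := normr_ge0 u; have := normr_ge0 v; nra.
    have tri : `|(nR - 1 - lam) * u + xi * v| <= `|nR - 1 - lam| * `|u| + `|v|.
      apply: le_trans (ler_normD _ _) _; rewrite !normrM lerD2l.
      by have := normr_ge0 v; nra.
    apply: le_trans (ler_wpM2l (normr_ge0 v) tri) _.
    have -> : `|v| * (`|nR - 1 - lam| * `|u| + `|v|) = `|nR - 1 - lam| * (`|u| * `|v|) + `|v| ^+ 2 by ring.
    rewrite real_normK ?num_real// mulrDl mul1r lerD// ?ler_wpM2l//.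
    by rewrite lerDr sqr_ge0.
  have uv2 : 2 * u * v <= u ^+ 2 + v ^+ 2 by have := sqr_ge0 (u - v); nra.
  by rewrite /K; nra.
have : E rho <= 0 by rewrite Erho mulr_le0_ge0.
rewrite /E pmulr_lle0 ?expR_gt0// => le0.
have : D0 rho ^+ 2 <= 0 by have := sqr_ge0 (D1 rho); lra.
rewrite le_eqVlt ltNge sqr_ge0 orbF sqrf_eq0 subr_eq0.
by move/eqP.
Qed.
End Identification.
End ZonalHypergeometric.

(** * The mean of |1 - b |x - zeta|^(-p)| *)

Section HalfFTC.
Context {R : realType}.
Notation mu := (@lebesgue_measure R).

Lemma integrable_FTC2_split (f F1 F2 : R -> R) (a b c : R) : a < b -> b < c ->
  mu.-integrable `]a, c[ (EFin \o f) ->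
  {in `]a, b[, continuous f} -> {in `]b, c[, continuous f} ->
  {within `[a, b], continuous F1} -> {within `[b, c], continuous F2} ->
  (forall x, x \in `]a, b[ -> is_derive x 1 F1 (f x)) ->
  (forall x, x \in `]b, c[ -> is_derive x 1 F2 (f x)) ->
  \int[mu]_(x in `]a, c[) f x = (F1 b - F1 a) + (F2 c - F2 b).
Proof.
move=> ab bc fi c1 c2 cF1 cF2 d1 d2.
have U : `]a, c[%classic = `]a, b]%classic `|` `]b, c[%classic.
  by rewrite -itv_bndbnd_setU// bnd_simp ltW.
have s1 : `]a, b]%classic `<=` `]a, c[%classic by rewrite U; exact: subsetUl.
have s2 : `]b, c[%classic `<=` `]a, c[%classic by rewrite U; exact: subsetUr.
have s0 : `]a, b[%classic `<=` `]a, c[%classic.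
  by apply: subset_trans s1; apply: subset_itvl; rewrite bnd_simp.
have fi0 : mu.-integrable `]a, b[ (EFin \o f) by exact: integrableS fi.
have fi2 : mu.-integrable `]b, c[ (EFin \o f) by exact: integrableS fi.
rewrite U Rintegral_setU//; last 2 first.
- by rewrite -U.
- apply/disj_setPS => x /= [] /=; rewrite !in_itv/= => /andP[_ xb] /andP[bx _].
  by have := le_lt_trans xb bx; rewrite ltxx.
rewrite -Rintegral_itv_bndo_bndc//.
by rewrite (integrable_FTC2_oo ab fi0 c1 cF1 d1) (integrable_FTC2_oo bc fi2 c2 cF2 d2).
Qed.

(** Two primitives, one on each side of 0, because the integrands are functions of |t| with a kink
    there. *)
Lemma wI_FTC_split (e : R) (g F1 F2 : R -> R) : - 2^-1 <= e -> mbd g ->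
  (forall t, m1p1 t -> t != 0 -> {for t, continuous g}) ->
  {within `[(-1)%R, 0%R], continuous F1} -> {within `[0%R, 1%R], continuous F2} ->
  (forall t : R, -1 < t < 0 -> is_derive t 1 F1 (wt e t * g t)) ->
  (forall t : R, 0 < t < 1 -> is_derive t 1 F2 (wt e t * g t)) ->
  wI e g = (F1 0 - F1 (-1)) + (F2 1 - F2 0).
Proof.
move=> e2 mg cg cF1 cF2 d1 d2.
have h1 : (-1 : R) < 0 by lra.
have h2 : (0 : R) < 1 by [].
have fi := wtM_integrable e2 mg.
have cf t : m1p1 t -> t != 0 -> {for t, continuous (fun t => wt e t * g t)}.
  by move=> tm t0; apply: continuousM; [exact: continuous_wt|exact: cg].
have c1 : {in `](-1)%R, 0%R[, continuous (fun t => wt e t * g t)}.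
  move=> t; rewrite in_itv/= => /andP[? ?]; apply: cf; last by rewrite lt_eqF.
  by rewrite /m1p1/= in_itv/=; apply/andP; split; lra.
have c2 : {in `]0%R, 1%R[, continuous (fun t => wt e t * g t)}.
  move=> t; rewrite in_itv/= => /andP[? ?]; apply: cf; last by rewrite gt_eqF.
  by rewrite /m1p1/= in_itv/=; apply/andP; split; lra.
have d1' (t : R) : t \in `](-1)%R, 0%R[ -> is_derive t 1 F1 (wt e t * g t).
  by rewrite in_itv/=; exact: d1.
have d2' (t : R) : t \in `]0%R, 1%R[ -> is_derive t 1 F2 (wt e t * g t).
  by rewrite in_itv/=; exact: d2.
exact (integrable_FTC2_split h1 h2 fi c1 c2 cF1 cF2 d1' d2').
Qed.

(** Young's inequality for the product of y and 1, with conjugate exponents k and k / (k - 1). *)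
Lemma powR_bernoulli (y k : R) : 0 <= y -> 1 < k -> 1 + k * (y - 1) <= y `^ k.
Proof.
move=> y0 k1.
have q0 : 0 < k / (k - 1) by rewrite divr_gt0//; lra.
have := @conjugate_powR R y 1 k (k / (k - 1)) y0 ler01 ltac:(lra) q0.
rewrite powR1 mulr1 invf_div => H.
have {}H : y <= y `^ k / k + 1 * ((k - 1) / k) by apply: H; field; lra.
have k0 : 0 < k by lra.
have : y * k <= y `^ k + (k - 1).
  rewrite -ler_pdivlMr//; apply: le_trans H _.
  rewrite [leRHS]mulrDl mul1r; exact: lexx.
by lra.
Qed.

End HalfFTC.

Section ThirdTerm.
Context {R : realType}.
Variable k : nat.
Hypothesis k_gt0 : (0 < k)%N.

(** The retraction of the line onto [-1, 1]. Composing with it makes functions known to be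
    continuous only at points of [-1, 1] globally continuous, as [mbd_continuous] and [sint_zonal]
    require. *)
Definition clamp (t : R) : R := (`|t + 1| - `|t - 1|) / 2.

Lemma clamp_id t : `|t| <= 1 -> clamp t = t.
Proof.
rewrite ler_norml => /andP[h1 h2]; rewrite /clamp ger0_norm ?ler0_norm; lra.
Qed.

Lemma clamp_norm t : `|clamp t| <= 1.
Proof.
rewrite /clamp ler_norml.
have h1 := ler_normB (t + 1) (t - 1); have h2 := ler_dist_dist (t + 1) (t - 1).
have E : t + 1 - (t - 1) = 2 by ring.
rewrite E (ger0_norm (_ : 0 <= 2))// ler_norml in h2.
by case/andP : h2 => ? ?; apply/andP; split; lra.
Qed.

Lemma continuous_clamp : continuous clamp.
Proof.
move=> t; apply: cvgM; last exact: cvg_cst.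
apply: cvgB; apply: cvg_norm.
  by apply: cvgD; [exact: cvg_id|exact: cvg_cst].
by apply: cvgB; [exact: cvg_id|exact: cvg_cst].
Qed.

Lemma continuous_clamp_comp (f : R -> R) : (forall t, `|t| <= 1 -> {for t, continuous f}) ->
  continuous (fun t => f (clamp t)).
Proof.
move=> cf t; apply: continuous_comp; first exact: continuous_clamp.
by apply: cf; exact: clamp_norm.
Qed.

Lemma mbd_continuous_in (f : R -> R) : (forall t, `|t| <= 1 -> {for t, continuous f}) -> mbd f.
Proof.
move=> cf; have := mbd_continuous (continuous_clamp_comp cf).
have E t : m1p1 t -> f (clamp t) = f t by move=> /m1p1_norm t1; rewrite clamp_id.
move=> [mf [B fB]]; split; last by exists B => t tm; rewrite -E//; exact: fB.
by apply: eq_measurable_fun mf => t /set_mem tm; rewrite E.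
Qed.

(** Read off from [sint_zonal] for the axes v and - v, which have the same norm. *)
Lemma wmean_sym (f : R -> R) : (forall t, `|t| <= 1 -> {for t, continuous f}) ->
  wmean k f = wmean k (fun t => f (- t)).
Proof.
move=> cf; pose g t := f (clamp t).
have cg : continuous g by exact: continuous_clamp_comp.
pose v : 'rV[R]_k.+2 := delta_mx 0 0.
have v1 : enorm v = 1.
  apply: enorm_eq1; rewrite (bigD1 0)//= !mxE !eqxx expr1n big1 ?addr0// => i i0.
  by rewrite mxE eqxx (negbTE i0) expr0n.
have cgN : continuous (fun t => g (- t)).
  by move=> t; apply: continuous_comp; [exact: opp_continuous|exact: cg].
have h1 := sint_zonal v cgN; have h2 := sint_zonal (- v) cg.
have : sint (fun z => g (- dotp z v)) = sint (fun z => g (dotp z (- v))).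
  by apply: eq_sint => z _; rewrite dotpC (dotpC z) dotpNl.
rewrite h1 h2 enormN v1 => E.
transitivity (wmean k (fun t => g (1 * t))).
  by apply: eq_wmean => t /m1p1_norm t1; rewrite mul1r /g clamp_id.
by rewrite -E; apply: eq_wmean => t /m1p1_norm t1; rewrite mul1r /g clamp_id ?normrN.
Qed.

Section Kernel.
Variables (D kap : R).
Hypotheses (D0 : 0 < D) (D1 : D < 1) (kap1 : 1 < kap).
Let m := (1 - D) `^ kap.

(* Folding [t] and [- t] together bounds the deficit in [wmean_abs_kernel] from below
   by [Kf |t|]. This function changes sign at most once, from + to -, while the weight
   decreases in [|t|]; so the weighted mean is nonnegative because the plain integral,
   which is explicit, is. *)
Definition Kf (t : R) : R := (2 - m) * (1 + D * t) `^ (- kap) - m * (1 - D * t) `^ (- kap).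

Let m0 : 0 <= m. Proof. exact: powR_ge0. Qed.
Let m1 : m <= 1.
Proof.
have D0' := D0; have D1' := D1; have kap1' := kap1.
have := @ge0_ler_powR R kap ltac:(lra) (1 - D) 1; rewrite powR1; apply.
- by rewrite nnegrE; lra.
- by rewrite nnegrE.
- by lra.
Qed.

Lemma powRN_le (x y : R) : 0 < x -> x <= y -> y `^ (- kap) <= x `^ (- kap).
Proof.
have D0' := D0; have D1' := D1; have kap1' := kap1.
move=> x0 xy; rewrite !powRN lef_pV2 ?posrE ?powR_gt0//; last by lra.
by apply: ge0_ler_powR; rewrite ?nnegrE; lra.
Qed.

Lemma Kf_noninc t u : 0 <= t -> t <= u -> u <= 1 -> Kf u <= Kf t.
Proof.
have D0' := D0; have D1' := D1; have kap1' := kap1; have m0' := m0; have m1' := m1.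
move=> t0 tu u1; have Du : D * t <= D * u by rewrite ler_pM2l.
have Du1 : D * u <= D by rewrite ler_piMr// ltW.
have Dt0 : 0 <= D * t by rewrite mulr_ge0// ltW.
have h1 : (1 + D * u) `^ (- kap) <= (1 + D * t) `^ (- kap) by apply: powRN_le; lra.
have h2 : (1 - D * t) `^ (- kap) <= (1 - D * u) `^ (- kap) by apply: powRN_le; lra.
by rewrite /Kf; apply: lerB; apply: ler_wpM2l => //; lra.
Qed.

Lemma is_derive_lin_powR (a e t : R) : 0 < 1 + a * t ->
  is_derive t 1 (fun t : R => (1 + a * t) `^ e) (e * (1 + a * t) `^ (e - 1) * a).
Proof.
move=> h; apply: is_derive_powR_comp => //.
by apply: is_derive_eq; rewrite /GRing.scale/=; ring.
Qed.

Let pos1 t : `|t| <= 1 -> 0 < 1 + D * t.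
Proof. by have D0' := D0; have D1' := D1; rewrite ler_norml => /andP[? ?]; nra. Qed.

Let pos2 t : `|t| <= 1 -> 0 < 1 - D * t.
Proof. by have D0' := D0; have D1' := D1; rewrite ler_norml => /andP[? ?]; nra. Qed.

Lemma continuous_Kf t : `|t| <= 1 -> {for t, continuous Kf}.
Proof.
move=> t1; apply/differentiable_continuous/derivable1_diffP.
have d1 := is_derive_lin_powR (- kap) (pos1 t1).
have d2 : is_derive t 1 (fun t : R => (1 - D * t) `^ (- kap)) (- kap * (1 - D * t) `^ (- kap - 1) * - D).
  have := @is_derive_lin_powR (- D) (- kap) t; rewrite mulNr; move/(_ (pos2 t1)) => h.
  by under eq_fun do rewrite -mulNr.
have : is_derive t 1 Kf ((2 - m) * (- kap * (1 + D * t) `^ (- kap - 1) * D) -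
   m * (- kap * (1 - D * t) `^ (- kap - 1) * - D)).
  by rewrite /Kf; apply: is_derive_eq; rewrite /GRing.scale/=.
by case.
Qed.

(** As m (1 - D)^(1 - kap) = 1 - D, comparing the primitive at 0 and 1 reduces the claim to (1 +
    D)^kap + (1 - D)^kap >= 2, which is Bernoulli's inequality at 1 + D and at 1 - D. *)
Lemma wI0_Kf_ge0 : 0 <= wI 0 (fun t => Kf `|t|).
Proof.
have D0' := D0; have D1' := D1; have kap1' := kap1; have m0' := m0; have m1' := m1.
pose P t := ((2 - m) * (1 + D * t) `^ (1 - kap) + m * (1 - D * t) `^ (1 - kap)) / ((1 - kap) * D).
have dP (t : R) : `|t| <= 1 -> is_derive t 1 (fun t => (2 - m) * (1 + D * t) `^ (1 - kap) + m * (1 - D * t) `^ (1 - kap))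
    ((1 - kap) * D * ((2 - m) * (1 + D * t) `^ (- kap) - m * (1 - D * t) `^ (- kap))).
  move=> t1; have d1 := is_derive_lin_powR (1 - kap) (pos1 t1).
  have d2 : is_derive t 1 (fun t : R => (1 - D * t) `^ (1 - kap)) ((1 - kap) * (1 - D * t) `^ (1 - kap - 1) * - D).
    have := @is_derive_lin_powR (- D) (1 - kap) t; rewrite mulNr; move/(_ (pos2 t1)) => h.
    by under eq_fun do rewrite -mulNr.
  apply: is_derive_eq; rewrite /GRing.scale/= (_ : 1 - kap - 1 = - kap); last by ring.
  by ring.
have kn0 : (1 - kap) * D != 0 by rewrite mulf_neq0//; [rewrite lt_eqF//; lra|rewrite gt_eqF].
have dP' (t : R) : `|t| <= 1 -> is_derive t 1 P (Kf t).
  move=> t1; have d := dP t t1.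
  have dd := is_deriveZ ((1 - kap) * D)^-1 d.
  have -> : P = ((1 - kap) * D)^-1 \*: (fun t : R => (2 - m) * (1 + D * t) `^ (1 - kap) + m * (1 - D * t) `^ (1 - kap)).
    by apply/funext => s; rewrite /P mulrC.
  by apply: (is_derive_eq dd); rewrite /GRing.scale/= mulKf.
have cP a b : -1 <= a -> b <= 1 -> {within `[a, b], continuous P}.
  move=> ha hb; apply: derivable_within_continuous => t; rewrite in_itv/= => /andP[h1 h2].
  have t1 : `|t| <= 1 by rewrite ler_norml; apply/andP; split; lra.
  by have [] := dP' t t1.
pose PN t := - P (- t).
have dPN (t : R) : `|t| <= 1 -> is_derive t 1 PN (Kf (- t)).
  move=> t1; have d := dP' (- t); rewrite normrN in d; have {}d := d t1.
  have dn : is_derive t 1 (fun t : R => - t) (-1) by apply: is_derive_eq.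
  have := is_derive1_comp d dn => d'.
  by apply: (is_derive_eq (is_deriveN d')); rewrite mulrN1 opprK.
have cPN a b : -1 <= a -> b <= 1 -> {within `[a, b], continuous PN}.
  move=> ha hb; apply: derivable_within_continuous => t; rewrite in_itv/= => /andP[h1 h2].
  have t1 : `|t| <= 1 by rewrite ler_norml; apply/andP; split; lra.
  by have [] := dPN t t1.
have cK (t : R) : `|t| <= 1 -> {for t, continuous (fun t => Kf `|t|)}.
  move=> t1; apply: continuous_comp; first exact: norm_continuous.
  by apply: continuous_Kf; rewrite normr_id.
have -> : wI 0 (fun t => Kf `|t|) = (PN 0 - PN (-1)) + (P 1 - P 0).
  apply: (@wI_FTC_split _ 0 (fun t => Kf `|t|) PN P); last first.
  - move=> t /andP[t0 t1]; rewrite /wt powRr0 mul1r (gtr0_norm t0).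
    by apply: dP'; rewrite gtr0_norm// ltW.
  - move=> t /andP[t1 t0]; rewrite /wt powRr0 mul1r (ltr0_norm t0).
    by apply: dPN; rewrite ltr0_norm//; lra.
  - by apply: cP; lra.
  - by apply: cPN; lra.
  - by move=> t /m1p1_norm t1 _; exact: cK.
  - exact: mbd_continuous_in.
  - by lra.
rewrite /PN !opprK oppr0.
suff : P 0 <= P 1 by lra.
rewrite /P !mulr0 !mulr1 subr0 addr0 !powR1 !mulr1 subrK.
rewrite ler_ndivlMr; last by rewrite pmulr_llt0//; lra.
rewrite divfK//.
have -> : m * (1 - D) `^ (1 - kap) = 1 - D.
  rewrite /m -powRD; last by rewrite (gt_eqF (_ : 0 < 1 - D)) ?implybT//; lra.
  by rewrite (_ : kap + (1 - kap) = 1); [rewrite powRr1//; lra|ring].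
have p0 : 0 < (1 + D) `^ (kap - 1) by rewrite powR_gt0//; lra.
rewrite -(ler_pM2r p0) mulrDl -mulrA -powRD; last first.
  by rewrite (gt_eqF (_ : 0 < 1 + D)) ?implybT//; lra.
rewrite (_ : 1 - kap + (kap - 1) = 0); last by ring.
rewrite powRr0 mulr1.
have h1 : (1 + D) `^ kap = (1 + D) * (1 + D) `^ (kap - 1).
  by rewrite mulr_powRB1//; lra.
have b1 := @powR_bernoulli _ (1 + D) kap ltac:(lra) kap1.
have b2 := @powR_bernoulli _ (1 - D) kap ltac:(lra) kap1.
rewrite -/m in b2; rewrite h1 in b1.
by lra.
Qed.

Lemma wmean_Kf_ge0 : 0 <= wmean k (fun t => Kf `|t|).
Proof.
have D0' := D0; have D1' := D1; have kap1' := kap1; have m0' := m0; have m1' := m1.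
have cK (t : R) : `|t| <= 1 -> {for t, continuous (fun t => Kf `|t|)}.
  move=> t1; apply: continuous_comp; first exact: norm_continuous.
  by apply: continuous_Kf; rewrite normr_id.
have mK : mbd (fun t => Kf `|t|) by exact: mbd_continuous_in.
have K0 : 0 <= Kf 0.
  by rewrite /Kf mulr0 addr0 subr0 powR1; lra.
have [K1|K1] := leP 0 (Kf 1).
  rewrite -[X in X <= _](@wmean_cst _ k); apply: le_wmean => //; first exact: mbd_cst.
  move=> t /m1p1_norm t1; apply: le_trans K1 _; exact: Kf_noninc.
have [t0 t0P Kt0] : exists2 t0, t0 \in `[0, 1] & Kf t0 = 0.
  apply: (@IVT R Kf 0 1 0) => //.
    apply: continuous_in_subspaceT => t /set_mem/=; rewrite in_itv/= => /andP[h1 h2].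
    by apply: continuous_Kf; rewrite ger0_norm.
  by rewrite ge_min le_max K0 (ltW K1) orbT.
move: t0P; rewrite in_itv/= => /andP[t00 t01].
have t0lt : t0 < 1.
  by rewrite lt_neqAle t01 andbT; apply: contraTneq K1 => <-; rewrite Kt0 ltxx.
pose e := @wexp R k.
(* For k > 0 the exponent is nonnegative, so that the weight decreases in |t|. *)
have e0 : 0 <= e by rewrite /e /wexp divr_ge0// subr_ge0 ler1n.
rewrite /wmean mulr_ge0 ?invr_ge0 ?(ltW (wI_gt0 k))//.
(* The weight is replaced by its value at the sign change t0. This lowers the integrand everywhere:
   [Kf] is nonnegative where the weight is larger and nonpositive where it is smaller. *)
apply: (@le_trans _ _ (wt e t0 * wI 0 (fun t => Kf `|t|))).
  by rewrite mulr_ge0 ?wt_ge0// wI0_Kf_ge0.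
have z2 : - 2^-1 <= 0 :> R by lra.
rewrite -(wI_Z _ z2 mK).
apply: le_Rintegral.
- exact: measurable_m1p1.
- apply: (wtM_integrable (e := 0)); first by lra.
  by apply: mbdM => //; exact: mbd_cst.
- by apply: wtM_integrable => //; exact: wexp_ge.
move=> t tm; rewrite {1}/wt powRr0 mul1r.
have t1 := m1p1_norm tm; have tp := one_minus_sqr_gt0 tm.
have [tt0|tt0] := leP `|t| t0.
  have : 0 <= Kf `|t| by rewrite -Kt0; exact: Kf_noninc.
  move=> Kt; apply: ler_wpM2r => //; rewrite /wt.
  apply: ge0_ler_powR => //; rewrite ?nnegrE; [by nra|exact: ltW|].
  have : t ^+ 2 <= t0 ^+ 2.
    rewrite -(real_normK (num_real t)).
    by rewrite ler_pXn2r ?nnegrE.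
  by lra.
have : Kf `|t| <= 0 by rewrite -Kt0; apply: Kf_noninc => //; exact: ltW.
move=> Kt; apply: ler_wnM2r => //; rewrite /wt.
apply: ge0_ler_powR => //; rewrite ?nnegrE; [exact: ltW|by nra|].
have : t0 ^+ 2 <= t ^+ 2.
  rewrite -(real_normK (num_real t)).
  by rewrite ler_pXn2r ?nnegrE// ltW.
by lra.
Qed.
End Kernel.

(** With Q = 1 + r^2 and D = 2 r / Q one has [ss r t] = Q (1 - D t); the term (1 - r)^(2 kap) is the
    smallest value of this, at t = 1, to the power kap. *)
Lemma wmean_abs_kernel (kap r b : R) : 1 < kap -> 0 < r < 1 ->
  0 <= b <= (1 + r ^+ 2) `^ kap ->
  wmean k (fun t => `|1 - b * ss r t `^ (- kap)|) <=
  wmean k (fun t => ss r t `^ (- kap)) *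
    (2 * (1 + r ^+ 2) `^ kap - (1 - r) `^ (2 * kap) - b).
Proof.
move=> kap1 /andP[r0 r1] /andP[b0 bq].
have rn : `|r| < 1 by rewrite gtr0_norm.
pose Q := 1 + r ^+ 2; have Q0 : 0 < Q by rewrite /Q; nra.
pose D := 2 * r / Q.
have D0 : 0 < D by rewrite divr_gt0//; lra.
have D1 : D < 1 by rewrite /D ltr_pdivrMr// mul1r /Q; nra.
pose q := Q `^ kap; have q0 : 0 < q by exact: powR_gt0.
pose m := (1 - D) `^ kap.
have ssE t : ss r t = Q * (1 - D * t) by rewrite /ss /D /Q; field; rewrite -/Q gt_eqF.
have mE : (1 - r) `^ (2 * kap) = q * m.
  rewrite powRrM powR_mulrn ?subr_ge0 ?(ltW r1)// /q /m -powRM ?(ltW Q0)//; last by lra.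
  by congr (_ `^ _); rewrite /D /Q; field; rewrite -/Q gt_eqF.
rewrite -/Q -/q in bq *; rewrite mE.
pose C := 2 * q - q * m - b; rewrite -/C mulrC.
have ms : mbd (fun t => ss r t `^ (- kap)) by exact: mbd_ss.
rewrite -wmeanZ//.
have mC : mbd (fun t => C * ss r t `^ (- kap)) by apply: mbdM => //; exact: mbd_cst.
have css e t : `|t| <= 1 -> {for t, continuous (fun t => ss r t `^ e)}.
  move=> t1; apply/differentiable_continuous/derivable1_diffP.
  have dss : is_derive t 1 (ss r) (- (2 * r)).
    by rewrite /ss; apply: is_derive_eq; rewrite /GRing.scale/=; ring.
  by have [] := is_derive_powR_comp e (ss_gt0 rn t1) dss.
have mabs : mbd (fun t => `|1 - b * ss r t `^ (- kap)|).
  apply: mbd_continuous_in => t t1.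
  apply: (@continuous_comp _ _ _ (fun t => 1 - b * ss r t `^ (- kap)) Num.norm); last exact: norm_continuous.
  apply: continuousB; first exact: cst_continuous.
  by apply: continuousM; [exact: cst_continuous|exact: css].
rewrite -subr_ge0 -wmeanB//.
(* With x the power of [ss], b <= q gives |x - b| <= max(x, 2 q - x) - b; so phi is a lower bound
   for the deficit that no longer contains b. *)
pose phi t := ss r t `^ (- kap) * (2 * q - q * m - Num.max (ss r t `^ kap) (2 * q - ss r t `^ kap)).
have cphi t : `|t| <= 1 -> {for t, continuous phi}.
  move=> t1; apply: continuousM; first exact: css.
  apply: continuousB; first exact: cst_continuous.
  apply: continuous_max; first exact: css.
  by apply: continuousB; [exact: cst_continuous|exact: css].
have mphi : mbd phi by exact: mbd_continuous_in.
have phile t : `|t| <= 1 -> phi t <= C * ss r t `^ (- kap) - `|1 - b * ss r t `^ (- kap)|.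
  move=> t1; have s0 := ss_gt0 rn t1.
  rewrite /phi /C powRN; set x := ss r t `^ kap.
  have x0 : 0 < x by exact: powR_gt0.
  have -> : 1 - b / x = x^-1 * (x - b) by field; rewrite gt_eqF.
  rewrite normrM gtr0_norm ?invr_gt0// [_ * x^-1]mulrC -mulrBr ler_pM2l ?invr_gt0//.
  have [xb|xb] := leP 0 (x - b).
    have h : x <= Num.max x (2 * q - x) by rewrite le_max lexx.
    by rewrite ger0_norm//; lra.
  have h : 2 * q - x <= Num.max x (2 * q - x) by rewrite le_max lexx orbT.
  by rewrite ltr0_norm//; lra.
apply: (@le_trans _ _ (wmean k phi)); last first.
  apply: le_wmean => //; first exact: mbdB.
  by move=> t /m1p1_norm; exact: phile.
have cphiN t : `|t| <= 1 -> {for t, continuous (fun t => phi (- t))}.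
  move=> t1; apply: continuous_comp; first exact: opp_continuous.
  by apply: cphi; rewrite normrN.
have mphiN : mbd (fun t => phi (- t)) by exact: mbd_continuous_in.
have E : 2 * wmean k phi = wmean k (fun t => Kf D kap `|t|).
  rewrite (_ : 2 * wmean k phi = wmean k phi + wmean k (fun t => phi (- t))).
    rewrite -wmeanD//; apply: eq_wmean => t /m1p1_norm.
    (* At u the maximum is 2 q - x, at - u it is x; in the sum the constants 1 and -1 cancel and
       leave [Kf]. *)
    have key (u : R) : 0 <= u -> u <= 1 -> phi u + phi (- u) = Kf D kap u.
      move=> u0 u1.
      have d1 : 0 < 1 - D * u by nra. have d2 : 0 < 1 + D * u by nra.
      have e1 : ss r u `^ kap = q * (1 - D * u) `^ kap by rewrite ssE powRM// ltW.
      have e2 : ss r (- u) `^ kap = q * (1 + D * u) `^ kap.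
        by rewrite ssE mulrN opprK powRM// ltW.
      have x1 : 0 < (1 - D * u) `^ kap by exact: powR_gt0.
      have x2 : 0 < (1 + D * u) `^ kap by exact: powR_gt0.
      have l1 : (1 - D * u) `^ kap <= 1.
        by have := @ge0_ler_powR R kap ltac:(lra) (1 - D * u) 1; rewrite powR1 !nnegrE;
           apply; nra.
      have l2 : 1 <= (1 + D * u) `^ kap.
        by have := @ge0_ler_powR R kap ltac:(lra) 1 (1 + D * u); rewrite powR1 !nnegrE;
           apply; nra.
      rewrite /phi !powRN e1 e2 /Kf -/m !powRN.
      rewrite max_r; last by nra.
      rewrite max_l; last by nra.
      by field; rewrite !gt_eqF.
    have [t0|t0] := leP 0 t; first by rewrite ger0_norm//; exact: key.
    rewrite ltr0_norm// => t1; have := key (- t); rewrite opprK addrC; apply => //.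
    by lra.
  by rewrite -(wmean_sym cphi); ring.
have := wmean_Kf_ge0 D0 D1 kap1; rewrite -E; lra.
Qed.
End ThirdTerm.

(** * Gamma at half-integers *)

Section GammaHalf.
Context {R : realType}.
Notation mu := (@lebesgue_measure R).

(* [F] is a primitive of the integrand of [Gamma s], with [l] its limit at infinity:
   the functional equation becomes an identity between primitives. *)
Definition gamma_prim (s l : R) (F : R -> R) := [/\ F 0 = 0,
  F x @[x --> 0^'+] --> (0 : R), F x @[x --> +oo] --> l &
  forall x : R, 0 < x -> is_derive x 1 F (x `^ (s - 1) * expR (- x))].

Lemma gamma_primE s l F : 1 < s -> gamma_prim s l F -> Gamma s = l.
Proof.
(* The absolute value extends the integrand continuously across 0, which uses s > 1; Gamma is
   therefore computed from 3/2 upwards. *)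
move=> s1 [F0 Fr Fy dF]; pose f (x : R) := `|x| `^ (s - 1) * expR (- x).
have cf : continuous f.
  have s0 : 0 < s - 1 by lra.
  have c1 := continuous_powR_norm s0.
  move=> x; apply: (@continuousM _ _ (fun x : R => `|x| `^ (s - 1)) (fun x => expR (- x))); first exact: c1.
  by apply: continuous_comp; [exact: opp_continuous|exact: continuous_expR].
rewrite /Gamma /pos_half.
have -> : (\int[mu]_(t in `]0%R, +oo[) ((t `^ (s - 1)) * expR (- t))%:E =
           \int[mu]_(t in `]0%R, +oo[) (f t)%:E)%E.
  apply: eq_integral => t; rewrite inE/= in_itv/= andbT => t0.
  by rewrite /f gtr0_norm.
rewrite integral_itv_obnd_cbnd; last first.
  apply/measurable_EFinP; apply: measurable_funTS.
  exact: continuous_measurable_fun.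
rewrite (@ge0_continuous_FTC2y _ f F 0 l).
- by rewrite F0 sube0.
- by move=> x _; rewrite mulr_ge0 ?powR_ge0 ?expR_ge0.
- by apply: continuous_subspaceT.
- exact: Fy.
- by move=> x /dF[].
- by rewrite F0.
- move=> x; rewrite in_itv/= andbT => x0; have := dF x x0 => d.
  by rewrite derive1E derive_val /f gtr0_norm.
Qed.

Lemma powR_expRN_cvg0 (s : R) : 0 < s -> x `^ s * expR (- x) @[x --> +oo] --> (0 : R).
Proof.
move=> s0; have [N sN] : exists N : nat, s <= N%:R.
  by exists (Num.truncn s).+1; rewrite ltW// truncnS_gt.
pose c : R := (N.+1)`!%:R.
have ci : c * x^-1 @[x --> +oo] --> (0 : R).
  rewrite -(mulr0 c); apply: cvgM; first exact: cvg_cst.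
  apply/gtr0_cvgV0; first by near=> x.
  exact: cvg_id.
apply: (@squeeze_cvgr _ _ _ _ (cst 0) (fun x => c * x^-1)) => //; last exact: cvg_cst.
near=> x.
have x1 : 1 <= x by near: x; exact: nbhs_pinfty_ge.
have x0 : 0 < x by lra.
rewrite mulr_ge0 ?powR_ge0 ?expR_ge0//=.
have h := @expR_ge1Dxn _ x N (ltW x0).
rewrite expRN ler_pdivrMr ?expR_gt0//.
apply: (@le_trans _ _ (x ^+ N)).
  by rewrite -powR_mulrn ?(ltW x0)//; exact: ler_powR.
have c0 : 0 < c by rewrite ltr0n fact_gt0.
have h2 : x ^+ N.+1 / c <= expR x by lra.
apply: (@le_trans _ _ (c * x^-1 * (x ^+ N.+1 / c))).
  rewrite exprS (_ : _ * (_ / _) = x ^+ N)//.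
  by field; rewrite !gt_eqF.
by rewrite ler_pM2l// mulr_gt0// invr_gt0.
Unshelve. all: end_near. Qed.

Lemma gamma_primS s l F : 0 < s -> gamma_prim s l F ->
  gamma_prim (s + 1) (s * l) (fun x => s * F x - x `^ s * expR (- x)).
Proof.
move=> s0 [F0 Fr Fy dF]; split.
- by rewrite F0 mulr0 powR0 ?gt_eqF// mul0r subr0.
- have z : s * 0 - 0 * expR (- 0) = 0 :> R by ring.
  rewrite -[X in _ --> X]z; apply: cvgB; first by apply: cvgM => //; exact: cvg_cst.
  apply: cvgM; first exact: powR_cvg0.
  apply: cvg_at_right_filter.
  by apply: continuous_comp; [exact: opp_continuous|exact: continuous_expR].
- rewrite -[X in _ --> X]subr0.
  apply: cvgB; first by apply: cvgM => //; exact: cvg_cst.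
  exact: powR_expRN_cvg0.
- move=> x x0; have d1 := dF x x0; have d2 := is_derive1_powR s x0.
  have x1 : x `^ (s + 1 - 1) = x `^ s by congr (_ `^ _); ring.
  by apply: is_derive_eq; rewrite /GRing.scale/= x1; ring.
Qed.

Lemma gamma_prim2 : gamma_prim 2 1 (fun x => 1 - expR (- x) - x `^ 1 * expR (- x)).
Proof.
have H : gamma_prim 1 1 (fun x => 1 - expR (- x)).
  split.
  - by rewrite oppr0 expR0 subrr.
  - have z : 1 - expR (- 0) = 0 :> R by rewrite oppr0 expR0 subrr.
    rewrite -[X in _ --> X]z; apply: cvg_at_right_filter; apply: cvgB; first exact: cvg_cst.
    by apply: continuous_comp; [exact: opp_continuous|exact: continuous_expR].
  - rewrite -[X in _ --> X]subr0; apply: cvgB; first exact: cvg_cst.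
    exact: cvgr_expR.
  - move=> x x0; rewrite subrr powRr0.
    by apply: is_derive_eq; rewrite /GRing.scale/=; ring.
have := gamma_primS ltr01 H; rewrite mulr1.
by under eq_fun do rewrite mul1r.
Qed.

Import gauss_integral_proof.

(** Substituting x = y^2 in the integral of sqrt(x) exp(-x) and integrating by parts leaves the
    Gaussian integral. *)
Lemma gamma_prim32 : gamma_prim (3 / 2) (Num.sqrt pi / 2)
  (fun x => integral0_gauss (Num.sqrt x) - Num.sqrt x * expR (- x)).
Proof.
have gi (y : R) : mu.-integrable `[0, y] (EFin \o gauss_fun).
  apply: continuous_compact_integrable; first exact: segment_compact.
  by apply: continuous_subspaceT; exact: continuous_gauss_fun.
have sq0 : Num.sqrt x @[x --> (0:R)^'+] --> (0 : R).
  by rewrite -[X in _ --> X](@sqrtr0 R); apply: cvg_at_right_filter; exact: sqrt_continuous.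
have sqy : Num.sqrt x @[x --> +oo] --> (+oo : set_system R).
  apply/cvgryPge => A; near=> x.
  have [A0|A0] := leP A 0; first by apply: le_trans A0 _; exact: sqrtr_ge0.
  rewrite -[leLHS](gtr0_norm A0) -sqrtr_sqr ler_sqrt; last by near: x; exact: nbhs_pinfty_ge.
  by near: x; apply: nbhs_pinfty_ge; rewrite num_real.
split.
- rewrite sqrtr0 mul0r subr0 /integral0_gauss set_itv1.
  by rewrite Rintegral_set1.
- have z : 0 - 0 * expR (- 0) = 0 :> R by ring.
  rewrite -[X in _ --> X]z; apply: cvgB; last first.
    apply: cvgM => //; apply: cvg_at_right_filter.
    by apply: continuous_comp; [exact: opp_continuous|exact: continuous_expR].
  apply: (@squeeze_cvgr _ _ _ _ (cst 0) Num.sqrt) => //; last exact: cvg_cst.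
  near=> x; rewrite integral0_gauss_ge0/=.
  have x0 := sqrtr_ge0 x.
  rewrite /integral0_gauss.
  have : \int[mu]_(t in `[0, Num.sqrt x]) gauss_fun t <= \int[mu]_(t in `[0, Num.sqrt x]) cst 1 t.
    apply: le_Rintegral => //; last by move=> t _; rewrite /gauss_fun -expR0 ler_expR oppr_le0 sqr_ge0.
    apply: continuous_compact_integrable; first exact: segment_compact.
    by apply: continuous_subspaceT; exact: cst_continuous.
  rewrite Rintegral_cst//= lebesgue_measure_itv/= lte_fin mul1r.
  by case: ifPn => _ //=; rewrite ?subr0 //; move/le_trans; apply.
- rewrite -[X in _ --> X]subr0; apply: cvgB.
    apply: (@cvg_comp _ _ _ Num.sqrt (@integral0_gauss R) _ _ _ sqy).
    have : Num.sqrt (@integral0_gauss R x ^+ 2) @[x --> +oo] --> Num.sqrt (pi / 4).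
      by apply: continuous_cvg => //; [exact: sqrt_continuous|exact: cvg_integral0_gauss_sqr].
    rewrite sqrtrM ?pi_ge0// sqrtrV// (_ : 4 = 2 ^+ 2); last by rewrite expr2 -natrM.
    rewrite sqrtr_sqr ger0_norm//.
    rewrite (_ : (fun _ => Num.sqrt _) = integral0_gauss)//.
    by apply/funext => r; rewrite sqrtr_sqr// ger0_norm// integral0_gauss_ge0.
  have := @powR_expRN_cvg0 2^-1 ltac:(lra).
  apply: cvg_trans; apply: near_eq_cvg; near=> x.
  by rewrite powR12_sqrt.
- move=> x x0; have d1 := is_derive1_sqrt x0.
  have y0 : 0 < Num.sqrt x by rewrite sqrtr_gt0.
  have d2 : is_derive (Num.sqrt x) 1 (@integral0_gauss R) (gauss_fun (Num.sqrt x)).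
    have h : Num.sqrt x < Num.sqrt x + 1 by rewrite ltrDl.
    have [h1 h2] := continuous_FTC1_closed h (gi _) y0 (@continuous_gauss_fun R _).
    by apply: DeriveDef; [exact: h1|rewrite -derive1E; exact: h2].
  have d3 := is_derive1_comp d2 d1.
  have d4 : is_derive x 1 (fun x : R => expR (- x)) (- expR (- x)).
    by apply: is_derive_eq; rewrite /GRing.scale/=; ring.
  have d5 := is_deriveB d3 (is_deriveM d1 d4).
  apply: (is_derive_eq d5).
  rewrite /GRing.scale/= /gauss_fun sqr_sqrtr ?(ltW x0)//.
  rewrite (_ : 3 / 2 - 1 = 2^-1); last by field.
  rewrite powR12_sqrt ?(ltW x0)//; field; by rewrite gt_eqF.
Unshelve. all: end_near. Qed.

(** A step of one in the argument is a step of two in m, so two consecutive cases are carried along,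
    starting from 3/2 and 2. *)
Lemma gamma_half (m : nat) : exists l F, 0 < l /\ gamma_prim (m%:R / 2 + 3 / 2) l F.
Proof.
suff : (exists l F, 0 < l /\ gamma_prim (m%:R / 2 + 3 / 2) l F) /\
       (exists l F, 0 < l /\ gamma_prim (m.+1%:R / 2 + 3 / 2) l F) by case.
elim: m => [|m [IH1 IH2]].
  split.
    exists (Num.sqrt pi / 2); eexists; split; first by rewrite divr_gt0// sqrtr_gt0 pi_gt0.
    by rewrite mul0r add0r; exact: gamma_prim32.
  exists 1; eexists; split => //.
  by rewrite (_ : _ + _ = 2); [exact: gamma_prim2|field].
split=> //; case: IH1 => l [F [l0 H]].
have s0 : 0 < m%:R / 2 + 3 / 2 :> R by rewrite ltr_wpDl// ?divr_ge0// divr_gt0.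
exists ((m%:R / 2 + 3 / 2) * l); eexists; split; first exact: mulr_gt0.
have := gamma_primS s0 H.
have E : m%:R / 2 + 3 / 2 + 1 = m.+2%:R / 2 + 3 / 2 :> R.
  by rewrite -(natr1 m.+1) -natr1; field.
by rewrite E; exact.
Qed.

Lemma Gamma_half_gt0 (m : nat) : 0 < Gamma (m%:R / 2 + 3 / 2 : R).
Proof.
have [l [F [l0 H]]] := gamma_half m.
rewrite (gamma_primE _ H)//.
have : 0 <= m%:R / 2 :> R by rewrite divr_ge0.
by lra.
Qed.

Lemma Gamma_halfS (m : nat) :
  Gamma (m.+2%:R / 2 + 3 / 2) = (m%:R / 2 + 3 / 2) * Gamma (m%:R / 2 + 3 / 2) :> R.
Proof.
have [l [F [l0 H]]] := gamma_half m.
have m0 : 0 <= m%:R / 2 :> R by rewrite divr_ge0.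
rewrite (gamma_primE _ H)//; last by lra.
have s0 : 0 < m%:R / 2 + 3 / 2 :> R by lra.
rewrite (_ : m.+2%:R / 2 + 3 / 2 = m%:R / 2 + 3 / 2 + 1); last by rewrite -(natr1 m.+1) -natr1; field.
by rewrite (gamma_primE _ (gamma_primS s0 H))//; lra.
Qed.

Lemma Gamma_32 : Gamma (3 / 2) = Num.sqrt pi / 2 :> R.
Proof. by rewrite (gamma_primE _ gamma_prim32)//; lra. Qed.

Lemma Gamma_2 : Gamma 2 = 1 :> R.
Proof. by rewrite (gamma_primE _ gamma_prim2)//; lra. Qed.

(** The Beta integral B(1/2, k/2 + 1). The factor (k + 2) / 2 turns Gamma((k + 2) / 2) into Gamma((k
    + 4) / 2), so that no argument falls below 3/2. *)
Lemma wI1_Gamma (k : nat) :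
  wI (wexp k.+1) (fun=> 1) * ((k%:R + 2) / 2) * Gamma (k%:R / 2 + 3 / 2) =
  Num.sqrt pi * Gamma (k.+1%:R / 2 + 3 / 2) :> R.
Proof.
suff : (forall m, (m = k) \/ (m = k.+1) -> wI (wexp m.+1) (fun=> 1) * ((m%:R + 2) / 2) * Gamma (m%:R / 2 + 3 / 2) =
  Num.sqrt pi * Gamma (m.+1%:R / 2 + 3 / 2) :> R) by apply; left.
elim: k => [m [|]->|k IH m].
- rewrite (_ : wexp 1 = 0) ?wI0; last by rewrite /wexp subrr mul0r.
  rewrite mul0r !add0r Gamma_32 (_ : 1 / 2 + 3 / 2 = 2) ?Gamma_2; last by field.
  by field.
- rewrite (_ : wexp 2 = - 2^-1 + 1); last by rewrite /wexp; field.
  have := @wI_succ1 R (- 2^-1) (lexx _).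
  rewrite (_ : 1 / 2 + 3 / 2 = 2) ?Gamma_2; last by field.
  have := Gamma_halfS 0; rewrite mul0r add0r => ->.
  rewrite wI_Nhalf; rewrite Gamma_32 => h.
  have p2 : Num.sqrt pi * Num.sqrt pi = pi :> R by rewrite -expr2 sqr_sqrtr// pi_ge0.
  have {}h : wI (- 2^-1 + 1) (fun=> 1) = pi / 2 :> R by lra.
  by rewrite h; move: p2; set q := Num.sqrt pi => <-; field.
case=> ->; first by apply: IH; right.
have := IH k (or_introl erefl) => {}IH.
rewrite Gamma_halfS (Gamma_halfS k.+1) [RHS]mulrCA -IH.
rewrite wexpSS; have := @wI_succ1 R (wexp k.+1) (wexp_ge _).
have E : 2 * wexp k.+1 + 2 = k%:R + 2 :> R by rewrite /wexp -natr1; field.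
have E' : 2 * wexp k.+1 + 3 = k%:R + 3 :> R by rewrite /wexp -natr1; field.
rewrite E E' => h.
have k0 : 0 < k%:R + 3 :> R by rewrite ltr_wpDl.
have -> : wI (wexp k.+1 + 1) (fun=> 1) = (k%:R + 2) / (k%:R + 3) * wI (wexp k.+1) (fun=> 1) :> R.
  by apply: (mulfI (lt0r_neq0 k0)); rewrite h; field; rewrite gt_eqF.
rewrite -(natr1 k.+1) -natr1; field; by rewrite gt_eqF.
Qed.

(** The primitive is a multiple of [wt (e + 1)], with opposite signs on the two halves of the
    interval. *)
Lemma wI_norm (e : R) : - 2^-1 <= e -> wI e (fun t => `|t|) = (e + 1)^-1.
Proof.
move=> e2; have e1 : 0 < e + 1 by lra.
have dw (t : R) : m1p1 t -> is_derive t 1 (fun t => wt (e + 1) t) (- (2 * (e + 1)) * (wt e t * t)).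
  move=> tm; have := is_derive_wt (e + 1) tm; rewrite addrK => d.
  by apply: (is_derive_eq d); ring.
have cw : {within `[(-1)%R, 1%R], continuous (wt (e + 1))} by exact: continuous_wt_closed.
pose c : R := (2 * (e + 1))^-1.
have c0 : 2 * (e + 1) != 0 by rewrite mulf_neq0// gt_eqF.
have cc (x : R) a b : -1 <= a -> b <= 1 -> {within `[a, b], continuous (fun t => x * wt (e + 1) t)}.
  move=> ha hb; have sub : `[a, b] `<=` `[(-1)%R, 1%R].
    by move=> t /=; rewrite !in_itv/= => /andP[? ?]; apply/andP; split; lra.
  by apply: continuous_subspaceW sub _ => t; apply: cvgM; [exact: cvg_cst|exact: cw].
have h1 (t : R) : -1 < t < 0 -> is_derive t 1 (fun t => c * wt (e + 1) t) (wt e t * `|t|).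
  move=> /andP[? t0]; have tm : m1p1 t by rewrite /m1p1/= in_itv/=; apply/andP; split; lra.
  have d := is_deriveZ c (dw t tm).
  by apply: (is_derive_eq d); rewrite ltr0_norm// /GRing.scale/= /c; field; rewrite gt_eqF.
have h2 (t : R) : 0 < t < 1 -> is_derive t 1 (fun t => - c * wt (e + 1) t) (wt e t * `|t|).
  move=> /andP[t0 ?]; have tm : m1p1 t by rewrite /m1p1/= in_itv/=; apply/andP; split; lra.
  have d := is_deriveZ (- c) (dw t tm).
  by apply: (is_derive_eq d); rewrite gtr0_norm// /GRing.scale/= /c; field; rewrite gt_eqF.
have mn : mbd (fun t : R => `|t|) by apply: mbd_continuous; exact: norm_continuous.
have hm1 : -1 <= -1 :> R by []. have h01 : 0 <= 1 :> R by []. have hm0 : -1 <= 0 :> R by lra.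
have -> := wI_FTC_split e2 mn (fun t _ _ => @norm_continuous _ _ t) (cc c _ _ hm1 h01) (cc (- c) _ _ hm0 (lexx 1)) h1 h2.
rewrite /wt expr0n/= subr0 powR1 sqrrN expr1n subrr powR0 ?gt_eqF// /c.
by field; rewrite gt_eqF.
Qed.

(** The mean of |zeta_1| on the unit sphere of R^n for n = k + 3; its reciprocal is the Gamma
    quotient in [Kconst]. *)
Lemma wmean_norm (k : nat) : wmean k.+1 (fun t : R => `|t|) =
  Gamma (k.+3%:R / 2) / (Num.sqrt pi * Gamma ((k.+3%:R + 1) / 2)) :> R.
Proof.
rewrite /wmean wI_norm ?wexp_ge//.
have := wI1_Gamma k.
rewrite (_ : k%:R / 2 + 3 / 2 = k.+3%:R / 2); last by rewrite -addn3 natrD; field.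
rewrite (_ : k.+1%:R / 2 + 3 / 2 = (k.+3%:R + 1) / 2); last by rewrite -addn3 -addn1 !natrD; field.
move=> <-.
have g0 : 0 < Gamma (k.+3%:R / 2 : R).
  by have := Gamma_half_gt0 k; rewrite (_ : k%:R / 2 + 3 / 2 = k.+3%:R / 2); last by rewrite -addn3 natrD; field.
have w0 := @wI_gt0 R k.+1.
have -> : wexp k.+1 + 1 = (k%:R + 2) / 2 :> R by rewrite /wexp -natr1; field.
have k0 : 0 < k%:R + 2 :> R by rewrite ltr_wpDl.
by field; rewrite !gt_eqF.
Qed.
End GammaHalf.

(** * The Poisson kernel *)

Section KernelDerivative.
Context {R : realType}.
Variables (k : nat) (a c : R).
Notation V := 'rV[R]_k.+2.

(* [kn] is the Poisson kernel up to its constant, for [a = 1 - alpha] and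
   [c = - (n - alpha) / 2]; [kd x v z] is its derivative at [x] along [v]. *)
Definition kq (x : V) : R := 1 - dotp x x.
Definition kp (x z : V) : R := dotp (x - z) (x - z).
Definition kn (x z : V) : R := kq x `^ a * kp x z `^ c.
Definition kd (x v z : V) : R :=
  a * (- (2 * dotp x v)) * kq x `^ (a - 1) * kp x z `^ c +
  c * (2 * dotp (x - z) v) * kq x `^ a * kp x z `^ (c - 1).

Lemma kp_bounds (x z : V) : enorm z = 1 ->
  (1 - enorm x) ^+ 2 <= kp x z <= (1 + enorm x) ^+ 2.
Proof.
move=> z1; rewrite /kp dotpp; have h1 := ler_enormB z x; have h2 := ler_enormD x (- z).
rewrite enormN z1 in h2; rewrite z1 enormB in h1.
have x0 := enorm_ge0 x; have y0 := enorm_ge0 (x - z).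
apply/andP; split; last by rewrite ler_pXn2r ?nnegrE//; lra.
have [l|l] := leP (enorm x) 1; first by rewrite ler_pXn2r ?nnegrE//; lra.
have h3 := ler_enormB x z; rewrite z1 in h3.
by rewrite -sqrrN ler_pXn2r ?nnegrE//; lra.
Qed.

Lemma kpE (x z : V) : enorm z = 1 -> kp x z = 1 + enorm x ^+ 2 - 2 * dotp z x.
Proof.
move=> z1; rewrite /kp dotpBl !dotpBr (dotpC x z) !dotpp z1 expr1n; ring.
Qed.

Lemma measurable_kp (x : V) :
  measurable_fun setT (fun z : k.+2.-tuple R => kp x (to_rV z)).
Proof.
rewrite /kp /dotp.
have [] : sbd (fun z : V => \sum_i (x - z) 0 i * (x - z) 0 i); last by [].
have h i : sbd (fun z : V => (x - z) 0 i).
  under eq_fun do rewrite !mxE.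
  by apply: sbdB; [exact: sbd_cst|exact: sbd_coord].
by apply: sbd_sum => i; exact: sbdM.
Qed.

Lemma sbd_kp (x : V) (e : R) : enorm x < 1 -> sbd (fun z => kp x z `^ e).
Proof.
move=> x1; split.
  by apply: (measurableT_comp (measurable_powR e)); exact: measurable_kp.
exists (((1 - enorm x) ^+ 2) `^ e + ((1 + enorm x) ^+ 2) `^ e) => z z1.
rewrite ger0_norm ?powR_ge0//; apply: powR_le_ends; last exact: kp_bounds.
by rewrite exprn_gt0// subr_gt0.
Qed.

Lemma sbd_dotpr (x v : V) : sbd (fun z => dotp (x - z) v).
Proof.
under eq_fun do rewrite dotpBl.
by apply: sbdB; [exact: sbd_cst|exact: sbd_dotp].
Qed.

Lemma sbd_kn (x : V) : enorm x < 1 -> sbd (kn x).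
Proof. by move=> x1; apply: sbdM; [exact: sbd_cst|exact: sbd_kp]. Qed.

Lemma sbd_kd (x v : V) : enorm x < 1 -> sbd (kd x v).
Proof.
move=> x1; apply: sbdD; apply: sbdM; try exact: sbd_kp; first exact: sbd_cst.
apply: sbdM; last exact: sbd_cst.
by apply: sbdM; [exact: sbd_cst|apply: sbdM; [exact: sbd_cst|exact: sbd_dotpr]].
Qed.

(** The constants del and B are independent of z, so the remainder estimate can be integrated over
    the sphere. *)
Lemma kn_taylor (x v : V) (s : R) : enorm (x + s *: v) < 1 ->
  exists del B : R, 0 < del /\ forall z h, enorm z = 1 -> `|h| < del ->
  `|kn (x + (s + h) *: v) z - kn (x + s *: v) z - h * kd (x + s *: v) v z| <= B * h ^+ 2.
Proof.
move=> y1; set y := x + s *: v; set rho := enorm y; rewrite -/y -/rho in y1.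
have rho0 : 0 <= rho := enorm_ge0 y.
have v0 := enorm_ge0 v.
(* Keeps the segment in the ball of radius [rh], halfway between rho and 1; the added 1 covers v =
   0. *)
pose del := (1 - rho) / 2 / (enorm v + 1).
have del0 : 0 < del by rewrite /del !divr_gt0 ?subr_gt0//; lra.
pose rh := (1 + rho) / 2.
pose m := (1 - rh) ^+ 2.
have m0 : 0 < m by rewrite exprn_gt0// /rh; lra.
(* Large enough at once for p <= 4, for |p'| <= 4 |v| and for the second derivatives, of modulus 2
   |v|^2. *)
pose Mx := 4 + 4 * enorm v + 2 * enorm v ^+ 2.
exists del, (qp_bound a c m Mx); split=> // z h z1 hd.
pose g t := x + t *: v.
pose q t := kq (g t); pose q1 t := - (2 * dotp (g t) v).
pose p t := kp (g t) z; pose p1 t := 2 * dotp (g t - z) v.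
have dl (w w' : V) (t : R) : is_derive t 1 (fun t => dotp (w + t *: v) w') (dotp v w').
  rewrite [X in is_derive _ _ X](_ : _ = fun t : R => dotp w w' + t * dotp v w').
    by apply: is_derive_eq; rewrite /GRing.scale/=; ring.
  by apply/funext => u; rewrite dotpDl dotpZl.
have dqu (w : V) (t : R) : is_derive t 1 (fun t => dotp (w + t *: v) (w + t *: v)) (2 * dotp (w + t *: v) v).
  rewrite [X in is_derive _ _ X](_ : _ = fun t : R => dotp w w + 2 * t * dotp w v + t ^+ 2 * dotp v v).
    by apply: is_derive_eq; rewrite /GRing.scale/= dotpDl dotpZl; ring.
  by apply/funext => u; rewrite !dotpDl !dotpDr !dotpZl !dotpZr (dotpC v w); ring.
have gz t : g t - z = (x - z) + t *: v by rewrite /g addrAC.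
have D1 t : `|t - s| <= `|h| -> [/\ is_derive t 1 q (q1 t), is_derive t 1 q1 (- (2 * dotp v v)),
     is_derive t 1 p (p1 t) & is_derive t 1 p1 (2 * dotp v v)].
  move=> _; have d1 := dqu x t; have d2 := dl x v t.
  have d3 := dqu (x - z) t; have d4 := dl (x - z) v t; split.
  - by rewrite /q /kq /g; apply: is_derive_eq; rewrite /q1 /g; ring.
  - by rewrite /q1 /g; apply: is_derive_eq; rewrite /GRing.scale/=; ring.
  - rewrite /p /kp /p1 gz; under eq_fun do rewrite gz; exact: d3.
  - rewrite /p1; under eq_fun do rewrite gz.
    by apply: is_derive_eq; rewrite /GRing.scale/=; ring.
have gn t : `|t - s| <= `|h| -> enorm (g t) <= rh.
  move=> th; rewrite /g (_ : x + t *: v = y + (t - s) *: v); last first.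
    by rewrite /y -addrA -scalerDl [s + _]addrC subrK.
  apply: le_trans (ler_enormD _ _) _; rewrite enormZ -/rho.
  have : `|t - s| * enorm v <= del * (enorm v + 1).
    by apply: ler_pM => //; lra.
  by rewrite /del divfK ?gt_eqF//; [rewrite /rh; lra|lra].
have D2 t : `|t - s| <= `|h| -> [/\ m <= q t <= Mx, m <= p t <= Mx,
     `|q1 t| <= Mx, `|p1 t| <= Mx & `|- (2 * dotp v v)| <= Mx /\ `|2 * dotp v v| <= Mx].
  move=> /gn gt; have gt0 := enorm_ge0 (g t).
  have rh1 : rh < 1 by rewrite /rh; lra. have rh0 : 0 <= rh by rewrite /rh; lra.
  have M4 : 4 <= Mx by rewrite /Mx; have := sqr_ge0 (enorm v); lra.
  have cs1 := cauchy_schwarz (g t) v.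
  have cs2 := cauchy_schwarz (g t - z) v.
  have vv : `|2 * dotp v v| <= Mx.
    by rewrite dotpp ger0_norm ?mulr_ge0 ?sqr_ge0// /Mx; lra.
  split.
  - by rewrite /q /kq dotpp /m; apply/andP; split; nra.
  - have /andP[b1 b2] := kp_bounds (g t) z1; rewrite /p; apply/andP; split.
      by apply: le_trans b1; rewrite /m; nra.
    by apply: le_trans b2 _; nra.
  - rewrite /q1 normrN normrM gtr0_norm//.
    have : enorm (g t) * enorm v <= 1 * enorm v by apply: ler_wpM2r => //; lra.
    by rewrite /Mx; have := sqr_ge0 (enorm v); lra.
  - rewrite /p1 normrM gtr0_norm//.
    have gz2 : enorm (g t - z) <= 2.
      by apply: le_trans (ler_enormD _ _) _; rewrite enormN z1; lra.
    have : enorm (g t - z) * enorm v <= 2 * enorm v by apply: ler_wpM2r.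
    by rewrite /Mx; have := sqr_ge0 (enorm v); lra.
  - by rewrite normrN.
exact: (@qp_taylor _ a c m Mx s h q q1 (fun=> - (2 * dotp v v)) p p1 (fun=> 2 * dotp v v) m0 D1 D2).
Qed.

Lemma is_derive_sint_kn (x v : V) (s : R) (psi : V -> R) : enorm (x + s *: v) < 1 -> sbd psi ->
  is_derive s 1 (fun s => sint (fun z => kn (x + s *: v) z * psi z))
    (sint (fun z => kd (x + s *: v) v z * psi z)).
Proof.
move=> y1 sp; have [del [B [del0 H]]] := kn_taylor y1.
have [mp [Bp pB]] := sp.
set y := x + s *: v; rewrite -/y in y1 H.
pose del2 := (1 - enorm y) / 2 / (enorm v + 1).
have v0 := enorm_ge0 v.
have del20 : 0 < del2 by rewrite /del2 !divr_gt0 ?subr_gt0//; lra.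
apply: (@is_derive_quad _ _ s _ (Num.min del del2) (B * Bp)).
  by rewrite lt_min del0 del20.
move=> h; rewrite lt_min => /andP[h1 h2].
have yh : enorm (x + (s + h) *: v) < 1.
  rewrite scalerDl addrA -/y; apply: le_lt_trans (ler_enormD _ _) _; rewrite enormZ.
  have : `|h| * enorm v <= del2 * (enorm v + 1) by apply: ler_pM => //; lra.
  by rewrite /del2 divfK ?gt_eqF//; lra.
have s1 : sbd (fun z => kn (x + (s + h) *: v) z * psi z) by apply: sbdM => //; exact: sbd_kn.
have s2 : sbd (fun z => kn y z * psi z) by apply: sbdM => //; exact: sbd_kn.
have s3 : sbd (fun z => kd y v z * psi z) by apply: sbdM => //; exact: sbd_kd.
rewrite -sintB// -sintZ// -sintB//; last 2 first.
- exact: sbdB.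
- by apply: sbdM => //; exact: sbd_cst.
rewrite -[leRHS](sint_cst k.+1); apply: normr_sint; last first.
- move=> z z1.
  have E (p q r t : R) : p * t - q * t - h * (r * t) = (p - q - h * r) * t by ring.
  rewrite E normrM mulrAC; apply: ler_pM => //; [exact: H|exact: pB].
- exact: sbd_cst.
- by apply: sbdB; [exact: sbdB|apply: sbdM => //; exact: sbd_cst].
Qed.

Lemma sint_kp (x : V) (g : R -> R) : enorm x < 1 -> (forall s, 0 < s -> {for s, continuous g}) ->
  sint (fun z => g (kp x z)) = wmean k (fun t => g (ss (enorm x) t)).
Proof.
move=> x1 cg; have x0 := enorm_ge0 x; set r := enorm x in x0 x1 *.
pose b : R := (1 - r) ^+ 2; have b0 : 0 < b by rewrite exprn_gt0// subr_gt0.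
(* g is known to be continuous on the positive reals only; the squared distance never falls below b,
   so cutting the argument off there changes no value that occurs. *)
pose f (s : R) : R := g (Num.max b (1 + r ^+ 2 - 2 * s)).
have cf : continuous f.
  move=> s; apply: (@continuous_comp _ _ _ (fun s : R => Num.max b (1 + r ^+ 2 - 2 * s)) g).
    apply: continuous_max; first exact: cst_continuous.
    apply: cvgB; first exact: cvg_cst.
    by apply: cvgM; [exact: cvg_cst|exact: cvg_id].
  by apply: cg; rewrite lt_max b0.
have := sint_zonal x cf; rewrite -/r => E.
transitivity (sint (fun z => f (dotp z x))).
  apply: eq_sint => z z1; rewrite /f max_r -?kpE//.
  by have /andP[] := kp_bounds x z1.
rewrite E; apply: eq_wmean => t /m1p1_norm t1; rewrite /f max_r.
  by rewrite /ss mulrA.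
have rr : `|r| <= r by rewrite ger0_norm.
have /andP[] := ss_bounds x1 rr t1; rewrite /ss /b => h _.
by rewrite mulrA.
Qed.
End KernelDerivative.

(** * Growth of the kernel derivative and the function G *)

Section KernelGrowth.
Context {R : realType}.
Variables (k : nat) (alpha : R).
Notation nR := (k.+3%:R : R).
Notation V := 'rV[R]_k.+3.

(** Since [kp] is a squared distance, exponents are halved: [lam1] belongs to the kernel and [lam2],
    larger by one, to its derivative. *)
Definition lam1 : R := (nR - alpha) / 2.
Definition lam2 : R := (nR + 2 - alpha) / 2.

Notation kdf := (kd (1 - alpha) (- lam1)).
Notation q r := (1 - r ^+ 2).

(* The paper's G with the maxima replaced by the values at [r], divided by [Cna]. *)
Definition growth (r : R) : R :=
  2 * (1 - alpha) / q r * hF k.+1 lam1 r + (nR - alpha) / q r ^+ 2 * hF k.+1 lam2 r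
  + (nR - alpha) / q r `^ (3 - alpha) * (hF k.+1 lam2 r * gfun k.+3 alpha r).

Lemma continuous_powRr (e s : R) : 0 < s -> {for s, continuous (fun s => s `^ e)}.
Proof.
move=> s0; apply/differentiable_continuous/derivable1_diffP.
by have [] := is_derive1_powR e s0.
Qed.

Lemma sint_kp_powR (x : V) e : enorm x < 1 ->
  sint (fun z => kp x z `^ e) = zm k.+1 0 e (enorm x).
Proof.
move=> x1; rewrite (sint_kp (g := fun s => s `^ e) x1 (@continuous_powRr e)).
by apply: eq_wmean => t _; rewrite expr0 mul1r.
Qed.

Lemma zm0_ge0 e (r : R) : `|r| < 1 -> 0 <= zm k.+1 0 e r.
Proof.
move=> r1; rewrite -[leLHS](wmean_cst k.+1); apply: le_wmean; first exact: mbd_cst.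
  by apply: mbdM; [exact: mbd_pow|exact: mbd_ss].
by move=> t _; rewrite expr0 mul1r powR_ge0.
Qed.

Lemma hFE lam (r : R) : 0 <= r < 1 -> hF k.+1 lam r = q r `^ (2 * lam - nR + 1) * zm k.+1 0 (- lam) r.
Proof. by move=> r01; rewrite -zV_hF. Qed.

Lemma hF_ge0 lam (r : R) : 0 <= r < 1 -> 0 <= hF k.+1 lam r.
Proof.
move=> r01; rewrite hFE// mulr_ge0 ?powR_ge0// zm0_ge0//.
by case/andP : r01 => r0 r1; rewrite ger0_norm.
Qed.

Hypothesis alpha1 : alpha < 1.

Lemma nRalpha : 2 < nR - alpha.
Proof. have a1 := alpha1; have : 3 <= nR by rewrite ler_nat. by lra. Qed.

(** The folding estimate with b = (1 - r^2)^(1 - alpha) <= 1. Its bracket is r times [gfun], and the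
    mean of the power of [ss] is the series times (1 - r^2)^(alpha - 3). *)
Lemma wmean_third (r : R) : 0 < r < 1 ->
  wmean k.+1 (fun t => `|1 - q r `^ (1 - alpha) * ss r t `^ (- lam2)|) <=
  r * (hF k.+1 lam2 r * gfun k.+3 alpha r) / q r `^ (3 - alpha).
Proof.
move=> /andP[r0 r1]; have n2 := nRalpha; have a1 := alpha1.
have r01 : 0 <= r < 1 by rewrite (ltW r0).
have q0 : 0 < q r by apply: omr_gt0; rewrite gtr0_norm.
have kap1 : 1 < lam2 by rewrite /lam2; lra.
have p1 (e : R) : 1 `^ e = 1 :> R by rewrite powR1.
have b01 : 0 <= q r `^ (1 - alpha) <= (1 + r ^+ 2) `^ lam2.
  rewrite powR_ge0/=; apply: (@le_trans _ _ 1).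
    rewrite -[leRHS](p1 (1 - alpha)); apply: ge0_ler_powR; rewrite ?nnegrE//; [lra|lra|].
    by have := sqr_ge0 r; lra.
  rewrite -[leLHS](p1 lam2); apply: ge0_ler_powR; rewrite ?nnegrE//; have := sqr_ge0 r; lra.
have := @wmean_abs_kernel _ k.+1 isT lam2 r _ kap1 _ b01; rewrite r0 r1 => /(_ isT).
move=> /le_trans; apply.
rewrite hFE// /gfun gt_eqF// (_ : 2 * lam2 - nR + 1 = 3 - alpha); last by rewrite /lam2; field.
rewrite (_ : 2 * lam2 = nR + 2 - alpha); last by rewrite /lam2; field.
rewrite /zm /zI; under [X in _ <= _ * (_ * wmean _ X * _) / _]eq_fun do rewrite expr0 mul1r.
set Z := wmean _ _; set u := q r `^ (3 - alpha).
have u0 : 0 < u by exact: powR_gt0.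
rewrite (_ : (nR + 2 - alpha) / 2 = lam2)//.
set X := 2 * _ - _ - _.
by rewrite (_ : r * (u * Z * (X / r)) / u = Z * X)//; field; rewrite !gt_eqF.
Qed.

(** The sign is read off from [wmean_third], whose right-hand side dominates a mean of absolute
    values. *)
Lemma hF_gfun_ge0 (r : R) : 0 < r < 1 -> 0 <= hF k.+1 lam2 r * gfun k.+3 alpha r.
Proof.
move=> r01; have := wmean_third r01; case/andP : r01 => r0 r1.
have u0 : 0 < q r `^ (3 - alpha) by apply: powR_gt0; apply: omr_gt0; rewrite gtr0_norm.
have rn : `|r| < 1 by rewrite gtr0_norm.
have mb : mbd (fun t => 1 - q r `^ (1 - alpha) * ss r t `^ (- lam2)).
  apply: mbdB; first exact: mbd_cst.
  by apply: mbdM; [exact: mbd_cst|exact: mbd_ss].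
have h : 0 <= wmean k.+1 (fun t => `|1 - q r `^ (1 - alpha) * ss r t `^ (- lam2)|).
  rewrite -[leLHS](wmean_cst k.+1); apply: le_wmean => //; first exact: mbd_cst.
  case: mb => mf [B fB]; split; first exact: measurableT_comp.
  by exists B => t tm; rewrite normr_id fB.
move=> /(le_trans h); rewrite -mulrA pmulr_rge0// pmulr_lge0 ?invr_gt0//.
Qed.

Lemma kd0 (v z : V) : enorm z = 1 -> kdf 0 v z = (nR - alpha) * dotp z v.
Proof.
move=> z1; rewrite /kd /kq /kp !dotp0l subr0 sub0r dotpp enormN z1 expr1n !powR1.
by rewrite dotpNl /lam1; field.
Qed.

(** The derivative has two terms along x, which carry the factor |x|, and one along z; the latter
    absorbs the derivative at 0 and becomes, up to sign, (n - alpha) (1 - Q2 P2) <z, v>. *)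
Lemma kd_diff_le (x v z : V) : enorm z = 1 -> enorm x < 1 ->
  `|kdf x v z - kdf 0 v z| <= enorm v *
    (2 * (1 - alpha) * enorm x * q (enorm x) `^ (- alpha) * kp x z `^ (- lam1) +
     (nR - alpha) * enorm x * q (enorm x) `^ (1 - alpha) * kp x z `^ (- lam2) +
     (nR - alpha) * `|1 - q (enorm x) `^ (1 - alpha) * kp x z `^ (- lam2)|).
Proof.
move=> z1 x1; have n2 := nRalpha; have a1 := alpha1.
rewrite kd0// /kd /kq dotpp.
rewrite (_ : 1 - alpha - 1 = - alpha); last by ring.
rewrite (_ : - lam1 - 1 = - lam2); last by rewrite /lam1 /lam2; field.
set r := enorm x; set Q1 := _ `^ (- alpha); set Q2 := _ `^ (1 - alpha).
set P1 := _ `^ (- lam1); set P2 := _ `^ (- lam2).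
have Q10 : 0 <= Q1 := powR_ge0 _ _. have Q20 : 0 <= Q2 := powR_ge0 _ _.
have P10 : 0 <= P1 := powR_ge0 _ _. have P20 : 0 <= P2 := powR_ge0 _ _.
have cx := cauchy_schwarz x v; have cz := cauchy_schwarz z v; rewrite z1 mul1r -/r in cx cz.
rewrite dotpBl /lam1.
set X := dotp x v in cx *; set Z := dotp z v in cz *.
rewrite (_ : _ - _ = - (2 * (1 - alpha) * Q1 * P1 * X) - (nR - alpha) * Q2 * P2 * X -
   (nR - alpha) * (1 - Q2 * P2) * Z); last by field.
rewrite [leRHS]mulrDr [X in _ <= X + _]mulrDr.
apply: le_trans (ler_normB _ _) _; apply: lerD; last first.
  rewrite !normrM (gtr0_norm (_ : 0 < nR - alpha)); last by lra.
  by rewrite [leRHS]mulrC; apply: ler_wpM2l => //; rewrite mulr_ge0//; lra.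
apply: le_trans (ler_normB _ _) _; apply: lerD; rewrite ?normrN normrM ger0_norm.
- rewrite (_ : enorm v * _ = 2 * (1 - alpha) * Q1 * P1 * (r * enorm v)); last by ring.
  by apply: ler_wpM2l => //; rewrite !mulr_ge0//; lra.
- by rewrite !mulr_ge0//; lra.
- rewrite (_ : enorm v * _ = (nR - alpha) * Q2 * P2 * (r * enorm v)); last by ring.
  by apply: ler_wpM2l => //; rewrite !mulr_ge0//; lra.
- by rewrite !mulr_ge0//; lra.
Qed.

Lemma sint_kd_diff (x v : V) : enorm x < 1 ->
  sint (fun z => `|kdf x v z - kdf 0 v z|) <= enorm v * enorm x * growth (enorm x).
Proof.
move=> x1; have [x0|xn0] := eqVneq x 0.
  rewrite x0 enorm0 mulr0 mul0r (@eq_sint _ _ _ (fun=> 0)) ?sint_cst// => z _.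
  by rewrite subrr normr0.
have r0 : 0 < enorm x by rewrite lt_def enorm_eq0 xn0 enorm_ge0.
have r01 : 0 < enorm x < 1 by rewrite r0.
have s1 := sbd_kp (- lam1) x1; have s2 := sbd_kp (- lam2) x1.
have sd (y : V) : enorm y < 1 -> sbd (kdf y v) by move=> y1; exact: sbd_kd.
set r := enorm x in r0 r01 x1 *.
have q0 : 0 < q r by apply: omr_gt0; rewrite gtr0_norm.
pose T1 := 2 * (1 - alpha) * r * q r `^ (- alpha).
pose T2 := (nR - alpha) * r * q r `^ (1 - alpha).
pose f3 z := `|1 - q r `^ (1 - alpha) * kp x z `^ (- lam2)|.
have s3 : sbd f3.
  apply: sbd_norm; apply: sbdB; first exact: sbd_cst.
  by apply: sbdM => //; exact: sbd_cst.
have sT c (f : V -> R) : sbd f -> sbd (fun z => c * f z).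
  by move=> sf; apply: sbdM => //; exact: sbd_cst.
apply: (@le_trans _ _ (sint (fun z => enorm v * (T1 * kp x z `^ (- lam1) + T2 * kp x z `^ (- lam2) + (nR - alpha) * f3 z)))).
  apply: le_sint.
  - by apply: sbd_norm; apply: sbdB; apply: sd; rewrite ?enorm0.
  - by apply: (sT); apply: sbdD; [apply: sbdD|]; exact: (sT).
  - by move=> z z1; exact: kd_diff_le.
rewrite sintZ; last by apply: sbdD; [apply: sbdD|]; exact: (sT).
rewrite sintD; [|by apply: sbdD; exact: sT|exact: sT].
rewrite sintD; [|exact: sT|exact: sT].
rewrite !sintZ// !sint_kp_powR// -/r -mulrA.
apply: ler_wpM2l; first exact: enorm_ge0.
rewrite /growth mulrDr; apply: lerD.
  have r01' : 0 <= r < 1 by rewrite (ltW r0).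
  rewrite !hFE//.
  (* By [hFE] the integrals are the series divided by (1 - r^2)^(1 - alpha) and (1 - r^2)^(3 -
     alpha); against the powers in [T1] and [T2] the denominators 1 - r^2 and its square remain. *)
  rewrite (_ : 2 * lam1 - nR + 1 = - alpha + 1); last by rewrite /lam1; field.
  rewrite (_ : 2 * lam2 - nR + 1 = (1 - alpha) + 2); last by rewrite /lam2; field.
  have pD e f : q r `^ (e + f) = q r `^ e * q r `^ f.
    by rewrite powRD// (gt_eqF q0) implybT.
  rewrite (pD (- alpha) 1) (pD (1 - alpha) 2) powRr1 ?(ltW q0)// (_ : q r `^ 2 = q r ^+ 2); last exact: (powR_mulrn 2 (ltW q0)).
  rewrite le_eqVlt; apply/orP; left; apply/eqP; rewrite /T1 /T2.
  by field; rewrite gt_eqF.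
have -> : sint f3 = wmean k.+1 (fun t => `|1 - q r `^ (1 - alpha) * ss r t `^ (- lam2)|).
  rewrite /f3 /r; apply: (sint_kp (g := fun s => `|1 - q r `^ (1 - alpha) * s `^ (- lam2)|)) => // s s0.
  apply: (@continuous_comp _ _ _ (fun s : R => 1 - q r `^ (1 - alpha) * s `^ (- lam2)) Num.norm); last exact: norm_continuous.
  apply: continuousB; first exact: cst_continuous.
  by apply: continuousM; [exact: cst_continuous|exact: continuous_powRr].
have n2 := nRalpha.
apply: le_trans (ler_wpM2l _ (wmean_third r01)) _; first by lra.
rewrite le_eqVlt; apply/orP; left; apply/eqP.
by field; rewrite gt_eqF// powR_gt0.
Qed.

Lemma has_ubound_hF lam (r : R) : 0 <= r < 1 -> exists B, forall t, 0 <= t <= r -> hF k.+1 lam t <= B.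
Proof.
move=> /andP[r0 r1].
have cF : {within `[0, r], continuous (hF k.+1 lam)}.
  apply: continuous_in_subspaceT => t /set_mem/=; rewrite in_itv/= => /andP[t0 tr].
  apply/differentiable_continuous/derivable1_diffP.
  have t1 : `|t| < 1 by rewrite ger0_norm//; lra.
  by have [] := is_derive_hF k.+1 lam t1.
have [c _ H] := EVT_max r0 cF.
by exists (hF k.+1 lam c) => t tr; apply: H; rewrite in_itv/=.
Qed.

(** Near 0 the quotient is controlled by the mean value theorem, as its numerator N vanishes at 0.
    [maxOn] needs such a bound, since [sup] is meaningful only for sets that are bounded above. *)
Lemma gfun_bounded (r : R) : 0 <= r < 1 -> exists2 B, 0 <= B & forall t, 0 <= t <= r -> gfun k.+3 alpha t <= B.
Proof.
move=> /andP[r0 r1]; have n2 := nRalpha; have a1 := alpha1.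
pose E e : R := (1 - r) `^ e + 2 `^ e.
have E0 e : 0 <= E e by rewrite addr_ge0 ?powR_ge0.
pose p := nR + 2 - alpha.
pose N (t : R) := 2 * (1 + t ^+ 2) `^ (p / 2) - (1 - t) `^ p - (1 - t ^+ 2) `^ (1 - alpha).
pose N1 (t : R) := 2 * (p / 2 * (1 + t ^+ 2) `^ (p / 2 - 1) * (2 * t)) -
   p * (1 - t) `^ (p - 1) * -1 - (1 - alpha) * (1 - t ^+ 2) `^ (1 - alpha - 1) * (- (2 * t)).
have dN (t : R) : `|t| <= r -> is_derive t 1 N (N1 t).
  rewrite ler_norml => /andP[t1 t2].
  have d1 : is_derive t 1 (fun t : R => 1 + t ^+ 2) (2 * t).
    by apply: is_derive_eq; rewrite /GRing.scale/=; ring.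
  have d2 : is_derive t 1 (fun t : R => 1 - t) (- 1).
    by apply: is_derive_eq; rewrite /GRing.scale/=; ring.
  have d3 : is_derive t 1 (fun t : R => 1 - t ^+ 2) (- (2 * t)).
    by apply: is_derive_eq; rewrite /GRing.scale/=; ring.
  have p1 : 0 < 1 + t ^+ 2 by have := sqr_ge0 t; lra.
  have p2 : 0 < 1 - t by lra.
  have p3 : 0 < 1 - t ^+ 2 by nra.
  have e1 := is_derive_powR_comp (q := fun t : R => 1 + t ^+ 2) (p / 2) p1 d1.
  have e2 := is_derive_powR_comp (q := fun t : R => 1 - t) p p2 d2.
  have e3 := is_derive_powR_comp (q := fun t : R => 1 - t ^+ 2) (1 - alpha) p3 d3.
  by rewrite /N; apply: is_derive_eq; rewrite /GRing.scale/= /N1; ring.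
pose B := 2 * p * E (p / 2 - 1) + p * E (p - 1) + 2 * (1 - alpha) * E (1 - alpha - 1).
have p0 : 0 < p by rewrite /p; lra.
have N1B (t : R) : `|t| <= r -> N1 t <= B.
  rewrite ler_norml => /andP[t1 t2].
  have hE y e : 1 - r <= y <= 2 -> y `^ e <= E e by apply: powR_le_ends; lra.
  have h1 := hE (1 + t ^+ 2) (p / 2 - 1) ltac:(by apply/andP; split; nra).
  have h2 := hE (1 - t) (p - 1) ltac:(by apply/andP; split; lra).
  have h3 := hE (1 - t ^+ 2) (1 - alpha - 1) ltac:(by apply/andP; split; nra).
  rewrite /N1 /B.
  move: h1 h2 h3 (E0 (p / 2 - 1)) (E0 (1 - alpha - 1)).
  have := powR_ge0 (1 + t ^+ 2) (p / 2 - 1); have := powR_ge0 (1 - t ^+ 2) (1 - alpha - 1).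
  set y1 := (1 + t ^+ 2) `^ _; set y2 := (1 - t) `^ _; set y3 := (1 - t ^+ 2) `^ _.
  set z1 := E (p / 2 - 1); set z2 := E (p - 1); set z3 := E (1 - alpha - 1).
  move=> y30 y10 h1 h2 h3 z10 z30.
  have u1 : y1 * t <= z1 by nra.
  have u3 : y3 * t <= z3 by nra.
  have w1 : p * (y1 * t) <= p * z1 by rewrite ler_pM2l.
  have w2 : p * y2 <= p * z2 by rewrite ler_pM2l.
  have w3 : (1 - alpha) * (y3 * t) <= (1 - alpha) * z3 by rewrite ler_pM2l//; lra.
  have -> : 2 * (p / 2 * y1 * (2 * t)) - p * y2 * -1 - (1 - alpha) * y3 * - (2 * t) =
    2 * (p * (y1 * t)) + p * y2 + 2 * ((1 - alpha) * (y3 * t)) by field.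
  by lra.
have B0 : 0 <= B by rewrite !addr_ge0// !mulr_ge0//; lra.
exists (B + p); first by lra.
move=> t /andP[t0 tr]; rewrite /gfun -/p; case: eqVneq => [_|tn0]; first by lra.
have tp : 0 < t by rewrite lt_def tn0.
have [|c] := @mvt_near _ N N1 0 t.
  by move=> s; rewrite subr0 (gtr0_norm tp) => st; apply: dN; lra.
rewrite subr0 (gtr0_norm tp) add0r => ct.
have -> : N 0 = 0 by rewrite /N expr0n/= addr0 !subr0 !powR1; ring.
rewrite subr0 -/(N t) => ->; rewrite mulfK//.
by have := N1B c ltac:(lra); lra.
Qed.

Lemma maxOn_ge (f : R -> R) (r t B : R) : (forall t, 0 <= t <= r -> f t <= B) -> 0 <= t <= r -> f t <= maxOn f r.
Proof.
move=> fB tr; apply: sup_ubound; last by exists t => //=; rewrite in_itv.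
by exists B => _ [s hs <-]; apply: fB; move: hs; rewrite /= in_itv.
Qed.

(** The prefactors increase with the radius and the maxima over [0, r] dominate the values at rho;
    comparing the products requires nonnegative factors, whence [hF_ge0] and [hF_gfun_ge0]. *)
Lemma growth_le (rho r : R) : 0 <= Cna k.+3 alpha -> 0 < rho -> rho <= r -> r < 1 ->
  Cna k.+3 alpha * growth rho <= Gfun k.+3 alpha r.
Proof.
move=> C0 rho0 rhor r1; have n2 := nRalpha; have a1 := alpha1.
have r01 : 0 <= r < 1 by apply/andP; split; lra.
have rho01 : 0 <= rho < 1 by apply/andP; split; lra.
have rhop : 0 < rho < 1 by apply/andP; split; lra.
have rhoI : 0 <= rho <= r by apply/andP; split; lra.
have qr : 0 < q r by apply: omr_gt0; rewrite ger0_norm; lra.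
have qq : q r <= q rho by nra.
have qrho : 0 < q rho by lra.
have E1 t : hyp2F1 (alpha / 2) ((nR + alpha) / 2 - 1) (nR / 2) (t ^+ 2) = hF k.+1 lam1 t.
  have e1 : alpha / 2 = nR / 2 - lam1 by rewrite /lam1; field.
  have e2 : (nR + alpha) / 2 - 1 = nR - 1 - lam1 by rewrite /lam1; field.
  by rewrite hyp2F1E e1 e2; exact: erefl.
have E2 t : hyp2F1 (alpha / 2 - 1) ((nR + alpha) / 2 - 2) (nR / 2) (t ^+ 2) = hF k.+1 lam2 t.
  have e1 : alpha / 2 - 1 = nR / 2 - lam2 by rewrite /lam2; field.
  have e2 : (nR + alpha) / 2 - 2 = nR - 1 - lam2 by rewrite /lam2; field.
  by rewrite hyp2F1E e1 e2; exact: erefl.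
rewrite /Gfun; move: (Cna k.+3 alpha) C0 => C C0.
under [fun t : R => hyp2F1 (alpha / 2) _ _ _]eq_fun do rewrite E1.
under [fun t : R => hyp2F1 (alpha / 2 - 1) _ _ _]eq_fun do rewrite E2.
under [fun t : R => hyp2F1 _ _ _ _ * _]eq_fun do rewrite E2.
have [B1 B1P] := has_ubound_hF lam1 r01; have [B2 B2P] := has_ubound_hF lam2 r01.
have [B3 B30 B3P] := gfun_bounded r01.
have m1 := maxOn_ge B1P rhoI; have m2 := maxOn_ge B2P rhoI.
have B4P t : 0 <= t <= r -> hF k.+1 lam2 t * gfun k.+3 alpha t <= B2 * B3.
  move=> tr; have t01 : 0 <= t < 1 by case/andP : tr => ? ?; apply/andP; split; lra.
  apply: (@le_trans _ _ (hF k.+1 lam2 t * B3)); first by apply: ler_wpM2l; [exact: hF_ge0|exact: B3P].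
  by apply: ler_wpM2r => //; exact: B2P.
have m3 := maxOn_ge B4P rhoI.
have h1 := hF_ge0 lam1 rho01; have h2 := hF_ge0 lam2 rho01; have h3 := hF_gfun_ge0 rhop.
rewrite /growth [leLHS]mulrDr [X in X + _ <= _]mulrDr; apply: lerD; [apply: lerD|].
- rewrite mulrA; apply: ler_pM => //.
    by rewrite !mulr_ge0 ?invr_ge0 ?(ltW qrho)//; lra.
  rewrite (_ : C * _ = 2 * (1 - alpha) * C / q rho); last by ring.
  apply: ler_wpM2l; first by rewrite !mulr_ge0//; lra.
  by rewrite lef_pV2 ?posrE.
- rewrite mulrA; apply: ler_pM => //.
    by rewrite !mulr_ge0 ?invr_ge0 ?exprn_ge0 ?(ltW qrho)//; lra.
  rewrite (_ : C * _ = (nR - alpha) * C / q rho ^+ 2); last by ring.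
  apply: ler_wpM2l; first by rewrite !mulr_ge0//; lra.
  by rewrite lef_pV2 ?posrE ?exprn_gt0// ler_pXn2r ?nnegrE//; exact: ltW.
- rewrite mulrA; apply: ler_pM => //.
    by rewrite !mulr_ge0 ?invr_ge0 ?powR_ge0//; lra.
  rewrite (_ : C * _ = (nR - alpha) * C / q rho `^ (3 - alpha)); last by ring.
  apply: ler_wpM2l; first by rewrite !mulr_ge0//; lra.
  rewrite lef_pV2 ?posrE ?powR_gt0//; apply: ge0_ler_powR; rewrite ?nnegrE; lra.
Qed.
End KernelGrowth.

(** * Univalence and covering *)

Section BoundedRepresentative.
Context {R : realType}.

Lemma measurable_enorm_tuple (d : measure_display) (T : measurableType d) n (f : T -> 'rV[R]_n) :
  (forall i, measurable_fun setT (fun t => f t 0 i)) ->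
  measurable_fun setT (fun t => enorm (f t)).
Proof.
move=> mf; rewrite /enorm.
apply: (measurableT_comp (continuous_measurable_fun (@sqrt_continuous R))).
by apply: measurable_sum => i; exact: measurable_funX.
Qed.

(** phi is measurable on the sphere only and bounded off a null set, whereas [sbd] asks for global
    measurability and a bound at every point of the sphere; so phi is replaced by 0 off the sphere
    and where its norm exceeds M. *)
Lemma bounded_representative k (phi : 'rV[R]_k.+1 -> 'rV[R]_k.+1) (M : R) : 0 <= M ->
  Linfty_sphere_bounded phi M ->
  exists psi : 'rV[R]_k.+1 -> 'rV[R]_k.+1, [/\ forall i, sbd (fun z => psi z 0 i),
    forall z, enorm (psi z) <= M &
    forall (f : 'rV[R]_k.+1 -> R) i,
      measurable_fun setT (fun t : k.+1.-tuple R => f (to_rV t)) ->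
      sphere_int (fun z => (f z * phi z 0 i)%:E) = sphere_int (fun z => (f z * psi z 0 i)%:E)].
Proof.
move=> M0 [mphi sN].
pose D : set (k.+1.-tuple R) := @to_rV R k.+1 @^-1` (@unit_sphere R k.+1).
have me : measurable_fun setT (fun t : k.+1.-tuple R => enorm (to_rV t)).
  apply: measurable_enorm_tuple => i.
  by under eq_fun do rewrite mxE; exact: measurable_tnth.
have mD : measurable D.
  have := me measurableT _ (measurable_set1 (1 : R)); rewrite setTI.
  by congr (measurable _).
pose phi1 z := if enorm z == 1 then phi z else 0.
have phi1E z : enorm z = 1 -> phi1 z = phi z by move=> z1; rewrite /phi1 z1 eqxx.
have m1 i : measurable_fun setT (fun t : k.+1.-tuple R => phi1 (to_rV t) 0 i).
  have h := (measurable_restrictT _ mD).1 (mphi i).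
  have := measurable_funM (measurable_indic mD) h.
  congr measurable_fun; apply/funext => t /=; rewrite /phi1 patchE indicE.
  have [tD|tD] := boolP (t \in D).
    by move/set_mem : (tD) => /= ->; rewrite eqxx mul1r.
  rewrite mul0r; case: eqP => [e|_]; last by rewrite mxE.
  by move: tD; rewrite mem_set.
pose b z := enorm (phi1 z).
have mb : measurable_fun setT (fun t : k.+1.-tuple R => b (to_rV t)) by exact: measurable_enorm_tuple.
pose psi z := if b z <= M then phi1 z else 0.
have mpsi i : measurable_fun setT (fun t : k.+1.-tuple R => psi (to_rV t) 0 i).
  have := measurable_fun_ifT (measurable_fun_ler mb (measurable_cst M)) (m1 i) (measurable_cst (0:R)).
  congr measurable_fun; apply/funext => t; rewrite /psi; case: ifP => // _.
  by rewrite mxE.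
have psiM z : enorm (psi z) <= M by rewrite /psi; case: ifP => // _; rewrite enorm0.
exists psi; split => //.
  move=> i; split; first exact: mpsi.
  exists M => z _; apply: le_trans (psiM z).
  rewrite -(ler_pXn2r (n := 2)) ?nnegrE ?enorm_ge0// sqr_enorm real_normK ?num_real//.
  by rewrite (bigD1 i)//= lerDl sumr_ge0// => j _; exact: sqr_ge0.
move=> f i mf.
rewrite (@eq_sphere_int _ _ _ (fun z => (f z * phi1 z 0 i)%:E)); last by move=> z z1; rewrite phi1E.
pose N := [set z | M < b z].
apply: (@sphere_int_null _ _ N).
- by apply/measurable_EFinP; apply: measurable_funM => //; exact: m1.
- by apply/measurable_EFinP; apply: measurable_funM => //; exact: mpsi.
- apply/measurable_EFinP.
  have := measurable_fun_ifT (measurable_fun_ltr (measurable_cst M) mb) (measurable_cst (1:R)) (measurable_cst (0:R)).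
  congr measurable_fun; apply/funext => t; rewrite indicE /N.
  by case: ifP => h; [rewrite mem_set|rewrite memNset//=; rewrite h].
- rewrite -sN /sigma/=; apply: eq_sphere_int => z z1; rewrite !indicE.
  suff -> : (z \in N) = (z \in [set z | M < enorm (phi z)]) by [].
  by apply/idP/idP => /set_mem/= h; apply/mem_set; move: h; rewrite /N/= /b phi1E.
- move=> z /negP; rewrite -leNgt => h; by rewrite /psi h.
Qed.
End BoundedRepresentative.

(** * Topology of the Euclidean norm; injectivity and Newton's map *)

Section Covering.
Context {R : realType}.
Variable n : nat.
Notation V := 'rV[R]_n.+1.

(** Row vectors carry the topology of the maximum norm; this comparison transfers Euclidean
    Lipschitz estimates to it. *)
Lemma enorm_le_norm (x : V) : enorm x <= n.+1%:R * `|x|.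
Proof.
have x0 : 0 <= `|x| by [].
have hi i : `|x 0 i| <= `|x|.
  rewrite [leRHS]/Num.norm/= mx_normrE.
  exact: (@le_bigmax _ _ _ 0 (fun ij : 'I_1 * 'I_n.+1 => `|x ij.1 ij.2|) (0, i)).
have n1 : 1 <= n.+1%:R :> R by rewrite ler1n.
rewrite -(ler_pXn2r (n := 2)) ?nnegrE ?enorm_ge0 ?mulr_ge0// sqr_enorm exprMn.
apply: (@le_trans _ _ (\sum_(i < n.+1) `|x| ^+ 2)).
  apply: ler_sum => i _; rewrite -(real_normK (num_real (x 0 i))).
  by rewrite ler_pXn2r ?nnegrE.
rewrite sumr_const card_ord -[leLHS]mulr_natl ler_wpM2r ?exprn_ge0// expr2.
by rewrite ler_peMl.
Qed.

Lemma ler_dist_enorm (x y : V) : `|enorm x - enorm y| <= enorm (x - y).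
Proof.
have h1 := ler_enormB x y; have h2 := ler_enormB y x; rewrite (enormB y) in h2.
by rewrite ler_norml; apply/andP; split; lra.
Qed.

Lemma enorm_lipschitz_continuous (A : set V) (f : V -> R) (L : R) : 0 < L ->
  (forall x y, A x -> A y -> `|f x - f y| <= L * enorm (x - y)) ->
  {within A, continuous f}.
Proof.
move=> L0 H; apply/subspace_continuousP => x Ax.
apply/cvgrPdist_le => e e0.
have n0 : 0 < n.+1%:R :> R by rewrite ltr0n.
have e'0 : 0 < (L * n.+1%:R)^-1 * e by rewrite mulr_gt0// invr_gt0 mulr_gt0.
have nx : nbhs x [set y | `|x - y| <= (L * n.+1%:R)^-1 * e].
  by apply/nbhs_ballP; exists ((L * n.+1%:R)^-1 * e) => //= y; rewrite -ball_normE /= => /ltW.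
have nx' : within A (nbhs x) [set y | `|x - y| <= (L * n.+1%:R)^-1 * e].
  by apply: filterS nx => y h _.
near=> y.
have Ay : A y by near: y; exact: withinT.
apply: le_trans (H _ _ Ax Ay) _.
apply: (@le_trans _ _ (L * (n.+1%:R * `|x - y|))).
  by rewrite ler_pM2l// enorm_le_norm.
rewrite mulrA -ler_pdivlMl ?mulr_gt0//.
by near: y; exact: nx'.
Unshelve. all: end_near. Qed.

Lemma compact_enorm_ball (rho : R) : compact [set x : V | enorm x <= rho].
Proof.
apply: bounded_closed_compact.
  exists rho; split; first exact: num_real.
  move=> M rM x /= xr; apply: le_trans (ltW rM).
  apply: le_trans xr; rewrite [leLHS]/Num.norm/= mx_normrE.
  apply: bigmax_le; first exact: enorm_ge0.
  move=> [i j] _ /=; rewrite (ord1 i).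
  rewrite -(ler_pXn2r (n := 2)) ?nnegrE ?enorm_ge0// sqr_enorm real_normK ?num_real//.
  by rewrite (bigD1 j)//= lerDl sumr_ge0// => l _; exact: sqr_ge0.
have ce : continuous (@enorm R n.+1).
  apply/continuous_subspace_setT; apply: (@enorm_lipschitz_continuous _ _ 1) => // x y _ _.
  by rewrite mul1r; exact: ler_dist_enorm.
rewrite (_ : [set x | _] = @enorm R n.+1 @^-1` [set r | r <= rho])//.
by apply: closed_comp => [x _|]; [exact: ce|exact: closed_le].
Qed.

(* Newton's map [x - (u x - w) A^-1] contracts a ball slightly smaller than [r0]
   into itself; a point of least displacement is a fixed point. *)
Lemma univalent_covering (u : V -> V) (A : 'M[R]_n.+1) (K r0 : R) : 0 < K -> 0 < r0 ->
  (forall x y rho, rho <= r0 -> enorm x <= rho -> enorm y <= rho ->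
     enorm (u x - u y - (x - y) *m A) <= K * rho * enorm (x - y)) ->
  (forall x, enorm x <= r0 -> enorm (u x - x *m A) <= K * enorm x ^+ 2 / 2) ->
  (forall v, K * r0 * enorm v <= enorm (v *m A)) ->
  (forall x y, enorm x < r0 -> enorm y < r0 -> u x = u y -> x = y) /\
  (forall w, enorm w < K * r0 ^+ 2 / 2 -> exists2 x, enorm x < r0 & u x = w).
Proof.
move=> K0 r00 H1 H2 H3; split.
  move=> x y xr yr uxy; apply/eqP; rewrite -subr_eq0 -enorm_eq0.
  pose rho := Num.max (enorm x) (enorm y).
  have rr : rho < r0 by rewrite gt_max xr yr.
  have := H1 x y rho (ltW rr); rewrite !le_max !lexx orbT => /(_ isT isT).
  rewrite uxy subrr sub0r enormN => h.
  have := le_trans (H3 _) h.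
  have := enorm_ge0 (x - y); set e := enorm (x - y) => e0 h'.
  rewrite eq_le e0 andbT leNgt; apply/negP => ep.
  by move: h'; rewrite ler_pM2r// ler_pM2l//; lra.
move=> w wR.
have uA : A \in unitmx.
  rewrite -row_free_unit; apply: inj_row_free => v vA.
  apply/eqP; rewrite -enorm_eq0 eq_le enorm_ge0 andbT.
  have := H3 v; rewrite vA enorm0 pmulr_rle0//; exact: mulr_gt0.
pose T x := x - (u x - w) *m invmx A.
have TA x : T x *m A = x *m A - u x + w by rewrite mulmxBl mulmxKV// opprB addrA addrAC.
have Kr0 : 0 < K * r0 by exact: mulr_gt0.
pose dl := K * r0 ^+ 2 / 2 - enorm w.
have dl0 : 0 < dl by rewrite subr_gt0.
(* With rho = r0 - d one has K r0 rho - K rho^2 / 2 = K (r0^2 - d^2) / 2, so the ball of radius rho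
   is mapped into itself as soon as K d^2 / 2 <= [dl]. *)
pose d := Num.min r0 (Num.min 1 (dl / K)).
have d0 : 0 < d by rewrite !lt_min r00 ltr01 divr_gt0.
have [d1 d2 d3] : [/\ d <= r0, d <= 1 & d * K <= dl].
  rewrite -ler_pdivlMr//; split; first by rewrite ge_min lexx.
    by rewrite !ge_min lexx orbT.
  by rewrite !ge_min lexx !orbT.
pose rho := r0 - d.
have rho0 : 0 <= rho by rewrite subr_ge0.
have rr : rho < r0 by rewrite /rho; lra.
have hw : K * rho ^+ 2 / 2 + enorm w <= K * r0 * rho.
  have : K * d ^+ 2 <= dl by apply: le_trans d3; rewrite mulrC ler_pM2r// expr2 ler_piMl// ltW.
  by rewrite /dl /rho; nra.
pose Bl : set V := [set x | enorm x <= rho].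
have TB x : Bl x -> Bl (T x).
  rewrite /Bl/= => xr; rewrite -(ler_pM2l Kr0); apply: le_trans (H3 _) _; rewrite TA.
  apply: le_trans hw; apply: le_trans (ler_enormD _ _) _; rewrite lerD2r enormB.
  have xr0 : enorm x <= r0 by lra.
  apply: le_trans (H2 _ xr0) _; rewrite ler_pM2r// ler_pM2l//.
  by rewrite ler_pXn2r ?nnegrE ?enorm_ge0.
have TL x y : Bl x -> Bl y -> K * r0 * enorm (T x - T y) <= K * rho * enorm (x - y).
  rewrite /Bl/= => xr yr; apply: le_trans (H3 _) _; rewrite mulmxBl !TA.
  apply: le_trans (H1 _ _ _ (ltW rr) xr yr).
  rewrite -enormN le_eqVlt; apply/orP; left; apply/eqP; congr enorm.
  by rewrite mulmxBl; apply/rowP => i; rewrite !mxE; ring.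
have TL1 x y : Bl x -> Bl y -> enorm (T x - T y) <= enorm (x - y).
  move=> xr yr; have := TL _ _ xr yr; have := enorm_ge0 (x - y).
  set e := enorm (x - y); set e' := enorm _ => e0 h.
  rewrite -(ler_pM2l Kr0); apply: le_trans h _; rewrite ler_wpM2r// ler_pM2l//; lra.
have cf : {within Bl, continuous (fun x => enorm (T x - x))}.
  apply: (@enorm_lipschitz_continuous _ _ 2) => // x y xr yr.
  apply: le_trans (ler_dist_enorm _ _) _.
  have -> : T x - x - (T y - y) = (T x - T y) - (x - y) by apply/rowP => i; rewrite !mxE; ring.
  apply: le_trans (ler_enormD _ _) _; rewrite enormN.
  by have := TL1 _ _ xr yr; lra.
have B0 : Bl !=set0 by exists 0; rewrite /Bl/= enorm0.
have [x xB xmin] := EVT_min_rV B0 (@compact_enorm_ball rho) cf.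
have {}xB : Bl x by rewrite inE in xB.
exists x; first by apply: le_lt_trans rr.
have := xmin (T x); rewrite mem_set; last exact: TB.
move=> /(_ isT); have := TL _ _ (TB _ xB) xB.
have := enorm_ge0 (T x - x); set e := enorm (T x - x); set e' := enorm _ => e0 h1 h2.
have ez : e = 0.
  apply/eqP; rewrite eq_le e0 andbT leNgt; apply/negP => ep.
  have : K * r0 * e <= K * rho * e by apply: le_trans h1; rewrite ler_pM2l.
  by rewrite ler_pM2r// ler_pM2l//; lra.
move/eqP : ez; rewrite enorm_eq0 subr_eq0 => /eqP Tx.
have := TA x; rewrite Tx => /eqP; rewrite -subr_eq0 => /eqP h.
apply/eqP; rewrite -subr_eq0; apply/eqP; rewrite -[RHS]h.
by apply/rowP => i; rewrite !mxE; ring.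
Qed.
End Covering.

(** The mean value theorem for f(s) - d s - c s^2 / 2. The case c = 0 gives the Lipschitz estimate;
    with c matched to a gradient bound linear in s it yields the factor 1/2 that an integral would
    give. *)
Lemma mvt_quad {R : realType} (f f1 : R -> R) (d c : R) :
  (forall s : R, 0 <= s <= 1 -> is_derive s 1 f (f1 s)) ->
  exists2 s, 0 <= s <= 1 & f 1 - f 0 - d - c / 2 = f1 s - d - c * s.
Proof.
move=> df; pose F (s : R) := f s - s * d - c / 2 * s ^+ 2.
have dF (s : R) : 0 <= s <= 1 -> is_derive s 1 F (f1 s - d - c * s).
  by move=> /df ds; rewrite /F; apply: is_derive_eq; rewrite /GRing.scale/=; field.
have F01 : {within `[0, 1], continuous F}.
  apply: derivable_within_continuous => s; rewrite in_itv/= => s01.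
  by have [] := dF s s01.
have D01 : forall s : R, s \in `]0, 1[ -> is_derive s 1 F (f1 s - d - c * s).
  by move=> s; rewrite in_itv/= => /andP[a b]; apply: dF; rewrite !ltW.
have [s] := @MVT_segment R F (fun s => f1 s - d - c * s) 0 1 ler01 D01 F01.
rewrite in_itv/= => s01; rewrite subr0 mulr1 => Es; exists s => //.
by rewrite -Es /F; ring.
Qed.

Lemma is_derive_dir {R : realType} n (p : 'rV[R]_n.+1 -> R) (e : 'rV[R]_n.+1) (g : R -> R) (d : R) :
  (forall s, p (s *: e) = g s) -> is_derive (0 : R) 1 g d ->
  is_derive (0 : 'rV[R]_n.+1) e p d.
Proof.
move=> gE [d1 d2]; have g0 : p 0 = g 0 by rewrite -gE scale0r.
have E : (fun h : R => h^-1 *: ((p \o shift 0) (h *: e) - p 0)) =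
         (fun h : R => h^-1 *: ((g \o shift 0) (h *: 1) - g 0)).
  apply/funext => h; rewrite g0 /=; congr (_ *: (_ - _)).
  by rewrite addr0 gE; congr g; rewrite addr0; exact/esym/mulr1.
by apply: DeriveDef; rewrite ?/derivable ?/derive E.
Qed.

(** * The Poisson map and its differential at the origin *)

Section PoissonMap.
Context {R : realType}.
Variables (k : nat) (alpha : R) (B : R).
Notation nR := (k.+3%:R : R).
Notation V := 'rV[R]_k.+3.
Notation knf := (kn (1 - alpha) (- lam1 k alpha)).
Notation kdf := (kd (1 - alpha) (- lam1 k alpha)).
Variable psi : V -> V.
Hypothesis alpha1 : alpha < 1.
Hypothesis psi_sbd : forall i, sbd (fun z => psi z 0 i).
Hypothesis psi_le : forall z, enorm (psi z) <= B.

(** The constant of the kernel is moved into psi, so B stands for [Cna] times M. The matrix [pjac]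
    acts on row vectors from the right and is thus the transpose of the Jacobian at 0. *)
Definition pmap (x : V) : V := \row_i sint (fun z => knf x z * psi z 0 i).
Definition pjac : 'M[R]_k.+3 :=
  \matrix_(j, i) ((nR - alpha) * sint (fun z => z 0 j * psi z 0 i)).

Let B_ge0 : 0 <= B.
Proof. exact: le_trans (enorm_ge0 _) (psi_le 0). Qed.

Lemma sbd_psi_dotp (w : V) : sbd (fun z => dotp (psi z) w).
Proof. by apply: sbd_sum => i; apply: sbdM => //; exact: sbd_cst. Qed.

Lemma psi_dotp_le (w z : V) : `|dotp (psi z) w| <= B * enorm w.
Proof.
apply: le_trans (cauchy_schwarz _ _) _.
by apply: ler_wpM2r; [exact: enorm_ge0|exact: psi_le].
Qed.

Lemma sint_dotp (f : V -> R) (w : V) : sbd f ->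
  \sum_i sint (fun z => f z * psi z 0 i) * w 0 i = sint (fun z => f z * dotp (psi z) w).
Proof.
move=> sf.
rewrite (@eq_sint _ _ _ (fun z => \sum_i w 0 i * (f z * psi z 0 i))); last first.
  by move=> z _; rewrite /dotp mulr_sumr; apply: eq_bigr => i _; ring.
have h i : sbd (fun z => f z * psi z 0 i) by exact: sbdM.
rewrite sint_sum; last by move=> i; apply: sbdM => //; exact: sbd_cst.
by apply: eq_bigr => i _; rewrite sintZ// mulrC.
Qed.

Lemma dotp_pmap (x w : V) : enorm x < 1 ->
  dotp (pmap x) w = sint (fun z => knf x z * dotp (psi z) w).
Proof.
move=> x1; rewrite -sint_dotp; last exact: sbd_kn.
by apply: eq_bigr => i _; rewrite mxE.
Qed.

Lemma dotp_pjac (v w : V) :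
  dotp (v *m pjac) w = sint (fun z => kdf 0 v z * dotp (psi z) w).
Proof.
transitivity (sint (fun z => (nR - alpha) * dotp z v * dotp (psi z) w)); last first.
  by apply: eq_sint => z z1; rewrite kd0.
have sv : sbd (fun z => (nR - alpha) * dotp z v).
  by apply: sbdM; [exact: sbd_cst|exact: sbd_dotp].
rewrite -sint_dotp//; apply: eq_bigr => i _; congr (_ * _).
rewrite mxE (@eq_sint _ _ _ (fun z => \sum_j ((nR - alpha) * v 0 j) * (z 0 j * psi z 0 i))); last first.
  by move=> z _; rewrite /dotp mulr_sumr mulr_suml; apply: eq_bigr => j _; ring.
have h j : sbd (fun z : V => z 0 j * psi z 0 i) by apply: sbdM => //; exact: sbd_coord.
rewrite sint_sum; last by move=> j; apply: sbdM => //; exact: sbd_cst.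
by apply: eq_bigr => j _; rewrite mxE sintZ//; ring.
Qed.

Lemma pjac_le (v : V) : enorm (v *m pjac) <=
  B * (nR - alpha) * (Gamma (nR / 2) / (Num.sqrt pi * Gamma ((nR + 1) / 2))) * enorm v.
Proof.
have n2 := nRalpha k alpha1; have B0 := B_ge0.
have n0 : 0 <= nR - alpha by lra.
rewrite -wmean_norm; set W := wmean _ _.
have W0 : 0 <= W.
  rewrite -[leLHS](wmean_cst k.+1); apply: le_wmean => //; first exact: mbd_cst.
  by apply: mbd_continuous; exact: norm_continuous.
apply: enorm_le_dual => [|w]; first by do !apply: mulr_ge0 => //; exact: enorm_ge0.
rewrite dotp_pjac; apply: le_trans (ler_norm _) _.
have sv : sbd (fun z : V => `|dotp z v|) by apply: sbd_norm; exact: sbd_dotp.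
pose c := (nR - alpha) * (B * enorm w).
apply: (@le_trans _ _ (sint (fun z : V => c * `|dotp z v|))).
  apply: normr_sint.
  - by apply: sbdM; [apply: sbd_kd; rewrite enorm0|exact: sbd_psi_dotp].
  - by apply: sbdM => //; exact: sbd_cst.
  - move=> z z1; rewrite kd0// !normrM (gtr0_norm (_ : 0 < nR - alpha)); last by lra.
    rewrite /c -!mulrA ler_pM2l; last by lra.
    rewrite mulrC [leRHS]mulrA; apply: ler_wpM2r => //; exact: psi_dotp_le.
rewrite sintZ//.
rewrite (sint_zonal v (@norm_continuous R R)).
rewrite (@eq_wmean _ _ _ (fun t => enorm v * `|t|)); last first.
  by move=> t _; rewrite normrM ger0_norm ?enorm_ge0.
rewrite wmeanZ; last by apply: mbd_continuous; exact: norm_continuous.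
by rewrite -/W /c le_eqVlt; apply/orP; left; apply/eqP; ring.
Qed.

Lemma is_derive_pmap (x v w : V) (s : R) : enorm (x + s *: v) < 1 ->
  is_derive s 1 (fun s => sint (fun z => knf (x + s *: v) z * dotp (psi z) w))
    (sint (fun z => kdf (x + s *: v) v z * dotp (psi z) w)).
Proof. by move=> h; apply: is_derive_sint_kn => //; exact: sbd_psi_dotp. Qed.

Lemma kd_diff_growth (x v w : V) : enorm x < 1 ->
  sint (fun z => kdf x v z * dotp (psi z) w) - dotp (v *m pjac) w <=
  B * growth k alpha (enorm x) * enorm x * enorm v * enorm w.
Proof.
move=> x1; rewrite dotp_pjac.
have s1 : sbd (kdf x v) by exact: sbd_kd.
have s0 : sbd (kdf 0 v) by apply: sbd_kd; rewrite enorm0.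
have sw := sbd_psi_dotp w.
rewrite -sintB; [|exact: sbdM|exact: sbdM].
have sd : sbd (fun z => `|kdf x v z - kdf 0 v z|) by apply: sbd_norm; exact: sbdB.
apply: le_trans (ler_norm _) _.
apply: (@le_trans _ _ (sint (fun z => (B * enorm w) * `|kdf x v z - kdf 0 v z|))).
  apply: normr_sint.
  - by apply: sbdB; exact: sbdM.
  - by apply: sbdM => //; exact: sbd_cst.
  - move=> z z1; rewrite -mulrBl normrM mulrC; apply: ler_wpM2r => //; exact: psi_dotp_le.
rewrite sintZ//.
apply: le_trans (ler_wpM2l _ (sint_kd_diff alpha1 v x1)) _.
  by rewrite mulr_ge0// enorm_ge0.
by rewrite le_eqVlt; apply/orP; left; apply/eqP; ring.
Qed.

Section Estimates.
Variables (K r0 : R).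
Hypothesis r01 : r0 < 1.
Hypothesis K_ge0 : 0 <= K.
Hypothesis growthK : forall t, 0 < t -> t <= r0 -> B * growth k alpha t <= K.

Lemma kd_diff_K (x v w : V) : enorm x <= r0 ->
  sint (fun z => kdf x v z * dotp (psi z) w) - dotp (v *m pjac) w <=
  K * enorm x * enorm v * enorm w.
Proof.
move=> xr; have x1 : enorm x < 1 by apply: le_lt_trans xr r01.
apply: le_trans (kd_diff_growth _ _ x1) _.
have [x0|xn0] := eqVneq (enorm x) 0; first by rewrite x0 !mulr0 !mul0r.
have xp : 0 < enorm x by rewrite lt_def xn0 enorm_ge0.
do 3! (apply: ler_wpM2r; first exact: enorm_ge0).
exact: growthK.
Qed.

Lemma pmap_mvt (x v w : V) (c : R) : (forall s, 0 <= s <= 1 -> enorm (x + s *: v) <= r0) ->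
  exists2 s, 0 <= s <= 1 &
    dotp (pmap (x + v) - pmap x - v *m pjac) w - c / 2 =
    sint (fun z => kdf (x + s *: v) v z * dotp (psi z) w) - dotp (v *m pjac) w - c * s.
Proof.
move=> H; have H1 s : 0 <= s <= 1 -> enorm (x + s *: v) < 1.
  by move=> /H h; apply: le_lt_trans h r01.
pose f s := sint (fun z => knf (x + s *: v) z * dotp (psi z) w).
pose f1 s := sint (fun z => kdf (x + s *: v) v z * dotp (psi z) w).
have df (s : R) : 0 <= s <= 1 -> is_derive s 1 f (f1 s).
  by move=> s01; apply: is_derive_pmap; exact: H1.
have [s s01 Es] := mvt_quad (dotp (v *m pjac) w) c df; exists s => //.
rewrite -[RHS]Es /f; have h1 : enorm (x + v) < 1.
  by have := H1 1; rewrite scale1r; apply; rewrite ler01 lexx.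
have h0 : enorm x < 1.
  by have := H1 0; rewrite scale0r addr0; apply; rewrite ler01 lexx.
by rewrite scale1r scale0r addr0 -(dotp_pmap w h1) -(dotp_pmap w h0) !dotpBl.
Qed.

Lemma pmap_diff_le (x y : V) (rho : R) : rho <= r0 -> enorm x <= rho -> enorm y <= rho ->
  enorm (pmap x - pmap y - (x - y) *m pjac) <= K * rho * enorm (x - y).
Proof.
move=> rr xr yr; have K0 := K_ge0.
have rho0 : 0 <= rho by apply: le_trans xr; exact: enorm_ge0.
have H s : 0 <= s <= 1 -> enorm (y + s *: (x - y)) <= rho.
  move=> /andP[s0 s1]; have -> : y + s *: (x - y) = (1 - s) *: y + s *: x.
    by apply/rowP => i; rewrite !mxE; ring.
  apply: le_trans (ler_enormD _ _) _; rewrite !enormZ !ger0_norm ?subr_ge0//.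
  by nra.
apply: enorm_le_dual => [|w]; first by rewrite !mulr_ge0// enorm_ge0.
have [|s s01] := @pmap_mvt y (x - y) w 0; first by move=> s /H h; exact: le_trans rr.
have yx : y + (x - y) = x by rewrite addrC subrK.
have E (a b : R) : a - 0 / 2 = b - 0 * s -> a = b by rewrite !mul0r !subr0.
move/E; rewrite yx => {E} ->.
apply: le_trans (kd_diff_K _ _ (le_trans (H s s01) rr)) _.
apply: ler_wpM2r; first exact: enorm_ge0.
apply: ler_wpM2r; first exact: enorm_ge0.
by apply: ler_wpM2l => //; exact: H.
Qed.

Lemma pmap_le (x : V) : pmap 0 = 0 -> enorm x <= r0 ->
  enorm (pmap x - x *m pjac) <= K * enorm x ^+ 2 / 2.
Proof.
move=> u0 xr; have K0 := K_ge0.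
apply: enorm_le_dual => [|w]; first by rewrite !mulr_ge0// ?exprn_ge0// enorm_ge0.
have H s : 0 <= s <= 1 -> enorm (0 + s *: x) <= r0.
  move=> /andP[s0 s1]; rewrite add0r enormZ ger0_norm//.
  by apply: le_trans xr; rewrite ler_piMl// enorm_ge0.
(* The gradient difference at s x is bounded by s times this c, which the quadratic correction
   cancels. *)
have [s s01] := @pmap_mvt 0 x w (K * enorm x ^+ 2 * enorm w) H.
rewrite add0r u0 subr0 => h.
have := kd_diff_K x w (H s s01); rewrite !add0r enormZ in h *.
case/andP : s01 => s0 s1; rewrite ger0_norm//.
move: h; set a := sint _ - _; set b := dotp _ _ => h h2.
have : K * (s * enorm x) * enorm x * enorm w = K * enorm x ^+ 2 * enorm w * s by ring.
by move=> E; rewrite E in h2; lra.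
Qed.
End Estimates.

Lemma dotp_delta (x : V) i : dotp x (delta_mx 0 i) = x 0 i.
Proof.
rewrite /dotp (bigD1 i)//= big1 ?addr0; first by rewrite mxE !eqxx mulr1.
by move=> l li; rewrite mxE eqxx (negbTE li) mulr0.
Qed.

Lemma jacobian_pmap : Defs.jacobian pmap 0 = pjac^T.
Proof.
have D i j : is_derive (0 : V) (delta_mx 0 j) (fun x => pmap x 0 i) (pjac j i).
  pose e : V := delta_mx 0 j.
  pose g (s : R) : R := sint (fun z => knf (0 + s *: e) z * dotp (psi z) (delta_mx 0 i)).
  have d : is_derive (0 : R) 1 g (pjac j i).
    have h0 : enorm (0 + 0 *: e) < 1 by rewrite scale0r addr0 enorm0.
    apply: (is_derive_eq (is_derive_pmap (delta_mx 0 i) h0)).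
    by rewrite scale0r addr0 -dotp_pjac dotp_delta -rowE mxE.
  have gE s : pmap (s *: e) 0 i = g s.
    by rewrite /g add0r mxE; apply: eq_sint => z _; rewrite dotp_delta.
  exact: (is_derive_dir (p := fun x => pmap x 0 i) gE d).
apply/matrixP => i j; rewrite !mxE derive_mx; last first.
  by apply/derivable_mxP => a b; rewrite (ord1 a); have [] := D b j.
by rewrite mxE; have [_ ->] := D i j; rewrite mxE.
Qed.
End PoissonMap.

(** * Normalization of the kernel and the role of the determinant *)

Section Conclusion.
Context {R : realType}.

Lemma Gamma_ge0 (s : R) : 0 <= Gamma s.
Proof.
apply: fine_ge0; apply: integral_ge0 => t _.
by rewrite lee_fin mulr_ge0 ?powR_ge0 ?expR_ge0.
Qed.

Lemma Cna_ge0 n (alpha : R) : 0 <= Cna n alpha.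
Proof. by rewrite divr_ge0// mulr_ge0// Gamma_ge0. Qed.

Lemma PkerE k (alpha : R) (x z : 'rV[R]_k.+3) : alpha < 1 ->
  Pker alpha x z = Cna k.+3 alpha * kn (1 - alpha) (- lam1 k alpha) x z.
Proof.
move=> a1; have n2 := nRalpha k a1; rewrite /Pker /kn /kq /kp !dotpp -mulrA; congr (_ * (_ * _)).
rewrite powRN; congr (_^-1).
by rewrite -(powR_mulrn 2 (enorm_ge0 _)) -powRrM /lam1; congr (_ `^ _); field.
Qed.

Lemma Palpha_pmap k (alpha M : R) (phi : 'rV[R]_k.+3 -> 'rV[R]_k.+3) : alpha < 1 -> 0 <= M ->
  Linfty_sphere_bounded phi M ->
  exists psi : 'rV[R]_k.+3 -> 'rV[R]_k.+3, [/\ forall i, sbd (fun z => psi z 0 i),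
    forall z, enorm (psi z) <= Cna k.+3 alpha * M &
    Palpha alpha phi = pmap alpha psi].
Proof.
move=> a1 M0 /(bounded_representative M0)[psi [sp pM E]].
have C0 := Cna_ge0 k.+3 alpha.
exists (fun z => Cna k.+3 alpha *: psi z); split.
- by move=> i; under eq_fun do rewrite mxE; apply: sbdM => //; exact: sbd_cst.
- by move=> z; rewrite enormZ ger0_norm// ler_wpM2l.
apply/funext => x; apply/rowP => i.
have mP : measurable_fun setT (fun t : k.+3.-tuple R => Pker alpha x (to_rV t)).
  under eq_fun do rewrite PkerE//.
  apply: measurable_funM; first exact: measurable_cst.
  apply: measurable_funM; first exact: measurable_cst.
  by apply: (measurableT_comp (measurable_powR _)); exact: measurable_kp.
transitivity (sint (fun z => Pker alpha x z * psi z 0 i)).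
  by rewrite mxE; exact: (congr1 fine (E (Pker alpha x) i mP)).
by rewrite mxE; apply: eq_sint => z _; rewrite PkerE// mxE; ring.
Qed.

Lemma Gamma_half_dim_gt0 k : 0 < Gamma (k.+3%:R / 2 : R) /\ 0 < Gamma ((k.+3%:R + 1) / 2 : R).
Proof.
have E1 : k%:R / 2 + 3 / 2 = k.+3%:R / 2 :> R by rewrite -addn3 natrD; field.
have E2 : k.+1%:R / 2 + 3 / 2 = (k.+3%:R + 1) / 2 :> R by rewrite -addn3 -addn1 !natrD; field.
by rewrite -E1 -E2; split; exact: Gamma_half_gt0.
Qed.

(** c, d, ga, gb and s stand for [Cna], n - alpha, the two Gamma values and sqrt(pi), so that only
    algebra remains. The norm bound L satisfies M r0 G L^n = 1, which gives both G > 0 and the lower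
    bound for |v A|. *)
Lemma univalent_covering_det1 n (u : 'rV[R]_n.+1 -> 'rV[R]_n.+1) (A : 'M[R]_n.+1)
    (c d ga gb s M G r0 : R) :
  0 <= c -> 0 < d -> 0 < ga -> 0 < gb -> 0 < s -> 0 < M -> 0 < r0 -> \det A = 1 ->
  (forall v, enorm (v *m A) <= c * M * d * (ga / (s * gb)) * enorm v) ->
  M ^+ n.+1 * r0 * G = (s * gb / (d * c * ga)) ^+ n ->
  (0 <= M * G -> forall x y rho, rho <= r0 -> enorm x <= rho -> enorm y <= rho ->
     enorm (u x - u y - (x - y) *m A) <= M * G * rho * enorm (x - y)) ->
  (0 <= M * G -> forall x, enorm x <= r0 -> enorm (u x - x *m A) <= M * G * enorm x ^+ 2 / 2) ->
  (0 < n)%N ->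
  (forall x y, enorm x < r0 -> enorm y < r0 -> u x = u y -> x = y) /\
  (forall w, enorm w < M / 2 * r0 ^+ 2 * G -> exists2 x, enorm x < r0 & u x = w).
Proof.
move=> c0 d0 ga0 gb0 s0 M0 r00 A1 AL KE H1 H2 n0.
have H3 v := enorm_mulmx_ge v AL; rewrite A1 normr1 in H3.
have cp : 0 < c.
  (* [Cna] enters only as nonnegative; c = 0 would make the norm bound 0, against det A = 1. *)
  rewrite lt_def c0 andbT; apply/negP => /eqP cz.
  pose v : 'rV[R]_n.+1 := delta_mx 0 0.
  have := H3 v; rewrite cz !mul0r expr0n (gtn_eqF n0) !mul0r mul1r => h.
  have v0 : v = 0 by apply/eqP; rewrite -enorm_eq0 eq_le h enorm_ge0.
  by have /rowP/(_ 0) := v0; rewrite !mxE eqxx => /eqP; rewrite oner_eq0.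
move: H3; set L := c * M * d * _ => H3.
have L0 : 0 < L by rewrite !mulr_gt0// invr_gt0 mulr_gt0.
have KL : M * r0 * G * L ^+ n = 1.
  have M0' : M ^+ n != 0 by rewrite expf_neq0// gt_eqF.
  apply: (mulfI M0'); rewrite mulr1 !mulrA -exprSr KE -exprMn.
  by congr (_ ^+ _); rewrite /L; field; rewrite !gt_eqF.
have G0 : 0 < G.
  have : 0 < M * r0 * G * L ^+ n by rewrite KL.
  by rewrite pmulr_lgt0 ?exprn_gt0// pmulr_rgt0// mulr_gt0.
have K0 : 0 < M * G by exact: mulr_gt0.
have -> : M / 2 * r0 ^+ 2 * G = M * G * r0 ^+ 2 / 2 by field.
apply: (univalent_covering K0 r00 (H1 (ltW K0)) (H2 (ltW K0))) => v.
rewrite -(ler_pM2l (exprn_gt0 n L0)) mulrA.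
rewrite (_ : L ^+ n * _ = M * r0 * G * L ^+ n); last by ring.
by rewrite KL; exact: H3.
Qed.
End Conclusion.

Theorem theorem1p3 (R : realType) (n : nat) (alpha M : R)
  (phi : 'rV[R]_n -> 'rV[R]_n) (r0 : R) :
  (3 <= n)%N -> alpha < 1 -> 0 < M ->
  Linfty_sphere_bounded phi M ->
  Palpha alpha phi 0 = 0 ->
  Jdet (Palpha alpha phi) 0 = 1 ->
  0 < r0 < 1 ->
  M ^+ n * r0 * Gfun n alpha r0 = Kconst n alpha ->
  (forall r : R, 0 < r < r0 -> M ^+ n * r * Gfun n alpha r != Kconst n alpha) ->
  (forall x y : 'rV[R]_n, enorm x < r0 -> enorm y < r0 ->
     Palpha alpha phi x = Palpha alpha phi y -> x = y) /\
  (forall w : 'rV[R]_n, enorm w < M / 2 * r0 ^+ 2 * Gfun n alpha r0 ->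
     exists2 x : 'rV[R]_n, enorm x < r0 & Palpha alpha phi x = w).
Proof.
move=> n3 a1 M0 phiM u0 J1 /andP[r00 r01] KE _.
case: n phi n3 phiM u0 J1 KE => [|[|[|k]]] phi n3; try by exfalso; move: n3.
move=> phiM u0 J1 KE {n3}.
have [psi [sp pM uE]] := Palpha_pmap a1 (ltW M0) phiM.
rewrite uE in u0 J1 *.
have n2 := nRalpha k a1.
have C0 := Cna_ge0 k.+3 alpha.
rewrite /Jdet (jacobian_pmap _ sp) det_tr in J1.
have AL := pjac_le a1 sp pM.
have gK t : 0 < t -> t <= r0 -> Cna k.+3 alpha * M * growth k alpha t <= M * Gfun k.+3 alpha r0.
  move=> t0 tr; have := growth_le a1 C0 t0 tr r01.
  move: (Cna _ _) (growth _ _ _) (Gfun _ _ _) => c g G h.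
  by rewrite (mulrC c) -mulrA ler_pM2l.
move: (Gfun k.+3 alpha r0) KE gK => G KE gK.
have [ga0 gb0] := @Gamma_half_dim_gt0 R k.
have d0 : 0 < k.+3%:R - alpha by lra.
have s0 : 0 < Num.sqrt pi :> R by rewrite sqrtr_gt0 pi_gt0.
apply: (univalent_covering_det1 C0 d0 ga0 gb0 s0 M0 r00 J1 AL KE _ _ isT) => K0.
- by move=> x y rho; exact: (pmap_diff_le a1 sp pM r01 K0 gK).
- by move=> x; exact: (pmap_le a1 sp pM r01 K0 gK u0).
Qed.
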